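(* Let $d\in\mathbb N$, let $\Omega\subset\mathbb R^d$ be an open bounded Lipschitz domain and let $T>0$. Assume that: (1) $\rho\in C^1([0,T],L^\infty(\Omega))\cap C([0,T],H^1(\Omega))$ with $0<\underline\rho_0\le\rho(t,x)\le\underline\rho_1<\infty$ and $|\partial_t\rho(t,x)|\le\underline\rho_1'<\infty$; (2) $\eta\in C([0,T],L^\infty(\Omega))$ with $0<\underline\eta_0\le\eta(t,x)\le\underline\eta_1<\infty$; (3) $\kappa\in C^1([0,T],L^\infty(\Omega))$ with $0<\underline\kappa_0\le\kappa(t,x)\le\underline\kappa_1<\infty$ and $|\partial_t\kappa(t,x)|\le\underline\kappa_1'<\infty$; (4) $f:\mathbb R\to\mathbb R$ is Lipschitz continuous with constant $L_f$; (5) $\tilde u_0\in H^1_0(\Omega)$ and $\omega\in H^1_0(\Omega)$; (6) $p\in C([0,T],L^2(\Omega))$, and the function $\underline\omega(t):=\left(p(t),\frac{\omega}{\rho(t)}\right)$ satisfies $\underline\omega\in C([0,T])$ and $\underline\omega(t)\ne0$ for all $t\in[0,T]$; put $\underline\omega_m:=\min_{t\in[0,T]}|\underline\omega(t)|>0$; (7) $m\in H^1((0,T])$; (8) there is a positive constant $\zeta<1$ such that $$\|p\|_{\mathcal X}^2\,\frac{M^2\,\underline\eta_1^2}{4\,\underline\omega_m^2\,\underline\eta_0\,\underline\rho_0}<\zeta,\qquad M:=\sup_{t\in[0,T]}\left\|\nabla\left(\frac{\omega}{\rho(t)}\right)\right\|,\quad \mathcal X:=C([0,T],L^2(\Omega)).$$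 Then there exists at most one couple $\{u,h\}$ with $$h\in L^2(0,T),\qquad u\in C([0,T],H^1_0(\Omega)),\qquad \partial_tu\in L^2((0,T),H^1_0(\Omega)),$$ such that $u(0,\cdot)=\tilde u_0$ and, for a.a. $t\in(0,T)$, $$(\partial_t(\rho(t)u(t)),\varphi)+(\eta(t)\nabla\partial_tu(t),\nabla\varphi)+(\kappa(t)\nabla u(t),\nabla\varphi)=h(t)(p(t),\varphi)+(f(u(t)),\varphi)\quad\text{for all }\varphi\in H^1_0(\Omega),$$ with $$h(t)=\frac1{\underline\omega(t)}\left[m'(t)+\left(u(t),\frac{\omega\,\partial_t\rho(t)}{\rho(t)}\right)+\left(\eta(t)\nabla\partial_tu(t),\nabla\left(\frac{\omega}{\rho(t)}\right)\right)+\left(\kappa(t)\nabla u(t),\nabla\left(\frac{\omega}{\rho(t)}\right)\right)-\left(f(u(t)),\frac{\omega}{\rho(t)}\right)\right].$$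
   Context: $(\cdot,\cdot)$ is the $L^2(\Omega)$ inner product (for scalar or vector functions) and $\|\cdot\|$ the associated norm. The bounds $\underline\rho_0,\underline\rho_1,\underline\rho_1',\underline\eta_0,\underline\eta_1,\underline\kappa_0,\underline\kappa_1,\underline\kappa_1'$ are constants, and the pointwise bounds hold for all $t\in[0,T]$ and a.e. $x\in\Omega$. Condition (8) includes that $M<\infty$. $f(u(t))$ denotes the composition $x\mapsto f(u(t,x))$. This is the weak formulation of the inverse problem of finding $u,h$ with $\partial_t(\rho u)-\nabla\cdot(\eta\nabla\partial_tu)-\nabla\cdot(\kappa\nabla u)=f(u)+p\,h$ in $(0,T)\times\Omega$, $u=0$ on $(0,T)\times\partial\Omega$, $u(0)=\tilde u_0$, from the measurement $\int_\Omega u(t,x)\omega(x)\,dx=m(t)$. *)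

(* Defs.v *)
From HB Require Import structures.
From mathcomp Require Import all_boot all_order all_algebra.
From mathcomp Require Import all_classical all_reals all_analysis.

Set Implicit Arguments.
Unset Strict Implicit.
Unset Printing Implicit Defensive.

Import Order.TTheory GRing.Theory Num.Theory numFieldNormedType.Exports.

Local Open Scope classical_set_scope.
Local Open Scope ring_scope.

Definition rV_display : measure_display.
Proof. exact: default_measure_display. Qed.

(* The product sigma-algebra on R^n, i.e. its Borel sigma-algebra. *)
Section measurable_rV.
Context (R : realType) (n : nat).

Let coord (i : 'I_n) (v : 'rV[R]_n) : measurableTypeR R := v 0 i.

Let rV_set0 : g_sigma_preimage coord set0.
Proof. exact: sigma_algebra0. Qed.

Let rV_setC A : g_sigma_preimage coord A -> g_sigma_preimage coord (~` A).
Proof. exact: sigma_algebraC. Qed.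

Let rV_bigcup (F : _^nat) : (forall i, g_sigma_preimage coord (F i)) ->
  g_sigma_preimage coord (\bigcup_i (F i)).
Proof. exact: sigma_algebra_bigcup. Qed.

HB.instance Definition _ := @isMeasurable.Build rV_display
  'rV[R]_n (g_sigma_preimage coord) rV_set0 rV_setC rV_bigcup.

End measurable_rV.

(* [sigma_finiteT] does not find the library's instance for [m1 \x m2], which *)
(* is shadowed by the one for probabilities.                                  *)
Lemma sigma_finite_prod d1 d2 (T1 : measurableType d1) (T2 : measurableType d2)
    (R : realType) (m1 : {sigma_finite_measure set T1 -> \bar R})
    (m2 : {sigma_finite_measure set T2 -> \bar R}) :
  sigma_finite setT (m1 \x m2)%E.
Proof.
have /sigma_finiteP[F [TF ndF Foo]] := sigma_finiteT m1.
have /sigma_finiteP[G [TG ndG Goo]] := sigma_finiteT m2.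
exists (fun n => F n `*` G n).
  rewrite -setXTT TF TG predeqE => -[x y]; split.
    move=> [/= [n _ Fnx] [k _ Gky]]; exists (maxn n k) => //; split.
    - by move: x Fnx; exact/subsetPset/ndF/leq_maxl.
    - by move: y Gky; exact/subsetPset/ndG/leq_maxr.
  by move=> [n _ []/= ? ?]; split; exists n.
move=> k; have [? ?] := Foo k; have [? ?] := Goo k.
split; first exact: measurableX.
by rewrite product_measure1E// lte_mul_pinfty// ge0_fin_numE.
Qed.

Section lebesgue_rV.
Context (R : realType).

Lemma measurable_coord n (i : 'I_n) :
  measurable_fun [set: 'rV[R]_n] (fun v : 'rV[R]_n => v 0 i : measurableTypeR R).
Proof.
move=> _ Y mY; rewrite setTI; apply: sub_sigma_algebra => /=.
rewrite -bigcup_seq/=; exists i => /=; first by rewrite mem_index_enum.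
by exists Y => //; rewrite setTI.
Qed.

Lemma measurable_fun_rV d (T : measurableType d) n (f : T -> 'rV[R]_n) :
  (forall i, measurable_fun [set: T] (fun x => f x 0 i : measurableTypeR R)) ->
  measurable_fun [set: T] f.
Proof.
move=> mf _ Y; rewrite setTI.
suff : @measurable _ 'rV[R]_n `<=` [set B | measurable (f @^-1` B)] by apply.
apply: smallest_sub.
  split => /=.
  - by rewrite preimage_set0.
  - by move=> A mA; rewrite setTD preimage_setC; exact: measurableC.
  - by move=> F mF; rewrite preimage_bigcup; exact: bigcupT_measurable.
move=> A; rewrite -bigcup_seq/= => -[i _ [B mB <-]]; rewrite /= setTI.
by rewrite -comp_preimage -[X in measurable X]setTI; exact: mf.
Qed.

Definition rV_cons n (xv : measurableTypeR R * 'rV[R]_n) : 'rV[R]_n.+1 :=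
  \row_i (if unlift 0 i is Some j then xv.2 0 j else xv.1).

Definition rV_uncons n (v : 'rV[R]_n.+1) : measurableTypeR R * 'rV[R]_n :=
  (v 0 0, \row_i v 0 (lift 0 i)).

Lemma rV_consK n : cancel (@rV_cons n) (@rV_uncons n).
Proof.
case=> x v; rewrite /rV_uncons /rV_cons mxE unlift_none /=; congr pair.
by apply/rowP => i; rewrite !mxE liftK.
Qed.

Lemma measurable_rV_cons n : measurable_fun setT (@rV_cons n).
Proof.
apply: measurable_fun_rV => i; rewrite /rV_cons.
under eq_fun do rewrite mxE.
case: (unlift 0 i) => [j|]; last exact: measurable_fst.
exact: (measurableT_comp (measurable_coord j) measurable_snd).
Qed.

Lemma measurable_rV_uncons n : measurable_fun setT (@rV_uncons n).
Proof.
apply/measurable_fun_pairP; split; first exact: measurable_coord.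
apply: measurable_fun_rV => i.
rewrite (_ : (fun _ => _) = fun v : 'rV[R]_n.+1 => v 0 (lift 0 i)).
  exact: measurable_coord.
by apply/funext => v /=; rewrite mxE.
Qed.

Section step.
Context n (mu : {sigma_finite_measure set 'rV[R]_n -> \bar R}).

Definition lebesgue_rV_step : set 'rV[R]_n.+1 -> \bar R :=
  pushforward (@lebesgue_measure R \x mu)%E (@rV_cons n).

Let step0 : lebesgue_rV_step set0 = 0%E.
Proof. by rewrite /lebesgue_rV_step /pushforward preimage_set0 measure0. Qed.

Let step_ge0 A : (0 <= lebesgue_rV_step A)%E.
Proof. by rewrite /lebesgue_rV_step /pushforward; exact: measure_ge0. Qed.

Let step_sigma_additive : semi_sigma_additive lebesgue_rV_step.
Proof.
have mcons A : measurable A -> measurable (@rV_cons n @^-1` A).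
  by move=> mA; rewrite -[X in measurable X]setTI; exact: measurable_rV_cons.
move=> F mF tF mUF; rewrite /lebesgue_rV_step /pushforward preimage_bigcup.
apply: measure_semi_sigma_additive.
- by move=> k; exact: mcons.
- apply/trivIsetP => /= i j _ _ ij; rewrite -preimage_setI.
  by move/trivIsetP : tF => /(_ _ _ _ _ ij) ->//; rewrite preimage_set0.
- by rewrite -preimage_bigcup; exact: mcons.
Qed.

HB.instance Definition _ := isMeasure.Build _ _ _ lebesgue_rV_step
  step0 step_ge0 step_sigma_additive.

Let sigma_finite_step : sigma_finite setT lebesgue_rV_step.
Proof.
have [F FT mF] := sigma_finite_prod (@lebesgue_measure R) mu.
exists (fun k => (@rV_uncons n) @^-1` F k).
  by rewrite -preimage_bigcup -FT preimage_setT.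
move=> k; have [mFk Fk] := mF k; split.
  by rewrite -[X in measurable X]setTI; exact: measurable_rV_uncons.
rewrite /lebesgue_rV_step /pushforward -comp_preimage.
by rewrite (_ : _ \o _ = id) //; apply/funext => x /=; rewrite rV_consK.
Qed.

HB.instance Definition _ :=
  @Measure_isSigmaFinite.Build _ _ _ lebesgue_rV_step sigma_finite_step.

End step.

(* The measure on R^(k+1) is the image of the product of the measures on R    *)
(* and R^k by (x, v) |-> (x, v_0, ..., v_(k-1)).                              *)
Fixpoint lebesgue_rV n : {sigma_finite_measure set 'rV[R]_n -> \bar R} :=
  if n is k.+1 then lebesgue_rV_step (lebesgue_rV k) else \d_(0 : 'rV[R]_0).

End lebesgue_rV.

Notation leb1 := (@lebesgue_measure _).
Notation lebd := (@lebesgue_rV _ _).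

(* Functions are not quotiented by equality a.e.: a space is given by the set *)
(* of its representatives, with the norm seen as a seminorm on them. The      *)
(* value of [snorm] outside [carrier] is meaningless.                         *)
Record seminormed (R : realType) (V : lmodType R) := Seminormed {
  carrier :> V -> Prop ;
  snorm : V -> R }.

Section space_domain.
Context (R : realType) (d : nat).
Local Notation E := 'rV[R]_d.
Implicit Types (Omega : set E) (g phi : E -> R).

Definition dotv (x y : E) : R := \sum_(i < d) x 0 i * y 0 i.

(* Near each boundary point, Omega is the strict epigraph, in the direction   *)
(* of some unit vector e, of a Lipschitz function gamma of the component      *)
(* orthogonal to e.                                                           *)
Definition lipschitz_boundary Omega :=
  forall z, (closure Omega `\` Omega) z ->
    exists (r : R) (e : E) (k : R) (gamma : E -> R),
      [/\ 0 < r, dotv e e = 1, k.-lipschitz gamma &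
        forall y, ball z r y ->
          (Omega y <-> gamma (y - dotv y e *: e) < dotv y e)].

Definition lipschitz_domain Omega :=
  [/\ Omega !=set0, open Omega, connected Omega, bounded_set Omega &
      lipschitz_boundary Omega].

Definition partial (i : 'I_d) g : E -> R := 'D_('e_i) g.

Definition smooth g := forall s : seq 'I_d,
  continuous (foldr partial g s) /\
  forall i x, derivable (foldr partial g s) x 'e_i.

Definition test_function Omega phi := smooth phi /\
  exists2 K, compact K & K `<=` Omega /\ [set x | phi x != 0] `<=` K.

Definition inner Omega (g1 g2 : E -> R) : R :=
  \int[lebd]_(x in Omega) (g1 x * g2 x).

Definition inner_vec Omega (G1 G2 : 'I_d -> E -> R) : R :=
  \sum_(i < d) inner Omega (G1 i) (G2 i).

(* [g \_ Omega] is 0 outside Omega, so that g is in L^p(Omega) if and only if *)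
(* [g \_ Omega] is in L^p(R^d).                                               *)
Definition Lp_space (p : \bar R) Omega : seminormed (E -> R) :=
  Seminormed [set g | g \_ Omega \in Lfun lebd p]
             (fun g => fine (Lnorm lebd p (EFin \o g \_ Omega))).

Definition L2_space := Lp_space 2%:E.
Definition Linfty_space := Lp_space +oo.

Definition locally_integrable Omega g := measurable_fun Omega g /\
  forall K, compact K -> K `<=` Omega -> lebd.-integrable K (EFin \o g).

Definition is_weak_gradient Omega g (G : 'I_d -> E -> R) :=
  locally_integrable Omega g /\ forall i, locally_integrable Omega (G i) /\
  forall phi, test_function Omega phi ->
    inner Omega g (partial i phi) = - inner Omega (G i) phi.

Definition weakly_differentiable Omega g :=
  exists G, is_weak_gradient Omega g G.

(* Weak gradients are unique up to equality a.e. in Omega; [grad] picks one,  *)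
(* and is 0 when there is none.                                               *)
Definition grad Omega g : 'I_d -> E -> R :=
  xget (fun=> fun=> 0) [set G | is_weak_gradient Omega g G].

(* L^2(Omega)-norm of the gradient, so that a finite value includes the       *)
(* existence of the weak gradient and its square integrability.               *)
Definition grad_norm Omega g : \bar R :=
  if `[< weakly_differentiable Omega g >] then
    Lnorm lebd 2%:E (EFin \o
      (fun x => Num.sqrt (\sum_(i < d) (grad Omega g i x) ^+ 2)) \_ Omega)
  else +oo%E.

Definition H1_space Omega : seminormed (E -> R) :=
  Seminormed
    [set g | [/\ L2_space Omega g, weakly_differentiable Omega g &
                 forall i, L2_space Omega (grad Omega g i)]]
    (fun g => Num.sqrt (snorm (L2_space Omega) g ^+ 2 +
                        (fine (grad_norm Omega g)) ^+ 2)).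

Definition H10_space Omega : seminormed (E -> R) :=
  Seminormed
    [set g | H1_space Omega g /\ forall eps, 0 < eps ->
       exists2 phi, test_function Omega phi &
                    snorm (H1_space Omega) (g - phi) < eps]
    (snorm (H1_space Omega)).

End space_domain.

Section time.
Context (R : realType) (V : lmodType R).
Implicit Types (T : R) (X : seminormed V) (u v : R -> V).

Definition continuous_in T X u := forall t, t \in `[0, T] ->
  X (u t) /\ snorm X (u s - u t) @[s --> within `[0, T] (nbhs t)] --> (0 : R).

(* u belongs to C^1([0,T], X) and du is its derivative. *)
Definition C1_in T X u du :=
  [/\ continuous_in T X u, continuous_in T X du &
      forall t, t \in `[0, T] ->
        snorm X ((s - t)^-1 *: (u s - u t) - du t)
          @[s --> within `[0, T] t^'] --> (0 : R)].

Record step_function X := StepFunction {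
  step_size : nat ;
  step_set : 'I_step_size -> set R ;
  step_val : 'I_step_size -> V ;
  measurable_step_set : forall i,
    measurable (step_set i : set (measurableTypeR R)) ;
  step_valP : forall i, X (step_val i) }.

Arguments step_set {X} s i.
Arguments step_val {X} s i.

Definition step_at X (s : step_function X) (t : R) : V :=
  \sum_i (\1_(step_set s i) t : R) *: step_val s i.

Definition step_integral T X (s : step_function X) : V :=
  \sum_i fine (leb1 (`]0, T[ `&` step_set s i)) *: step_val s i.

Definition strongly_measurable T X u :=
  exists s : nat -> step_function X,
    {ae leb1, forall t, t \in `]0, T[ -> X (u t) /\
      snorm X (step_at (s n) t - u t) @[n --> \oo] --> (0 : R)}.

(* I is the Bochner integral of u over (0,T). *)
Definition is_bochner_integral T X u (I : V) :=
  [/\ strongly_measurable T X u, X I &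
      exists s : nat -> step_function X,
        (\int[leb1]_(t in `]0%R, T[) (snorm X (step_at (s n) t - u t))%:E)%E
          @[n --> \oo] --> 0%E /\
        snorm X (step_integral T (s n) - I) @[n --> \oo] --> (0 : R)].

Definition L2_in T X u := strongly_measurable T X u /\
  (\int[leb1]_(t in `]0%R, T[) ((snorm X (u t)) ^+ 2)%:E < +oo)%E.

End time.

Section time_derivative.
Context (R : realType).
Implicit Types (T : R) (psi : R -> R).

Definition time_test_function T psi :=
  (forall n t, derivable (derive1n n psi) t 1) /\
  exists2 K : set R, compact K &
    [set t | psi t != 0] `<=` K /\ K `<=` `]0, T[.

(* du is the weak derivative of u on (0,T), in the sense of X-valued          *)
(* distributions.                                                             *)
Definition is_weak_derivative (V : lmodType R) T (X : seminormed V)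
    (u du : R -> V) :=
  forall psi, time_test_function T psi -> exists I,
    is_bochner_integral T X (fun t => derive1 psi t *: u t) I /\
    is_bochner_integral T X (fun t => - (psi t *: du t)) I.

Definition L2_time T : set (R -> R) := [set h | h \_ `]0, T[ \in Lfun leb1 2%:E].

(* m belongs to H^1(0,T) and dm is its weak derivative. *)
Definition H1_time T (m dm : R -> R) :=
  [/\ L2_time T m, L2_time T dm &
      forall psi, time_test_function T psi ->
        \int[leb1]_(t in `]0, T[) (m t * derive1 psi t) =
        - \int[leb1]_(t in `]0, T[) (dm t * psi t)].

End time_derivative.

Section problem.
Context (R : realType) (d : nat).
Local Notation E := 'rV[R]_d.
Variables (Omega : set E) (T : R).

Definition scale_vec (a : E -> R) (G : 'I_d -> E -> R) : 'I_d -> E -> R :=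
  fun i => a \* G i.

(* du and dru are the weak time derivatives of u and rho u. Those of the data *)
(* rho and m are given as drho and dm.                                        *)
Definition is_solution (rho drho eta kappa p : R -> E -> R) (f : R -> R)
    (u0 omega : E -> R) (dm : R -> R) (u : R -> E -> R) (h : R -> R) :=
  let wr t : E -> R := fun x => omega x / rho t x in
  [/\ L2_time T h,
      continuous_in T (H10_space Omega) u,
      {ae lebd, forall x, Omega x -> u 0 x = u0 x} &
      exists du dru : R -> E -> R,
      [/\ is_weak_derivative T (H10_space Omega) u du,
          L2_in T (H10_space Omega) du,
          is_weak_derivative T (L2_space Omega) (fun t => rho t \* u t) dru &
          {ae leb1, forall t, t \in `]0, T[ ->
            (forall phi, H10_space Omega phi ->
               inner Omega (dru t) phi +
               inner_vec Omega (scale_vec (eta t) (grad Omega (du t)))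
                 (grad Omega phi) +
               inner_vec Omega (scale_vec (kappa t) (grad Omega (u t)))
                 (grad Omega phi) =
               h t * inner Omega (p t) phi + inner Omega (f \o u t) phi) /\
            h t = (inner Omega (p t) (wr t))^-1 *
              (dm t +
               inner Omega (u t) (fun x => omega x * drho t x / rho t x) +
               inner_vec Omega (scale_vec (eta t) (grad Omega (du t)))
                 (grad Omega (wr t)) +
               inner_vec Omega (scale_vec (kappa t) (grad Omega (u t)))
                 (grad Omega (wr t)) -
               inner Omega (f \o u t) (wr t))}]].

End problem.

(* Main.v *)
Require Import Defs.
From HB Require Import structures.
From mathcomp Require Import all_boot all_order all_algebra.
From mathcomp Require Import all_classical all_reals all_analysis.
From mathcomp Require Import measurable_realfun ess_sup_inf.
From mathcomp Require Import ring lra.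
Import Order.TTheory GRing.Theory Num.Theory numFieldNormedType.Exports.
Local Open Scope classical_set_scope.
Local Open Scope ring_scope.

(* Let U and V be the differences of the two solutions u and of their time
   derivatives. The time derivative of u exists strongly at almost every t,
   because a Bochner integrable function has Lebesgue points; there
   (rho u)' = rho' u + rho u'. Subtracting the two equations at such a t and
   testing with V makes the formula for h contribute at most
   (|p| M eta_1 / omega_m) |V| |grad V| plus terms bounded by |U|, and by the
   smallness condition the former is absorbed by rho_0 |V|^2 + eta_0 |grad V|^2.
   Hence |V| <= C |U| in H^1 at almost every t, and U = 0 follows by Gronwall's
   argument from U(0) = 0. *)

(** * Smooth functions of time *)

Section smooth_functions_on_R.
Context {R : realType}.
Implicit Types (f g : R -> R) (P : {poly R}).

(** The derivatives [du] and [dru] of a solution are distributional and a priori unrelated, which is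
    why pointwise strong derivatives are needed at all. In the definition of the Bochner integral
    the norm of the error need not be measurable: integrals there are lower integrals, and scalar
    consequences are phrased with [has_integral]. With c = |p| M eta_1 / omega_m, a = |V| and b =
    |grad V|, the smallness condition says that rho_0 a^2 - c a b + eta_0 b^2 is positive definite,
    that is c^2 < 4 rho_0 eta_0. The final step does not differentiate |U|^2. The weak derivative is
    paired with the fixed vector U(e) and with a smoothed indicator of [c, e]; this gives an
    integral inequality, by which the maximum of an exponentially weighted norm is at most half of
    itself. Functions are not identified almost everywhere, so norms are only seminorms and [grad],
    a choice, is linear only almost everywhere. That linearity rests on the uniqueness of weak
    gradients, proved with smooth approximations of boxes. *)

Fixpoint Cn n f : Prop := if n is m.+1 then
  (forall t, derivable f t 1) /\ Cn m (derive1 f) else True.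

(** [Cn n] asks for [n]-fold differentiability without continuity of the last derivative; over all
    [n] the difference disappears. *)
Definition Csmooth f := forall n, Cn n f.

Lemma Csmooth_derivable f t : Csmooth f -> derivable f t 1.
Proof. by move=> /(_ 1%N) [+ _]; apply. Qed.

Lemma Csmooth_derive1 f : Csmooth f -> Csmooth (derive1 f).
Proof. by move=> sf n; case: (sf n.+1). Qed.

Lemma Csmooth_continuous f : Csmooth f -> continuous f.
Proof.
by move=> sf t; apply/differentiable_continuous/derivable1_diffP/Csmooth_derivable.
Qed.

Lemma Csmooth_derivable_iter f n t : Csmooth f -> derivable (derive1n n f) t 1.
Proof.
elim: n f => [|n IHn] f sf; first exact: Csmooth_derivable.
by rewrite derive1Sn; exact/IHn/Csmooth_derive1.
Qed.

Lemma CnW n f : Cn n.+1 f -> Cn n f.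
Proof.
by elim: n f => [//|n IHn] f [df Cf]; split => //; exact: IHn.
Qed.

Lemma CnD n f g : Cn n f -> Cn n g -> Cn n (f \+ g).
Proof.
elim: n f g => [//|n IHn] f g [df Cf] [dg Cg]; split.
  by move=> t; exact: derivableD.
rewrite (_ : derive1 _ = derive1 f \+ derive1 g); first exact: IHn.
apply/funext => t; rewrite /= !derive1E -deriveD//; by [exact: df|exact: dg].
Qed.

(** The derivative f g' + g f' contains the factors undifferentiated, so the induction lowers their
    order with [CnW]. *)
Lemma CnM n f g : Cn n f -> Cn n g -> Cn n (f \* g).
Proof.
elim: n f g => [//|n IHn] f g.
move=> /[dup] /CnW Cf0 [df Cf] /[dup] /CnW Cg0 [dg Cg]; split.
  by move=> t; exact: derivableM.
rewrite (_ : derive1 _ = (f \* derive1 g) \+ (g \* derive1 f)).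
  by apply: CnD; exact: IHn.
apply/funext => t; rewrite /= !derive1E -[RHS]deriveM//; by [exact: df|exact: dg].
Qed.

Lemma Cn_cst n c : Cn n (fun=> c).
Proof.
elim: n c => [//|n IHn] c; split; first by move=> t; exact: derivable_cst.
rewrite (_ : derive1 _ = fun=> 0)//.
by apply/funext => t; rewrite derive1_cst.
Qed.

Lemma is_derive_affine (a b t : R) :
  is_derive t (1 : R) (fun t : R => a * t + b) a.
Proof.
have -> : (fun t : R => a * t + b) = a \*: id + cst b by apply/funext => s.
by apply: is_derive_eq; rewrite addr0 scaler1.
Qed.

Lemma Cn_affine n f a b : Cn n f -> Cn n (fun t => f (a * t + b)).
Proof.
have daff := is_derive_affine a b.
elim: n f => [//|n IHn] f [df Cf].
have dfaff (t : R) :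
    is_derive t (1 : R) (fun t => f (a * t + b)) (a * derive1 f (a * t + b)).
  rewrite mulrC; apply: (is_derive1_comp (f := f)).
  by rewrite derive1E; exact/derivableP.
split; first by move=> t; case: (dfaff t).
rewrite (_ : derive1 _ = (fun=> a) \* (fun t => derive1 f (a * t + b))).
  by apply: CnM; [exact: Cn_cst|exact: IHn].
by apply/funext => t; rewrite derive1E; exact: derive_val.
Qed.

Lemma CsmoothD f g : Csmooth f -> Csmooth g -> Csmooth (f \+ g).
Proof. by move=> sf sg n; exact: CnD. Qed.

Lemma CsmoothM f g : Csmooth f -> Csmooth g -> Csmooth (f \* g).
Proof. by move=> sf sg n; exact: CnM. Qed.

Lemma Csmooth_cst c : Csmooth (fun=> c).
Proof. by move=> n; exact: Cn_cst. Qed.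

Lemma Csmooth_affine f a b : Csmooth f -> Csmooth (fun t => f (a * t + b)).
Proof. by move=> sf n; exact: Cn_affine. Qed.

(** For P = 1 this is the classical exp(-1/x) extended by 0. Allowing polynomials in 1/x makes the
    family stable under differentiation. *)
Definition flat P (x : R) : R :=
  if 0 < x then P.[x^-1] * expR (- x^-1) else 0.

Lemma flat_lin (c : R) P (Q : {poly R}) x :
  flat (c *: P + Q) x = c * flat P x + flat Q x.
Proof.
rewrite /flat; case: ifPn => _; last by rewrite mulr0 addr0.
by rewrite hornerD hornerZ; ring.
Qed.

(** With y = 1/x, the inequality exp y >= y^(n+1) / (n+1)! bounds y^n exp(-y) by (n+1)! / y. *)
Lemma flat_Xn_le n x : `|flat 'X^n x| <= (n.+1)`!%:R * `|x|.
Proof.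
rewrite /flat; case: ifPn => [x0|_]; last by rewrite normr0 mulr_ge0.
have y0 : 0 < x^-1 by rewrite invr_gt0.
rewrite hornerXn ger0_norm; last first.
  by rewrite mulr_ge0 ?expR_ge0// exprn_ge0// ltW.
rewrite (gtr0_norm x0) expRN ler_pdivrMr ?expR_gt0//.
have := expR_ge1Dxn n (ltW y0) => h.
have {}h : x^-1 ^+ n.+1 / (n.+1)`!%:R <= expR x^-1.
  by apply: le_trans h; rewrite lerDr.
apply: le_trans (_ : (n.+1)`!%:R * x * (x^-1 ^+ n.+1 / (n.+1)`!%:R) <= _).
  have f0 : (n.+1)`!%:R != 0 :> R by rewrite pnatr_eq0 -lt0n fact_gt0.
  rewrite exprS le_eqVlt; apply/orP; left; apply/eqP.
  by field; rewrite f0 gt_eqF.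
by rewrite ler_wpM2l// mulr_ge0// ltW.
Qed.

(** A bound by a multiple of |x| near 0 is stable under linear combinations, so it reduces to
    monomials, where [flat_Xn_le] gives it. *)
Lemma flat_cvg0 P : flat P x @[x --> 0] --> 0.
Proof.
elim/poly_ind: P => [|P c IH].
  rewrite (_ : flat 0 = cst 0); first exact: cvg_cst.
  by apply/funext => x; rewrite /flat horner0 mul0r if_same.
suff H : forall P, exists C, forall x, `|x| <= 1 -> `|flat P x| <= C * `|x|.
  have [C HC] := H (P * 'X + c%:P).
  apply: norm_cvg0; apply: (@squeeze_cvgr _ _ _ _ (cst 0) (fun x => C * `|x|)).
  - near=> x; rewrite normr_ge0/=; apply: HC.
    near: x; exists 1 => //= x/=; rewrite sub0r normrN; exact: ltW.
  - exact: cvg_cst.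
  - have := @norm_continuous _ R 0; rewrite /continuous_at normr0 => n0.
    by have := cvgM (cvg_cst C) n0; rewrite mulr0; exact.
move=> {c IH}P; rewrite -[P]coefK poly_def.
apply: (big_ind (fun p => exists C, forall x, `|x| <= 1 ->
  `|flat p x| <= C * `|x|)) => [|p q [C1 H1] [C2 H2]|i _].
- exists 0 => x _; rewrite /flat horner0 mul0r if_same normr0; exact: mulr_ge0.
- exists (C1 + C2) => x x1; rewrite -[p]scale1r flat_lin mul1r mulrDl.
  by rewrite (le_trans (ler_normD _ _))// lerD ?H1 ?H2.
- exists (`|P`_i| * (i.+1)`!%:R) => x x1.
  rewrite -[_ *: _]addr0 flat_lin {2}/flat horner0 mul0r if_same addr0.
  by rewrite normrM -mulrA ler_wpM2l// flat_Xn_le.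
Unshelve. all: by end_near. Qed.

(** For x > 0, the derivative of P(1/x) exp(-1/x) is x^(-2) (P - P')(1/x) exp(-1/x), again a member
    of the family. At x <= 0 both the derivative and the formula vanish. *)
Lemma is_derive_flat P x :
  is_derive x (1 : R) (flat P) (flat ('X^2 * (P - P^`())) x).
Proof.
have [x0|x0|->] := ltgtP x 0.
- rewrite [X in is_derive _ _ _ X](_ : _ = 0); last first.
    by rewrite /flat ltNge (ltW x0).
  apply: (near_eq_is_derive (f := cst 0)).
  near=> y; rewrite /flat ltNge (_ : y <= 0)//=.
  by near: y; exact: lt_le_nbhsl.
- rewrite {2}/flat x0.
  apply: (near_eq_is_derive (f := fun y : R^o => P.[y^-1] * expR (- y^-1) : R^o)).
    near=> y; rewrite /flat (_ : 0 < y)//.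
    by near: y; exact: lt_nbhsr.
  have dV : is_derive x 1 (fun y : R => y^-1) (- x ^- 2 *: 1).
    by apply: is_deriveV; rewrite gt_eqF.
  have dP := @is_derive1_comp _ (horner P) _ x _ _ (is_derive_poly P x^-1) dV.
  have dE := @is_derive1_comp _ expR _ x _ _ (is_derive_expR (- x^-1))
    (is_deriveN dV).
  have dPE : is_derive x (1 : R) (fun y : R => P.[y^-1] * expR (- y^-1)) _ :=
    is_deriveM dP dE.
  apply: (is_derive_eq dPE).
  rewrite /= !hornerE /GRing.scale/=.
  have xn0 : x != 0 by rewrite gt_eqF.
  by field.
- rewrite [X in is_derive _ _ _ X](_ : _ = 0); last by rewrite /flat ltxx.
  have H : h^-1 *: (flat P (h *: (1:R) + 0) - flat P 0) @[h --> 0^'] --> (0:R).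
    (* Dividing by h amounts to one more factor 1/h in the polynomial, so the difference quotient at
       0 is itself a flat function and tends to 0. *)
    rewrite (_ : (fun h => _) = flat (P * 'X)).
      by apply: cvg_within_filter; exact: flat_cvg0.
    apply/funext => h; rewrite addr0 {2}/flat ltxx subr0 /flat.
    rewrite /GRing.scale/= mulr1; case: ifPn => _; last by rewrite mulr0.
    by rewrite hornerMX; ring.
  apply: DeriveDef.
    by rewrite /derivable; apply/cvg_ex; exists 0; exact: H.
  by rewrite /derive; exact: cvg_lim H.
Unshelve. all: by end_near. Qed.

Lemma Csmooth_flat P : Csmooth (flat P).
Proof.
move=> n; elim: n P => [//|n IHn] P; split.
  by move=> t; case: (is_derive_flat P t).
rewrite (_ : derive1 _ = flat ('X^2 * (P - P^`())))//.
by apply/funext => t; rewrite derive1E; case: (is_derive_flat P t).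
Qed.

(** This is exp(-1/x) exp(-1/(1-x)) on (0,1), extended by 0. *)
Let bump x := flat 1 x * flat 1 (- 1 * x + 1).

Let bump_ge0 x : 0 <= bump x.
Proof.
by rewrite /bump /flat !hornerE ?mul1r; apply: mulr_ge0;
  case: ifPn => // _; exact: expR_ge0.
Qed.

Let bump_gt0 x : 0 < x < 1 -> 0 < bump x.
Proof.
move=> /andP[x0 x1]; rewrite /bump /flat !hornerE ?mul1r x0.
by rewrite (_ : 0 < -1 * x + 1) ?mulr_gt0 ?expR_gt0//; lra.
Qed.

Let bump_out x : x <= 0 \/ 1 <= x -> bump x = 0.
Proof.
rewrite /bump /flat; case=> x01; first by rewrite ltNge x01 mul0r.
by rewrite (ltNge _ (- 1 * x + 1)) (_ : - 1 * x + 1 <= 0) ?mulr0//; lra.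
Qed.

Let bump_smooth : Csmooth bump.
Proof.
apply: (@CsmoothM (flat 1) (fun x => flat 1 (- 1 * x + 1))).
  exact: Csmooth_flat.
exact/Csmooth_affine/Csmooth_flat.
Qed.

(** Starting the integral at -1, strictly to the left of the support of [bump], makes every x >= 0
    an interior point for the fundamental theorem of calculus. *)
Let F x := \int[lebesgue_measure]_(t in `[(-1)%R, x]) bump t.

Let F_le0 x : x <= 0 -> F x = 0.
Proof.
move=> x0; rewrite /F (@eq_Rintegral _ _ _ _ _ (fun=> 0)).
  by rewrite Rintegral_cst// mul0r.
move=> t; rewrite inE/= in_itv/= => /andP[_ tx]; apply: bump_out; left.
exact: le_trans x0.
Qed.

Let F_derive x : is_derive x (1 : R) F (bump x).
Proof.
have [x0|x0] := ltP x 0.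
  rewrite bump_out; last by left; exact: ltW.
  apply: (near_eq_is_derive (f := cst 0)).
  near=> y; rewrite /= F_le0//.
  by near: y; exact: lt_le_nbhsl.
have xx1 : x < x + 1 by rewrite ltrDl.
have ib : lebesgue_measure.-integrable `[(-1), (x + 1)] (EFin \o bump).
  apply: continuous_compact_integrable; first exact: segment_compact.
  exact/continuous_subspaceT/Csmooth_continuous.
have x1 : -1 < x by rewrite (lt_le_trans _ x0)// ltrN10.
have [dF Fx] := continuous_FTC1_closed xx1 ib x1 (Csmooth_continuous _ bump_smooth x).
by split; [exact: dF|rewrite -derive1E; exact: Fx].
Unshelve. all: by end_near. Qed.

Let F_continuous : continuous F.
Proof.
by move=> x; apply/differentiable_continuous/derivable1_diffP; case: (F_derive x).
Qed.

Let F_MVT a b : a < b -> exists2 c, a < c < b & F b - F a = bump c * (b - a).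
Proof.
move=> ab; have [c cab Fc] := @MVT _ F bump a b ab (fun x _ => F_derive x)
  (continuous_subspaceT F_continuous).
by exists c => //; rewrite in_itv in cab.
Qed.

(** The witness is F / F 1; the mean value theorem writes [F 1] as a value of [bump] inside (0,1),
    so it is positive. *)
Lemma smooth_step : exists S : R -> R, [/\ Csmooth S,
  forall x, x <= 0 -> S x = 0, forall x, 1 <= x -> S x = 1,
  forall x, 0 <= S x <= 1 & forall x, 0 <= derive1 S x].
Proof.
have F1_gt0 : 0 < F 1.
  have [c c01 Fc] := @F_MVT 0 1 ltr01.
  by move: Fc; rewrite (F_le0 0)// !subr0 mulr1 => ->; exact: bump_gt0.
have F_ge1 x : 1 <= x -> F x = F 1.
  rewrite le_eqVlt => /predU1P[<-//|x1]; have [c /andP[c1 _] Fc] := F_MVT _ _ x1.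
  by apply/eqP; rewrite -subr_eq0 Fc bump_out ?mul0r//; right; exact: ltW.
have F_nd a b : a <= b -> F a <= F b.
  rewrite le_eqVlt => /predU1P[->//|ab]; have [c _ Fc] := F_MVT _ _ ab.
  by rewrite -subr_ge0 Fc mulr_ge0// subr_ge0 ltW.
pose c := (F 1)^-1.
have dS (x : R) : is_derive x (1 : R) (c \*: F) (c * bump x).
  exact: is_deriveZ.
have dSE : derive1 (c \*: F) = (fun=> c) \* bump.
  by apply/funext => x; rewrite derive1E; apply: derive_val.
exists (c \*: F); split.
- case=> [//|n]; split; first by move=> t; case: (dS t).
  by rewrite dSE; apply: CsmoothM => //; exact: Csmooth_cst.
- by move=> x x0; rewrite /= F_le0// scaler0.
- by move=> x x1; rewrite /= F_ge1// /GRing.scale/= mulVf// gt_eqF.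
- move=> x; rewrite /= /GRing.scale/= mulrC.
  rewrite divr_ge0 ?(ltW F1_gt0)//=; last first.
    have [x0|/ltW x0] := leP x 0; first by rewrite F_le0.
    by rewrite -(F_le0 0)// F_nd.
  rewrite ler_pdivrMr// mul1r; have [x1|/ltW x1] := leP x 1; first exact: F_nd.
  by rewrite F_ge1.
- by move=> x; rewrite dSE /= mulr_ge0 ?bump_ge0// invr_ge0 ltW.
Qed.

End smooth_functions_on_R.

Set Implicit Arguments.
Unset Strict Implicit.
Unset Printing Implicit Defensive.

(** * Lebesgue measure on R^d *)

Section boxes.
Context {R : realType} {d : nat}.
Local Notation E := 'rV[R]_d.
Implicit Types (a b : 'I_d -> R) (A : set E).

Definition box a b : set E := [set x | forall i, a i < x 0 i < b i].
Definition cbox a b : set E := [set x | forall i, a i <= x 0 i <= b i].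

Lemma box_sub_cbox a b : box a b `<=` cbox a b.
Proof. by move=> x abx i; have /andP[/ltW -> /ltW ->] := abx i. Qed.

Lemma measurable_coordinatewise (P : 'I_d -> set R) :
  (forall i, measurable (P i : set (measurableTypeR R))) ->
  measurable [set x : E | forall i, P i (x 0 i)].
Proof.
move=> mP; rewrite [X in measurable X](_ : _ =
    \bigcap_(i in [set: 'I_d]) ((fun x : E => x 0 i) @^-1` P i)).
  apply: fin_bigcap_measurable => [|i _]; first exact: finite_finset.
  by rewrite -[X in measurable X]setTI; exact: measurable_coord.
by rewrite eqEsubset; split => [x Px i _|x Px i]; [exact: Px|exact: (Px i)].
Qed.

Lemma measurable_box a b : measurable (box a b).
Proof.
have -> : box a b = [set x : E | forall i, `]a i, b i[%classic (x 0 i)]; last first.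
  by apply: (@measurable_coordinatewise (fun i => `]a i, b i[%classic)) => i.
by apply/seteqP; split => x abx i; have := abx i; rewrite /= in_itv.
Qed.

Lemma measurable_cbox a b : measurable (cbox a b).
Proof.
have -> : cbox a b = [set x : E | forall i, `[a i, b i]%classic (x 0 i)]; last first.
  by apply: (@measurable_coordinatewise (fun i => `[a i, b i]%classic)) => i.
by apply/seteqP; split => x abx i; have := abx i; rewrite /= in_itv.
Qed.

Lemma compact_cbox a b : compact (cbox a b).
Proof.
have -> : cbox a b = [set x : E | forall i, `[a i, b i]%classic (x ord0 i)]; last first.
  by apply: (@rV_compact R d (fun i => `[a i, b i]%classic)) => i; exact: segment_compact.
by apply/seteqP; split => x abx i; have := abx i; rewrite /= in_itv.
Qed.

(** Boxes with rational end points form a countable base. Only those whose closed box stays in [A]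
    are kept, so that local integrability in [A] applies on each of them. *)
Lemma open_rV_bigcup A : open A -> exists2 c : nat -> ('I_d -> R) * ('I_d -> R),
  A `<=` \bigcup_(k in [set k | cbox (c k).1 (c k).2 `<=` A])
    box (c k).1 (c k).2 &
  forall k, measurable (box (c k).1 (c k).2).
Proof.
move=> oA.
(* Codes that decode to no pair of rational vectors get an arbitrary box; this is harmless, since
   only an inclusion of [A] in the union is claimed. *)
pose c (k : nat) : ('I_d -> R) * ('I_d -> R) :=
  if @unpickle ({ffun 'I_d -> rat} * {ffun 'I_d -> rat})%type k is Some q
  then (fun i => ratr (q.1 i), fun i => ratr (q.2 i))
  else (fun=> 0, fun=> 0).
exists c; last by move=> k; exact: measurable_box.
move=> z Az; have /nbhs_ballP[r /= r0 zrA] : nbhs z A by exact: open_nbhs_nbhs.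
have Ha (i : 'I_d) : exists q : rat, ratr q \in `](z 0 i - r), (z 0 i)[.
  by apply: rat_in_itvoo; rewrite ltrBlDr ltrDl.
have Hb (i : 'I_d) : exists q : rat, ratr q \in `](z 0 i), (z 0 i + r)[.
  by apply: rat_in_itvoo; rewrite ltrDl.
have [fa Hfa] := choice Ha; have [fb Hfb] := choice Hb.
pose q := (finfun fa, finfun fb).
exists (pickle q) => /=.
  rewrite /c pickleK /= => x xab; apply: zrA; split=> // i j; rewrite (ord1 i).
  have := xab j; have := Hfa j; have := Hfb j.
  rewrite !in_itv/= !ffunE /ball/= => /andP[_ b1] /andP[a1 _] /andP[a2 b2].
  by rewrite ltr_distlC; lra.
rewrite /c pickleK /= => i; rewrite !ffunE.
by have := Hfa i; have := Hfb i; rewrite !in_itv/= => /andP[-> _] /andP[_ ->].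
Qed.

Lemma open_measurable_rV A : open A -> measurable A.
Proof.
move=> oA; have [c cA mc] := open_rV_bigcup oA.
rewrite [X in measurable X](_ : _ = \bigcup_(k in
    [set k | cbox (c k).1 (c k).2 `<=` A]) box (c k).1 (c k).2).
  by apply: bigcup_measurable => k _.
apply/seteqP; split => // x [k /= kA xk]; apply: kA; exact: box_sub_cbox xk.
Qed.

Lemma compact_measurable_rV A : compact A -> measurable A.
Proof.
move=> cA; rewrite -[A]setCK; apply: measurableC; apply: open_measurable_rV.
apply: closed_openC; apply: compact_closed cA.
exact: (@norm_hausdorff _ 'rV[R]_d).
Qed.

Lemma continuous_measurable_rV (g : E -> R) : continuous g ->
  measurable_fun [set: E] g.
Proof.
move=> cg; apply: (@measurability _ _ _ (measurableTypeR R) _ _ _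
  (RGenOpens.measurableE R)).
move=> _ [_ [a [b ->]] <-]; rewrite setTI; apply: open_measurable_rV.
by apply: open_comp => [x _|]; [exact: cg|exact: interval_open].
Qed.

(** Boxes are stable under intersection, so this generating family is the one on which Dynkin's
    induction can start. *)
Lemma rV_measurable_boxes :
  @measurable _ E = <<s [set A | exists a b, A = box a b] >>.
Proof.
apply/seteqP; split; last first.
  apply: smallest_sub; first exact: sigma_algebra_measurable.
  by move=> _ [a [b ->]]; exact: measurable_box.
apply: smallest_sub; first exact: smallest_sigma_algebra.
move=> A; rewrite -bigcup_seq/= => -[i _ [B mB <-]]; rewrite setTI.
pose T := g_sigma_algebraType [set A : set E | exists a b, A = box a b].
suff mi : measurable_fun [set: T] (fun x : T => (x : E) 0 i : measurableTypeR R).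
  by have := mi measurableT B mB; rewrite setTI.
apply: (@measurability _ _ _ (measurableTypeR R) _ _ _
  (RGenOInfty.measurableE R)).
move=> _ [_ [c ->] <-]; rewrite setTI.
(* The half-space x_i > c is exhausted by boxes with side (c, n) in direction [i] and (-n, n) in the
   others. *)
rewrite [X in measurable X](_ : _ = \bigcup_n
   box (fun j => if j == i then c else - n%:R) (fun=> n%:R)); last first.
  apply/seteqP; split => [x|x [n _] /(_ i)]; rewrite /preimage/= in_itv/= andbT; last first.
    by rewrite eqxx => /andP[].
  move=> cx; pose K := (\sum_(j < d) `|(x : E) 0 j|).
  exists (Num.truncn K).+1 => // j.
  have jK : `|(x : E) 0 j| < (Num.truncn K).+1%:R.
    apply: le_lt_trans (truncnS_gt _).
    by rewrite /K (bigD1 j)//= lerDl sumr_ge0.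
  move: jK; rewrite ltr_norml => /andP[j1 ->]; rewrite andbT.
  by case: eqP => [->|_].
apply: bigcupT_measurable => n; apply: sub_sigma_algebra.
by exists (fun j => if j == i then c else - n%:R), (fun=> n%:R).
Qed.

End boxes.

Lemma lebesgue_rV_cbox_lty (R : realType) d (a b : 'I_d -> R) :
  (lebesgue_rV R d (cbox a b) < +oo)%E.
Proof.
elim: d a b => [|n IHn] a b.
  apply: (@le_lt_trans _ _ 1%E); last exact: ltry.
  by rewrite /= diracE lee_fin; case: (_ \in _).
rewrite /= /lebesgue_rV_step /pushforward.
rewrite (_ : _ @^-1` _ = `[a ord0, b ord0]%classic `*`
    cbox (fun i => a (lift ord0 i)) (fun i => b (lift ord0 i))).
  rewrite product_measure1E//=; last exact: measurable_cbox.
  apply: lte_mul_pinfty => //.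
  by rewrite lebesgue_measure_itv/=; case: ifPn => // _; rewrite -EFinD.
apply/seteqP; split => [[x v]|[x v] [/= abx abv]].
  move=> /= abxv; split => [|i].
    by have := abxv ord0; rewrite mxE unlift_none /= in_itv.
  by have := abxv (lift ord0 i); rewrite mxE liftK.
move=> i; rewrite mxE; case: unliftP => [j ->|->] /=; first exact: abv.
by rewrite in_itv in abx.
Qed.

Lemma bounded_lebesgue_rV_lty (R : realType) d (A : set 'rV[R]_d) :
  measurable A -> bounded_set A -> (lebesgue_rV R d A < +oo)%E.
Proof.
move=> mA [M [_ /(_ (M + 1))]]; rewrite ltrDl ltr01 => /(_ isT) AM.
apply: le_lt_trans (lebesgue_rV_cbox_lty (fun=> - (M + 1)) (fun=> M + 1)).
apply: le_measure; rewrite ?inE//; first exact: measurable_cbox.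
move=> x /AM /= xM i; rewrite -ler_norml; apply: le_trans xM.
rewrite /Num.Def.normr/= mx_normrE.
by apply: (le_bigmax _ (fun i => `|x i.1 i.2|) (ord0, i)).
Qed.

(** * Test functions *)

Section tensor_test_functions.
Context {R : realType} {d : nat}.
Local Notation E := 'rV[R]_d.
Implicit Types b : 'I_d -> R -> R.

(** Products of functions of one coordinate are stable under partial derivatives, which reduces
    smoothness on R^d to smoothness on R. *)
Definition tensor b : E -> R := fun x => \prod_i b i (x 0 i).

Definition tensor_derive (j : 'I_d) b : 'I_d -> R -> R :=
  fun i => if i == j then derive1 (b i) else b i.

Lemma tensor_cvg_quotient b j x : (forall i, Csmooth (b i)) ->
  h^-1 *: ((tensor b \o shift x) (h *: 'e_j) - tensor b x) @[h --> 0^'] -->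
  tensor (tensor_derive j b) x.
Proof.
move=> sb; pose c := \prod_(i < d | i != j) b i (x 0 i).
have -> : tensor (tensor_derive j b) x = c * derive1 (b j) (x 0 j).
  rewrite /tensor (bigD1 j)//= /tensor_derive eqxx mulrC; congr (_ * _).
  by apply: eq_bigr => i /negbTE ->.
rewrite (_ : (fun h => _) =
    fun h : R => c * (h^-1 *: (b j (h *: (1 : R) + x 0 j) - b j (x 0 j)))).
  by apply: cvgMr; rewrite derive1E; exact: Csmooth_derivable.
apply/funext => h; rewrite /tensor /= (bigD1 j)//= [X in _ - X](bigD1 j)//=.
rewrite !mxE !eqxx /= (eq_bigr (fun i => b i (x 0 i))); last first.
  by move=> i /negbTE ij; rewrite !mxE eqxx ij mulr0 add0r.
by rewrite -/c /GRing.scale/=; ring.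
Qed.

Lemma tensor_derivable b j x : (forall i, Csmooth (b i)) ->
  derivable (tensor b) x 'e_j.
Proof. by move=> sb; apply/cvg_ex; eexists; exact: tensor_cvg_quotient. Qed.

Lemma partial_tensor b j : (forall i, Csmooth (b i)) ->
  partial j (tensor b) = tensor (tensor_derive j b).
Proof.
by move=> sb; apply/funext => x; apply: cvg_lim => //; exact: tensor_cvg_quotient.
Qed.

Lemma tensor_derive_smooth b j : (forall i, Csmooth (b i)) ->
  forall i, Csmooth (tensor_derive j b i).
Proof.
by move=> sb i; rewrite /tensor_derive; case: ifP => // _; exact: Csmooth_derive1.
Qed.

Lemma tensor_continuous b : (forall i, Csmooth (b i)) -> continuous (tensor b).
Proof.
move=> sb; rewrite /tensor; elim: (index_enum _) => [|i s IHs] x.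
  have -> : (fun x : E => \prod_(i <- [::]) b i (x 0 i)) = cst 1.
    by apply/funext => y; rewrite big_nil.
  exact: cst_continuous.
rewrite /continuous_at; under eq_fun do rewrite big_cons; rewrite big_cons.
have bi : {for x, continuous (fun y : E => b i (y 0 i))}.
  apply: (@continuous_comp _ _ _ (fun y : E => y 0 i) (b i)).
    exact: coord_continuous.
  exact: Csmooth_continuous.
exact: cvgM bi (IHs x).
Qed.

Lemma tensor_smooth b : (forall i, Csmooth (b i)) -> smooth (tensor b).
Proof.
move=> sb s; suff [b' sb' ->] : exists2 b', (forall i, Csmooth (b' i)) &
    foldr (@partial R d) (tensor b) s = tensor b'.
  by split; [exact: tensor_continuous|move=> i x; exact: tensor_derivable].
elim: s => [|j s [b' sb' IH]] /=; first by exists b.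
exists (tensor_derive j b'); first exact: tensor_derive_smooth.
by rewrite IH partial_tensor.
Qed.

(** Bounded pointwise approximation of the indicator of a box by smooth functions supported in the
    closed box, ready for dominated convergence. *)
Lemma box_approximation (c e : 'I_d -> R) : exists phi : nat -> E -> R, [/\
  forall n, smooth (phi n),
  forall n x, ~ cbox c e x -> phi n x = 0,
  forall n x, `|phi n x| <= 1 &
  forall x, phi n x @[n --> \oo] --> (\1_(box c e) x : R)].
Proof.
have [S [sS S0 S1 S01 _]] := @smooth_step R.
(* That is S(n (t - c_i)) S(n (e_i - t)): zero unless c_i < t < e_i, and equal to 1 as soon as both
   n (t - c_i) and n (e_i - t) reach 1. *)
pose b n i t := S (n%:R * t + - (n%:R * c i)) * S (- n%:R * t + n%:R * e i).
have bcS n i t : t <= c i -> b n i t = 0.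
  move=> tc; rewrite /b S0 ?mul0r// -mulrBr.
  by rewrite mulr_ge0_le0// subr_le0.
have beS n i t : e i <= t -> b n i t = 0.
  move=> tc; rewrite /b mulrC S0 ?mul0r// mulNr addrC -mulrBr.
  by rewrite mulr_ge0_le0// subr_le0.
exists (fun n => tensor (b n)); split.
- move=> n; apply: tensor_smooth => i.
  by apply: (@CsmoothM _ (fun t => S (n%:R * t + - (n%:R * c i))));
    exact: Csmooth_affine.
- move=> n x /existsNP[i /negP]; rewrite negb_and -!ltNge => /orP xi.
  rewrite /tensor (bigD1 i)//=; case: xi => /ltW xi; first by rewrite bcS// mul0r.
  by rewrite beS// mul0r.
- move=> n x; rewrite normr_prod; apply: prodr_ile1 => i _.
  rewrite normr_ge0 /b normrM mulr_ile1// ger0_norm//.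
  + by have /andP[] := S01 (n%:R * x 0 i + - (n%:R * c i)).
  + by have /andP[] := S01 (n%:R * x 0 i + - (n%:R * c i)).
  + by have /andP[] := S01 (- n%:R * x 0 i + n%:R * e i).
  + by have /andP[] := S01 (- n%:R * x 0 i + n%:R * e i).
- move=> x; rewrite indicE; have [xce|xce] := boolP (x \in box c e); last first.
    rewrite (_ : (fun n => _) = fun=> 0); first exact: cvg_cst.
    apply/funext => n; move: xce; rewrite notin_setE => /existsNP[i /negP].
    rewrite negb_and -!leNgt /tensor (bigD1 i)//= => /orP[] xi.
      by rewrite bcS// mul0r.
    by rewrite beS// mul0r.
  apply: cvg_near_cst.
  have H i : \forall n \near \oo, b n i (x 0 i) = 1.
    move: xce; rewrite inE => /(_ i) /andP[ci ei].
    near=> n; rewrite /b !S1 ?mulr1//.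
      rewrite mulNr addrC -mulrBr -ler_pdivrMr ?subr_gt0// mul1r.
      by near: n; exact: nbhs_infty_ger.
    rewrite -mulrBr -ler_pdivrMr ?subr_gt0// mul1r.
    by near: n; exact: nbhs_infty_ger.
  have {}H := filter_forall _ H.
  near=> n; have Hn : forall i, b n i (x 0 i) = 1 by near: n; exact: H.
  by rewrite /tensor big1.
Unshelve. all: by end_near. Qed.

End tensor_test_functions.

(** * The fundamental lemma of the calculus of variations *)

Section variational_lemma.
Context {R : realType} {d : nat} (Omega : set 'rV[R]_d).
Hypothesis Omega_open : open Omega.
Local Notation E := 'rV[R]_d.
Implicit Types (g psi : E -> R) (K : set E).

Let mOmega : measurable Omega := open_measurable_rV Omega_open.

Lemma locally_integrable_mul g psi K : Defs.locally_integrable Omega g ->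
  compact K -> K `<=` Omega -> continuous psi -> (forall x, ~ K x -> psi x = 0) ->
  lebd.-integrable Omega (EFin \o (g \* psi)).
Proof.
move=> [mg ig] cK KO cpsi psi0; have mK := compact_measurable_rV cK.
have restrictE : (EFin \o (g \* psi)) \_ Omega = (EFin \o (g \* psi)) \_ K.
  apply/funext => x; rewrite !patchE; case: ifPn => xO; case: ifPn => xK//.
    by rewrite /= psi0 ?mulr0//; move: xK; rewrite notin_setE.
  by move: xK; rewrite inE => /KO /mem_set; rewrite (negbTE xO).
apply/(integrable_mkcond _ mOmega); rewrite restrictE.
apply/(integrable_mkcond _ mK).
have -> : EFin \o (g \* psi) = ((EFin \o g) \* (EFin \o psi))%E.
  by apply/funext => x /=; rewrite EFinM.
apply: integrableMl => //; first exact: ig.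
- by apply: measurable_funTS; exact: continuous_measurable_rV.
- have /compact_bounded[M [_ HM]] : compact (psi @` K).
    by apply: continuous_compact => //; exact: continuous_subspaceT.
  by exists M; split; [exact: num_real|move=> y /HM{}HM x Kx; apply: HM; exists x].
Qed.

Lemma test_function_integrable g phi : Defs.locally_integrable Omega g ->
  test_function Omega phi -> lebd.-integrable Omega (EFin \o (g \* phi)).
Proof.
move=> ig [sphi [K cK [KO supp]]].
apply: (locally_integrable_mul ig cK KO) => [|x].
  by have [] := sphi [::].
by apply: contra_notP => /eqP phix; apply: supp.
Qed.

Lemma partial_integrable g phi i : Defs.locally_integrable Omega g ->
  test_function Omega phi ->
  lebd.-integrable Omega (EFin \o (g \* partial i phi)).
Proof.
move=> ig [sphi [K cK [KO supp]]].
apply: (locally_integrable_mul ig cK KO) => [|x nKx].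
  by have [] := sphi [:: i].
(* [K] is closed, so at a point outside it the test function vanishes on a whole neighbourhood and
   its derivative is 0. *)
rewrite /partial (@near_eq_derive _ _ _ _ (cst 0)) ?derive_cst//.
have oK : open (~` K).
  by apply: closed_openC; apply: compact_closed cK; exact: (@norm_hausdorff _ E).
have := open_nbhs_nbhs (conj oK nKx).
apply: filterS => y nKy /=; symmetry.
by apply: contrapT => /nesym/eqP /supp.
Qed.

Section vanishing.
Variable W : E -> R.
Hypothesis iW : Defs.locally_integrable Omega W.
Hypothesis W_test : forall phi, test_function Omega phi -> inner Omega W phi = 0.

(** Dominated convergence along smooth approximations of the box, with dominating function |W|,
    which is integrable because the closed box is a compact subset of [Omega]. *)
Let integral_box0 (a b : 'I_d -> R) : cbox a b `<=` Omega ->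
  (\int[lebd]_(x in box a b) (W x)%:E = 0)%E.
Proof.
move=> abO.
have iWab : lebd.-integrable (cbox a b) (EFin \o W).
  by apply: iW.2 => //; exact: compact_cbox.
have [phi [sphi phi0 phi1 phic]] := box_approximation a b.
have tphi n : test_function Omega (phi n).
  split => //; exists (cbox a b); first exact: compact_cbox.
  by split => // x /eqP; apply: contra_notP => /phi0.
have mphi n : measurable_fun setT (phi n).
  by apply: continuous_measurable_rV; have [] := sphi n [::].
have mab := measurable_cbox a b.
have mWab : measurable_fun (cbox a b) W.
  by apply/measurable_EFinP; exact: measurable_int iWab.
have := @dominated_convergence _ _ _ lebd _ mab
  (fun n x => (W x * phi n x)%:E) (fun x => (W x * \1_(box a b) x)%:E)
  (fun x => `|(W x)%:E|%E).
case => //.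
- move=> n; apply/measurable_EFinP; apply: measurable_funM => //.
  exact: (measurable_funTS (mphi n)).
- apply/measurable_EFinP; apply: measurable_funM => //.
  by apply: measurable_indic; exact: measurable_box.
- apply/nearW => x _; apply: cvg_EFin; first exact: nearW.
  by apply: cvgMr; exact: phic.
- exact: integrable_abse.
- apply/nearW => x n _; rewrite EFinM abseM /=.
  by rewrite -[leRHS]mule1 lee_wpmul2l// lee_fin.
move=> _ _.
rewrite (_ : (fun n => _) = fun=> 0%E); last first.
  apply/funext => n; have := W_test (tphi n).
  rewrite /inner /Rintegral => H.
  have iWphi := test_function_integrable iW (tphi n).
  have {H} H : (\int[lebd]_(x in Omega) (W x * phi n x)%:E = 0)%E.
    rewrite -[LHS]fineK ?H//; exact: integrable_fin_num iWphi.
  rewrite -H [RHS]integral_mkcond [LHS]integral_mkcond.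
  apply: eq_integral => x _; rewrite !patchE.
  case: ifPn => xab; case: ifPn => xO//.
    by move: xab; rewrite inE => /abO /mem_set; rewrite (negbTE xO).
  by rewrite phi0 ?mulr0//; move: xab; rewrite notin_setE.
move/cvg_lim => /(_ (@ereal_hausdorff R)); rewrite lim_cst//; move=> ->.
rewrite [LHS]integral_mkcond [RHS]integral_mkcond.
apply: eq_integral => x _; rewrite !patchE indicE.
case: ifPn => [xab|_].
  by rewrite mulr1 mem_set//; apply: box_sub_cbox; rewrite inE in xab.
by rewrite mulr0 if_same.
Qed.

Let box_setI (a b a' b' : 'I_d -> R) : box a b `&` box a' b' =
  box (fun i => Num.max (a i) (a' i)) (fun i => Num.min (b i) (b' i)).
Proof.
apply/seteqP; split => [x [H1 H2] i|x H].
  rewrite gt_max lt_min; have /andP[-> ->] := H1 i.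
  by have /andP[-> ->] := H2 i.
by split => i; have := H i; rewrite gt_max lt_min;
  move=> /andP[/andP[H1 H2] /andP[H3 H4]]; apply/andP.
Qed.

(** The measurable sets [A] such that W has integral 0 over [A] cut with the box contain all boxes
    and form a Dynkin class, hence are all measurable sets; a function whose integrals all vanish is
    0 almost everywhere. *)
Lemma locally_integrable_vanishing_box a b : cbox a b `<=` Omega ->
  {ae lebd, forall x, box a b x -> W x = 0}.
Proof.
move=> abO.
have mab := measurable_box a b.
have iWab : lebd.-integrable (box a b) (EFin \o W).
  apply: (integrableS (measurable_cbox a b)) => //; first exact: box_sub_cbox.
  by apply: iW.2 => //; exact: compact_cbox.
suff H : forall A, measurable A ->
    (\int[lebd]_(x in A `&` box a b) (W x)%:E = 0)%E.
  have := @integral_ae_eq _ _ _ lebd _ mab (cst 0)%E (EFin \o W) iWab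
    (measurable_cst _).
  case=> [A Aab mA|N [mN N0 HN]].
    by have := H A mA; rewrite setIidl// => ->; rewrite integral0.
  exists N; split => // x /= xn; apply: HN => /= H0; apply: xn => xab.
  by have [] := H0 xab.
move=> A mA; move: (mA); rewrite rV_measurable_boxes; move: A {mA}.
apply: (@dynkin_induction _ _ [set A | exists a b, A = box a b]
  (fun A => (\int[lebd]_(x in A `&` box a b) (W x)%:E = 0)%E)).
- exact: rV_measurable_boxes.
- move=> _ _ [a1 [b1 ->]] [a2 [b2 ->]]; rewrite box_setI.
  by eexists; eexists.
- by rewrite setTI integral_box0.
- move=> _ [a1 [b1 ->]]; rewrite box_setI integral_box0//.
  apply: subset_trans abO => x H i; have := H i.
  by rewrite ge_max le_min => /andP[/andP[_ ->] /andP[_ ->]].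
- move=> A mA A0.
  have : (\int[lebd]_(x in box a b) (W x)%:E =
      \int[lebd]_(x in A `&` box a b) (W x)%:E +
      \int[lebd]_(x in ~` A `&` box a b) (W x)%:E)%E.
    rewrite -integral_setU_EFin//.
    + by rewrite -setIUl setUv setTI.
    + exact: measurableI.
    + by apply: measurableI => //; exact: measurableC.
    + rewrite -setIUl setUv setTI; apply/measurable_EFinP.
      exact: measurable_int iWab.
    + by apply/disj_setPLR => x [Ax _] /= [].
  by rewrite integral_box0// A0 add0e => <-.
- move=> F mF tF F0.
  rewrite setI_bigcupl integral_bigcup//.
  + by rewrite eseries0// => i _ _; exact: F0.
  + by apply: trivIset_setIr.
  + by move=> k; exact: measurableI.
  + apply: integrableS iWab => //.
      by apply: bigcupT_measurable => k; exact: measurableI.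
    by move=> x [k _ []].
Qed.

(** Countably many boxes with closure in [Omega] cover [Omega], and a countable union of null sets
    is null. *)
Lemma locally_integrable_vanishing : {ae lebd, forall x, Omega x -> W x = 0}.
Proof.
have [c Oc mc] := open_rV_bigcup Omega_open.
have H k : {ae lebd, forall x, cbox (c k).1 (c k).2 `<=` Omega ->
    box (c k).1 (c k).2 x -> W x = 0}.
  have [kO|nkO] := pselect (cbox (c k).1 (c k).2 `<=` Omega).
    have := locally_integrable_vanishing_box kO.
    by apply: filterS => x Hx _.
  by apply/nearW => x.
have := ae_foralln H; apply: filterS => x Hx /Oc[k /= kO xk].
exact: Hx xk.
Qed.

End vanishing.

End variational_lemma.

(** * Semi-inner products and L^2 *)

(** A positive semidefinite form, with laws on the carrier only: outside it [B] may be meaningless,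
    and functions that differ on a null set stay distinct, so definiteness cannot be asked. It is
    instantiated with L^2, H^1 and square-integrable vector fields. *)
Record semi_inner (R : realType) (V : lmodType R) (X : seminormed V)
    (B : V -> V -> R) : Prop := SemiInner {
  semi_inner0 : X 0 ;
  semi_innerD : forall u v, X u -> X v -> X (u + v) ;
  semi_innerZ : forall a u, X u -> X (a *: u) ;
  semi_formD : forall u v w, X u -> X v -> X w -> B (u + v) w = B u w + B v w ;
  semi_formZ : forall a u w, X u -> X w -> B (a *: u) w = a * B u w ;
  semi_formC : forall u v, X u -> X v -> B u v = B v u ;
  semi_form_sqr : forall u, X u -> snorm X u ^+ 2 = B u u ;
  snorm_ge0 : forall u, 0 <= snorm X u }.

Section semi_inner_theory.
Context {R : realType} {V : lmodType R} {X : seminormed V} {B : V -> V -> R}.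
Hypothesis XB : semi_inner X B.
Implicit Types u v w : V.

Lemma semi_innerN u : X u -> X (- u).
Proof. by move=> Xu; rewrite -scaleN1r; exact: (semi_innerZ XB). Qed.

Lemma semi_innerB u v : X u -> X v -> X (u - v).
Proof. by move=> Xu Xv; apply: (semi_innerD XB) => //; exact: semi_innerN. Qed.

Lemma semi_inner_sum I (s : seq I) (F : I -> V) :
  (forall i, X (F i)) -> X (\sum_(i <- s) F i).
Proof.
move=> XF; elim: s => [|i s IHs]; first by rewrite big_nil; exact: semi_inner0 XB.
by rewrite big_cons; exact: (semi_innerD XB).
Qed.

Lemma semi_formN u w : X u -> X w -> B (- u) w = - B u w.
Proof. by move=> Xu Xw; rewrite -scaleN1r (semi_formZ XB)// mulN1r. Qed.

Lemma semi_formB u v w : X u -> X v -> X w -> B (u - v) w = B u w - B v w.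
Proof.
by move=> Xu Xv Xw; rewrite (semi_formD XB)//; [rewrite semi_formN|exact: semi_innerN].
Qed.

Lemma semi_form0 w : X w -> B 0 w = 0.
Proof.
by move=> Xw; rewrite -(scale0r 0) (semi_formZ XB) ?mul0r//; exact: (semi_inner0 XB).
Qed.

Lemma semi_form_sum I (s : seq I) (F : I -> V) w : (forall i, X (F i)) -> X w ->
  B (\sum_(i <- s) F i) w = \sum_(i <- s) B (F i) w.
Proof.
move=> XF Xw; elim: s => [|i s IHs]; first by rewrite !big_nil semi_form0.
by rewrite !big_cons (semi_formD XB) ?IHs//; exact: semi_inner_sum.
Qed.

Lemma snormZ a u : X u -> snorm X (a *: u) = `|a| * snorm X u.
Proof.
move=> Xu; have Xau := semi_innerZ XB a Xu.
apply/eqP; rewrite -(@eqrXn2 _ 2)//; last 2 first.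
- exact: (snorm_ge0 XB).
- by rewrite mulr_ge0// (snorm_ge0 XB).
rewrite exprMn !(semi_form_sqr XB)// (semi_formZ XB)// (semi_formC XB)//.
by rewrite (semi_formZ XB)// real_normK ?num_real// mulrA expr2.
Qed.

Lemma snormN u : X u -> snorm X (- u) = snorm X u.
Proof. by move=> Xu; rewrite -scaleN1r snormZ// normrN1 mul1r. Qed.

Lemma snorm0 : snorm X 0 = 0.
Proof. by rewrite -(scale0r 0) snormZ ?normr0 ?mul0r//; exact: (semi_inner0 XB). Qed.

Lemma snormBC u v : X u -> X v -> snorm X (u - v) = snorm X (v - u).
Proof. by move=> Xu Xv; rewrite -snormN ?opprB//; exact: semi_innerB. Qed.

Lemma cauchy_schwarz u v : X u -> X v -> `|B u v| <= snorm X u * snorm X v.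
Proof.
move=> Xu Xv.
have ge0 s t : 0 <= s ^+ 2 * B u u + 2 * s * t * B u v + t ^+ 2 * B v v.
  have Xsu := semi_innerZ XB s Xu; have Xtv := semi_innerZ XB t Xv.
  have Xst := semi_innerD XB Xsu Xtv.
  have := sqr_ge0 (snorm X (s *: u + t *: v)).
  rewrite (semi_form_sqr XB)// (semi_formD XB)// !(semi_formZ XB)//.
  rewrite ![B _ (_ + _)](semi_formC XB)// !(semi_formD XB)// !(semi_formZ XB)//.
  by rewrite (semi_formC XB Xv Xu); congr (_ <= _); ring.
have nu := snorm_ge0 XB u; have nv := snorm_ge0 XB v.
rewrite -(@ler_pXn2r _ 2)// ?nnegrE ?mulr_ge0//.
rewrite exprMn !(semi_form_sqr XB)// real_normK ?num_real//.
have a0 : 0 <= B u u by rewrite -(semi_form_sqr XB)// sqr_ge0.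
have c0 : 0 <= B v v by rewrite -(semi_form_sqr XB)// sqr_ge0.
move: (B u u) (B u v) (B v v) a0 c0 ge0 => a b c a0 c0 ge0.
(* Without definiteness the discriminant argument splits: a > 0 uses (s, t) = (-b, a), a = 0 < c
   uses (c, -b), and a = c = 0 uses (1, -b), which forces b = 0. *)
have [ca|] := ltP 0 a.
  by have := ge0 (- b) a; nra.
move=> ale0; have {ale0}a00 : a = 0 by apply/eqP; rewrite eq_le ale0.
rewrite a00 mul0r; have [cc|cle0] := ltP 0 c.
  by have := ge0 c (- b); rewrite a00; nra.
by have := ge0 1 (- b); rewrite a00 (_ : c = 0); [nra|apply/eqP; rewrite eq_le cle0].
Qed.

Lemma snormD u v : X u -> X v -> snorm X (u + v) <= snorm X u + snorm X v.
Proof.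
move=> Xu Xv; have Xuv := semi_innerD XB Xu Xv.
have nu := snorm_ge0 XB u; have nv := snorm_ge0 XB v.
rewrite -(@ler_pXn2r _ 2)// ?nnegrE ?addr_ge0// ?(snorm_ge0 XB)//.
rewrite (semi_form_sqr XB)// (semi_formD XB)// ![B _ (_ + _)](semi_formC XB)//.
rewrite !(semi_formD XB)// (semi_formC XB Xv Xu) -!(semi_form_sqr XB)//.
have := ler_norm (B u v); have := cauchy_schwarz Xu Xv.
by move: (B u v) (snorm X u) (snorm X v) => b s t h1 h2; nra.
Qed.

Lemma snormB u v w : X u -> X v -> X w ->
  snorm X (u - w) <= snorm X (u - v) + snorm X (v - w).
Proof.
move=> Xu Xv Xw; rewrite -[u - w](subrKA v); apply: snormD; exact: semi_innerB.
Qed.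

Lemma ler_snormB u v : X u -> X v -> `|snorm X u - snorm X v| <= snorm X (u - v).
Proof.
move=> Xu Xv; rewrite ler_norml; apply/andP; split.
  rewrite lerNl opprB lerBlDr snormBC//.
  by have := snormD (semi_innerB Xv Xu) Xu; rewrite subrK.
by rewrite lerBlDr; have := snormD (semi_innerB Xu Xv) Xv; rewrite subrK.
Qed.

End semi_inner_theory.

Lemma Lnorm2_sqr (R : realType) d (T : measurableType d)
    (mu : {measure set T -> \bar R}) (h : T -> R) :
  (Lnorm mu 2%:E (EFin \o h) < +oo)%E ->
  ((fine (Lnorm mu 2%:E (EFin \o h))) ^+ 2)%:E = (\int[mu]_x (h x ^+ 2)%:E)%E.
Proof.
move=> fin; have <- : (Lnorm mu 2%:E (EFin \o h) `^ 2 =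
    \int[mu]_x (h x ^+ 2)%:E)%E.
  rewrite poweR_Lnorm ?pnatr_eq0//; apply: eq_integral => x _ /=.
  by rewrite -[X in _ `^ X]/(2%:R) powR_mulrn// real_normK ?num_real.
have : Lnorm mu 2%:E (EFin \o h) \is a fin_num by rewrite ge0_fin_numE ?Lnorm_ge0.
have := Lnorm_ge0 mu 2%:E (EFin \o h).
case: (Lnorm _ _ _) => [r| |]//= r0 _.
by rewrite -[X in _ `^ X]/(2%:R) powR_mulrn.
Qed.

Lemma Lnorm2_lty (R : realType) d (T : measurableType d)
    (mu : {measure set T -> \bar R}) (h : T -> R) :
  (Lnorm mu 2%:E (EFin \o h) < +oo)%E <-> (\int[mu]_x (h x ^+ 2)%:E < +oo)%E.
Proof.
have E : (\int[mu]_x (`|(h x)%:E| `^ 2) = \int[mu]_x (h x ^+ 2)%:E)%E.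
  apply: eq_integral => x _ /=.
  by rewrite -[X in _ `^ X]/(2%:R) powR_mulrn// real_normK ?num_real.
split; last by move=> fin; rewrite unlock poweR_lty// E.
by move=> /(poweR_lty 2); rewrite poweR_Lnorm ?pnatr_eq0// E.
Qed.

Section L2.
Context {R : realType} {d : nat} (Omega : set 'rV[R]_d).
Local Notation E := 'rV[R]_d.
Local Notation L2 := (L2_space Omega).
Implicit Types (C : R) (g h a : E -> R).

Lemma patch_mul g1 g2 : (g1 \* g2) \_ Omega = (g1 \_ Omega) \* (g2 \_ Omega).
Proof. by apply/funext => x /=; rewrite !patchE; case: ifP; rewrite ?mulr0. Qed.

Lemma patch_add g1 g2 : (g1 + g2) \_ Omega = (g1 \_ Omega) + (g2 \_ Omega).
Proof.
by apply/funext => x; rewrite !fctE !patchE; case: ifP => // _; rewrite addr0.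
Qed.

Lemma patch_scale c g : (c *: g) \_ Omega = c *: (g \_ Omega).
Proof.
by apply/funext => x; rewrite !fctE !patchE; case: ifP => // _; rewrite scaler0.
Qed.

Lemma innerE g1 g2 : inner Omega g1 g2 =
  \int[lebd]_x ((g1 \_ Omega) x * (g2 \_ Omega) x).
Proof.
rewrite /inner Rintegral_mkcond; congr (Rintegral _ _ _).
exact: (patch_mul g1 g2).
Qed.

Lemma L2_measurable g : L2 g -> measurable_fun setT (g \_ Omega).
Proof. by rewrite /= inE => /andP[]; rewrite inE. Qed.

Lemma L2_mul_integrable g1 g2 : L2 g1 -> L2 g2 -> lebd.-integrable setT
  (EFin \o (fun x => (g1 \_ Omega) x * (g2 \_ Omega) x)).
Proof. by move=> L1 L2; apply/Lfun1_integrable; exact: Lfun2_mul_Lfun1. Qed.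

Lemma L2P g : measurable_fun setT (g \_ Omega) ->
  (\int[lebd]_x ((g \_ Omega) x ^+ 2)%:E < +oo)%E -> L2 g.
Proof.
move=> mg ig; rewrite /= inE; apply/andP; split; rewrite inE//=.
by rewrite /finite_norm; apply/Lnorm2_lty.
Qed.

Lemma L2_fin g : L2 g -> (Lnorm lebd 2%:E (EFin \o g \_ Omega) < +oo)%E.
Proof. by rewrite /= inE => /andP[_]; rewrite inE. Qed.

Lemma L2_snorm_sqr g : L2 g -> (snorm L2 g ^+ 2)%:E =
  (\int[lebd]_x ((g \_ Omega) x ^+ 2)%:E)%E.
Proof. by move=> /L2_fin; exact: Lnorm2_sqr. Qed.

Lemma L2_add g1 g2 : L2 g1 -> L2 g2 -> L2 (g1 + g2).
Proof.
rewrite /= patch_add.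
exact: (Lfun_addr_closed _ (lee1n 2)).2.
Qed.

Lemma L2_scale c g : L2 g -> L2 (c *: g).
Proof.
move=> Lg; rewrite /= patch_scale.
have [_ H] := Lfun_submod_closed (lebd : {measure set E -> \bar R}) (lee1n 2).
have [L0 _] := Lfun_addr_closed (lebd : {measure set E -> \bar R}) (lee1n 2).
by rewrite -[_ *: _]addr0; exact: H.
Qed.

Lemma L2_semi_inner : semi_inner L2 (inner Omega).
Proof.
split.
- rewrite /= (_ : 0 \_ Omega = 0).
    exact: (Lfun_addr_closed _ (lee1n 2)).1.
  by apply/funext => x; rewrite patchE if_same.
- exact: L2_add.
- exact: L2_scale.
- move=> u v w Lu Lv Lw; rewrite !innerE -RintegralD//.
  + apply: eq_Rintegral => x _; rewrite patch_add fctE; exact: mulrDl.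
  + exact: L2_mul_integrable.
  + exact: L2_mul_integrable.
- move=> c u w Lu Lw; rewrite !innerE -RintegralZl//.
  + by apply: eq_Rintegral => x _; rewrite patch_scale fctE -scalerAl.
  + exact: L2_mul_integrable.
- by move=> u v _ _; rewrite !innerE; apply: eq_Rintegral => x _; rewrite mulrC.
- move=> u Lu; rewrite innerE /Rintegral.
  by rewrite -[LHS]/(fine (_)%:E) L2_snorm_sqr.
- by move=> u; rewrite fine_ge0// Lnorm_ge0.
Qed.

(** Membership and norm bound together: bounded coefficients, Lipschitz compositions and functions
    that agree almost everywhere are all cases of pointwise domination. *)
Lemma L2_dominated C g h : measurable_fun setT (h \_ Omega) -> L2 g -> 0 <= C ->
  {ae lebd, forall x, Omega x -> `|h x| <= C * `|g x|} ->
  L2 h /\ snorm L2 h <= C * snorm L2 g.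
Proof.
move=> mh Lg C0 hg; have mg := L2_measurable Lg.
have le : (\int[lebd]_x ((h \_ Omega) x ^+ 2)%:E <=
    (C ^+ 2)%:E * \int[lebd]_x ((g \_ Omega) x ^+ 2)%:E)%E.
  rewrite -ge0_integralZl//; last 3 first.
  - by apply/measurable_EFinP; exact: measurable_funX.
  - by move=> x _; rewrite lee_fin sqr_ge0.
  - by rewrite lee_fin sqr_ge0.
  apply: ae_ge0_le_integral => //.
  - by move=> x _; rewrite lee_fin sqr_ge0.
  - by apply/measurable_EFinP; exact: measurable_funX.
  - by move=> x _; rewrite -EFinM lee_fin mulr_ge0 ?sqr_ge0.
  - apply: measurable_funeM; apply/measurable_EFinP; exact: measurable_funX.
  - apply: filterS hg => x hgx _; rewrite -EFinM lee_fin !patchE.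
    case: ifPn => xO; last by rewrite expr0n/= mulr0.
    rewrite -exprMn -[leLHS]real_normK ?num_real// -[leRHS]real_normK ?num_real//.
    rewrite lerXn2r ?nnegrE// normrM (ger0_norm C0); apply: hgx.
    by rewrite inE in xO.
have Lh : L2 h.
  apply: L2P => //; apply: le_lt_trans le _.
  by rewrite -L2_snorm_sqr// -EFinM ltry.
split => //.
have nh := snorm_ge0 L2_semi_inner h; have ng := snorm_ge0 L2_semi_inner g.
rewrite -(@ler_pXn2r _ 2)// ?nnegrE ?mulr_ge0//.
by move: le; rewrite -!L2_snorm_sqr// -EFinM lee_fin -exprMn.
Qed.

Lemma L2_mul_dominated C a g : measurable_fun setT (a \_ Omega) -> L2 g ->
  0 <= C -> {ae lebd, forall x, Omega x -> `|a x| <= C} ->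
  L2 (a \* g) /\ snorm L2 (a \* g) <= C * snorm L2 g.
Proof.
move=> ma Lg C0 aC; apply: L2_dominated => //.
  by rewrite patch_mul; apply: measurable_funM => //; exact: L2_measurable.
by apply: filterS aC => x aC xO; rewrite normrM ler_wpM2r// aC.
Qed.

Lemma L2_snorm_eq0 g : L2 g -> snorm L2 g = 0 ->
  {ae lebd, forall x, Omega x -> g x = 0}.
Proof.
move=> Lg g0; have : Lnorm lebd 2%:E (EFin \o g \_ Omega) = 0%E.
  rewrite -[LHS]fineK; first by rewrite -[fine _]/(snorm L2 g) g0.
  by rewrite ge0_fin_numE ?L2_fin ?Lnorm_ge0.
move=> /Lnorm_eq0_eq0; case => //.
  by apply/measurable_EFinP; exact: L2_measurable.
move=> N [mN N0 HN]; exists N; split => // x /= xg; apply: HN => /= H; apply: xg => xO.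
by have [] := H I; rewrite patchE mem_set.
Qed.

Lemma L2_ae0 g : measurable_fun setT (g \_ Omega) ->
  {ae lebd, forall x, Omega x -> g x = 0} -> L2 g /\ snorm L2 g = 0.
Proof.
move=> mg g0; have [|||Lg ng] := @L2_dominated 0 0 g mg.
- exact: semi_inner0 L2_semi_inner.
- by [].
- by apply: filterS g0 => x g0 /g0 ->; rewrite normr0 mul0r.
by split=> //; apply/eqP; rewrite eq_le (snorm_ge0 L2_semi_inner)// andbT -[leRHS](mul0r (snorm L2 0)).
Qed.

Lemma Linfty_measurable g : Linfty_space Omega g -> measurable_fun setT (g \_ Omega).
Proof. by rewrite /= inE => /andP[]; rewrite inE. Qed.

Lemma Linfty_bound g : Linfty_space Omega g ->
  {ae lebd, forall x, Omega x -> `|g x| <= snorm (Linfty_space Omega) g}.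
Proof.
rewrite /= inE => /andP[]; rewrite !inE/= /finite_norm => mg.
(* When the whole space has measure 0 the norm is given by a separate convention, and any property
   holds almost everywhere. *)
rewrite unlock; case: ifPn => [mu0|]; last first.
  rewrite lt0e measure_ge0 andbT negbK => /eqP mu0 _.
  by exists setT; split => //; exact: measurableT.
move=> fin.
have := ess_sup_ge (lebd : {measure set E -> \bar R}) (abse \o (EFin \o g \_ Omega)).
apply: filterS => x /=.
have ge0 : (0 <= ess_sup lebd (abse \o (EFin \o g \_ Omega)))%E.
  apply: ess_sup_gee => //; by apply/nearW => y /=; rewrite lee_fin.
rewrite -[X in (_ <= X)%E]fineK ?ge0_fin_numE// lee_fin => + xO.
by rewrite patchE mem_set.
Qed.

End L2.

(** * Weak gradients and H^1 *)

Section weak_gradient.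
Context {R : realType} {d : nat} (Omega : set 'rV[R]_d).
Hypothesis Omega_open : open Omega.
Local Notation E := 'rV[R]_d.
Local Notation L2 := (L2_space Omega).
Local Notation H1 := (H1_space Omega).
Implicit Types (g phi : E -> R) (G : 'I_d -> E -> R).

Let mOmega : measurable Omega := open_measurable_rV Omega_open.

Lemma locally_integrableD g1 g2 : Defs.locally_integrable Omega g1 ->
  Defs.locally_integrable Omega g2 -> Defs.locally_integrable Omega (g1 + g2).
Proof.
move=> [m1 i1] [m2 i2]; split; first exact: measurable_funD.
move=> K cK KO; have mK := compact_measurable_rV cK.
rewrite (_ : EFin \o _ = ((EFin \o g1) \+ (EFin \o g2))%E).
  by apply: integrableD => //; [exact: i1|exact: i2].
by apply/funext => x /=; rewrite EFinD.
Qed.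

Lemma locally_integrableZ c g : Defs.locally_integrable Omega g ->
  Defs.locally_integrable Omega (c *: g).
Proof.
move=> [mg ig]; split; first exact: measurable_funM.
move=> K cK KO; have mK := compact_measurable_rV cK.
rewrite (_ : EFin \o _ = (fun x => (c%:E * (EFin \o g) x)%E)).
  by apply: integrableZl => //; exact: ig.
by apply/funext => x /=; rewrite EFinM.
Qed.

Lemma innerDl_integrable g1 g2 phi :
  lebd.-integrable Omega (EFin \o (g1 \* phi)) ->
  lebd.-integrable Omega (EFin \o (g2 \* phi)) ->
  inner Omega (g1 + g2) phi = inner Omega g1 phi + inner Omega g2 phi.
Proof.
move=> i1 i2; rewrite /inner -RintegralD//.
by apply: eq_Rintegral => x _; rewrite fctE mulrDl.
Qed.

Lemma innerZl_integrable c g phi :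
  lebd.-integrable Omega (EFin \o (g \* phi)) ->
  inner Omega (c *: g) phi = c * inner Omega g phi.
Proof.
move=> ig; rewrite /inner -RintegralZl//.
by apply: eq_Rintegral => x _; rewrite fctE -scalerAl.
Qed.

Lemma weak_gradientD g1 g2 G1 G2 : is_weak_gradient Omega g1 G1 ->
  is_weak_gradient Omega g2 G2 ->
  is_weak_gradient Omega (g1 + g2) (fun i => G1 i + G2 i).
Proof.
move=> [l1 w1] [l2 w2]; split; first exact: locally_integrableD.
move=> i; have [lG1 e1] := w1 i; have [lG2 e2] := w2 i.
split; first exact: locally_integrableD.
move=> phi tphi; rewrite !innerDl_integrable.
- by rewrite e1// e2// opprD.
- exact: test_function_integrable.
- exact: test_function_integrable.
- exact: partial_integrable.
- exact: partial_integrable.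
Qed.

Lemma weak_gradientZ c g G : is_weak_gradient Omega g G ->
  is_weak_gradient Omega (c *: g) (fun i => c *: G i).
Proof.
move=> [l w]; split; first exact: locally_integrableZ.
move=> i; have [lG e] := w i; split; first exact: locally_integrableZ.
move=> phi tphi; rewrite !innerZl_integrable.
- by rewrite e// mulrN.
- exact: test_function_integrable.
- exact: partial_integrable.
Qed.

(** The difference of the two fields is orthogonal to every test function, so the fundamental lemma
    applies to each component. *)
Lemma weak_gradient_unique g G1 G2 : is_weak_gradient Omega g G1 ->
  is_weak_gradient Omega g G2 ->
  forall i, {ae lebd, forall x, Omega x -> G1 i x = G2 i x}.
Proof.
move=> [_ w1] [_ w2] i; have [l1 e1] := w1 i; have [l2 e2] := w2 i.
have l2N := locally_integrableZ (-1) l2.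
have := locally_integrable_vanishing Omega_open (locally_integrableD l1 l2N).
have W0 phi : test_function Omega phi ->
    inner Omega (G1 i + (- 1 *: G2 i)) phi = 0.
  move=> tphi; rewrite innerDl_integrable; last 2 first.
  - exact: test_function_integrable.
  - exact: test_function_integrable.
  rewrite innerZl_integrable; last exact: test_function_integrable.
  by apply: oppr_inj; rewrite opprD -e1// mulN1r opprK e2// oppr0 addNr.
move=> /(_ W0); apply: filterS => x H xO.
by have := H xO; rewrite !fctE scaleN1r => /eqP; rewrite subr_eq0 => /eqP.
Qed.

Lemma gradP g : weakly_differentiable Omega g ->
  is_weak_gradient Omega g (grad Omega g).
Proof. by move=> [G wG]; rewrite /grad; apply: xgetPex; exists G. Qed.

Lemma weakly_differentiableD g1 g2 : weakly_differentiable Omega g1 ->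
  weakly_differentiable Omega g2 -> weakly_differentiable Omega (g1 + g2).
Proof. by move=> [G1 w1] [G2 w2]; eexists; exact: weak_gradientD w1 w2. Qed.

Lemma weakly_differentiableZ c g : weakly_differentiable Omega g ->
  weakly_differentiable Omega (c *: g).
Proof. by move=> [G w]; eexists; exact: weak_gradientZ w. Qed.

(** [grad] is a choice of representative, with no linearity of its own: the sum of the chosen
    gradients is another weak gradient, and uniqueness identifies the two up to a null set. *)
Lemma gradD g1 g2 i : weakly_differentiable Omega g1 ->
  weakly_differentiable Omega g2 -> {ae lebd, forall x, Omega x ->
  grad Omega (g1 + g2) i x = (grad Omega g1 i + grad Omega g2 i) x}.
Proof.
move=> w1 w2; have wD := weak_gradientD (gradP w1) (gradP w2).
exact: (weak_gradient_unique (gradP (weakly_differentiableD w1 w2)) wD i).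
Qed.

Lemma gradZ c g i : weakly_differentiable Omega g ->
  {ae lebd, forall x, Omega x -> grad Omega (c *: g) i x = (c *: grad Omega g i) x}.
Proof.
move=> w; have wZ := weak_gradientZ c (gradP w).
exact: (weak_gradient_unique (gradP (weakly_differentiableZ c w)) wZ i).
Qed.

Lemma grad_measurable g i : weakly_differentiable Omega g ->
  measurable_fun setT (grad Omega g i \_ Omega).
Proof.
move=> /gradP[_ /(_ i)[[mG _] _]].
exact/(measurable_restrictT _ mOmega).
Qed.

Lemma L2_ae_eq g1 g2 : measurable_fun setT (g1 \_ Omega) -> L2 g2 ->
  {ae lebd, forall x, Omega x -> g1 x = g2 x} -> L2 g1 /\ snorm L2 (g1 - g2) = 0.
Proof.
move=> m1 L2 e; have [L1 _] : L2_space Omega g1 /\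
    snorm (L2_space Omega) g1 <= 1 * snorm (L2_space Omega) g2.
  by apply: L2_dominated => //; apply: filterS e => x e /e ->; rewrite mul1r.
split=> //; have L12 := semi_innerB (L2_semi_inner Omega) L1 L2.
apply: (L2_ae0 (L2_measurable L12) _).2.
by apply: filterS e => x e /e xO; rewrite !fctE xO subrr.
Qed.

Lemma inner_ae_eq g1 g2 phi : measurable_fun setT (g1 \_ Omega) -> L2 g2 ->
  L2 phi -> {ae lebd, forall x, Omega x -> g1 x = g2 x} ->
  inner Omega g1 phi = inner Omega g2 phi.
Proof.
move=> m1 L2 Lphi e; have [L1 n0] := L2_ae_eq m1 L2 e.
apply/eqP; rewrite -subr_eq0 -normr_le0.
rewrite -(semi_formB (L2_semi_inner Omega))//.
have := cauchy_schwarz (L2_semi_inner Omega)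
  (semi_innerB (L2_semi_inner Omega) L1 L2) Lphi.
by rewrite n0 mul0r.
Qed.

Definition inner_H1 g1 g2 :=
  inner Omega g1 g2 + inner_vec Omega (grad Omega g1) (grad Omega g2).

Let integral_grad_sqr g : weakly_differentiable Omega g ->
  (\int[lebd]_x (((fun x => Num.sqrt (\sum_(i < d) grad Omega g i x ^+ 2))
      \_ Omega) x ^+ 2)%:E =
   \sum_(i < d) \int[lebd]_x ((grad Omega g i \_ Omega) x ^+ 2)%:E)%E.
Proof.
move=> wg; rewrite -ge0_integral_sum//; last 2 first.
- move=> i; apply/measurable_EFinP; apply: measurable_funX.
  exact: grad_measurable.
- by move=> i x _; rewrite lee_fin sqr_ge0.
apply: eq_integral => x _; rewrite sumEFin; congr EFin.
rewrite patchE; case: ifPn => xO; last first.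
  rewrite expr0n/= big1// => i _; rewrite patchE (negbTE xO) expr0n//.
rewrite sqr_sqrtr; last by apply: sumr_ge0 => i _; exact: sqr_ge0.
by apply: eq_bigr => i _; rewrite patchE xO.
Qed.

Lemma grad_norm_fin g : (grad_norm Omega g < +oo)%E ->
  weakly_differentiable Omega g /\ (forall i, L2 (grad Omega g i)).
Proof.
rewrite /grad_norm; case: asboolP => // wg fin; split => // i.
apply: L2P; first exact: grad_measurable.
move/Lnorm2_lty : fin; rewrite integral_grad_sqr//.
apply: le_lt_trans; rewrite (bigD1 i)//= leeDl// sume_ge0// => j _.
by apply: integral_ge0 => x _; rewrite lee_fin sqr_ge0.
Qed.

Lemma grad_norm_sqr g : weakly_differentiable Omega g ->
  (forall i, L2 (grad Omega g i)) -> grad_norm Omega g \is a fin_num /\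
  fine (grad_norm Omega g) ^+ 2 = inner_vec Omega (grad Omega g) (grad Omega g).
Proof.
move=> wg LG; rewrite /grad_norm; case: asboolP => // _.
set h := (X in EFin \o X).
have hE : (\int[lebd]_x (h x ^+ 2)%:E =
    (inner_vec Omega (grad Omega g) (grad Omega g))%:E)%E.
  rewrite /h integral_grad_sqr// /inner_vec -sumEFin; apply: eq_bigr => i _.
  by rewrite -(semi_form_sqr (L2_semi_inner Omega))// L2_snorm_sqr.
have fin : (Lnorm lebd 2%:E (EFin \o h) < +oo)%E.
  by apply/Lnorm2_lty; rewrite hE ltry.
split; first by rewrite ge0_fin_numE ?Lnorm_ge0.
by apply: EFin_inj; rewrite Lnorm2_sqr.
Qed.

Lemma H1_L2 g : H1 g -> L2 g. Proof. by case. Qed.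
Lemma H1_weak g : H1 g -> weakly_differentiable Omega g. Proof. by case. Qed.
Lemma H1_grad g i : H1 g -> L2 (grad Omega g i). Proof. by case. Qed.

Let sipL2 := L2_semi_inner Omega.

Lemma inner_vecDl G1 G2 G : (forall i, L2 (G1 i)) -> (forall i, L2 (G2 i)) ->
  (forall i, L2 (G i)) -> inner_vec Omega (fun i => G1 i + G2 i) G =
  inner_vec Omega G1 G + inner_vec Omega G2 G.
Proof.
move=> L1 L2 L; rewrite /inner_vec -big_split/=; apply: eq_bigr => i _.
exact: (semi_formD sipL2).
Qed.

Lemma inner_vecZl c G1 G : (forall i, L2 (G1 i)) -> (forall i, L2 (G i)) ->
  inner_vec Omega (fun i => c *: G1 i) G = c * inner_vec Omega G1 G.
Proof.
move=> L1 L; rewrite /inner_vec mulr_sumr; apply: eq_bigr => i _.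
exact: (semi_formZ sipL2).
Qed.

Lemma inner_vecC G1 G2 : (forall i, L2 (G1 i)) -> (forall i, L2 (G2 i)) ->
  inner_vec Omega G1 G2 = inner_vec Omega G2 G1.
Proof.
by move=> L1 L2; rewrite /inner_vec; apply: eq_bigr => i _; exact: (semi_formC sipL2).
Qed.

Lemma inner_vec_ae_eq G1 G2 G :
  (forall i, measurable_fun setT (G1 i \_ Omega)) -> (forall i, L2 (G2 i)) ->
  (forall i, L2 (G i)) ->
  (forall i, {ae lebd, forall x, Omega x -> G1 i x = G2 i x}) ->
  inner_vec Omega G1 G = inner_vec Omega G2 G.
Proof.
move=> m1 L2 L e; rewrite /inner_vec; apply: eq_bigr => i _.
exact: inner_ae_eq.
Qed.

Lemma H1D g1 g2 : H1 g1 -> H1 g2 -> H1 (g1 + g2).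
Proof.
move=> [L1 w1 G1] [L2 w2 G2]; have w := weakly_differentiableD w1 w2.
split => //; first exact: (semi_innerD sipL2).
move=> i; have mG := grad_measurable i w.
exact: (L2_ae_eq mG (semi_innerD sipL2 (G1 i) (G2 i)) (gradD i w1 w2)).1.
Qed.

Lemma H1Z c g : H1 g -> H1 (c *: g).
Proof.
move=> [L w G]; have wc := weakly_differentiableZ c w.
split => //; first exact: (semi_innerZ sipL2).
move=> i; have mG := grad_measurable i wc.
exact: (L2_ae_eq mG (semi_innerZ sipL2 c (G i)) (gradZ c i w)).1.
Qed.

Lemma inner_vec_grad_sqr g : H1 g ->
  fine (grad_norm Omega g) ^+ 2 = inner_vec Omega (grad Omega g) (grad Omega g).
Proof. by case=> _ w G; exact: (grad_norm_sqr w G).2. Qed.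

Lemma inner_vec_ge0 G : (forall i, L2 (G i)) -> 0 <= inner_vec Omega G G.
Proof.
move=> L; rewrite /inner_vec; apply: sumr_ge0 => i _.
by rewrite -(semi_form_sqr sipL2)// sqr_ge0.
Qed.

Lemma H1_snorm_sqr g : H1 g -> snorm H1 g ^+ 2 =
  snorm L2 g ^+ 2 + inner_vec Omega (grad Omega g) (grad Omega g).
Proof.
move=> Hg; rewrite {1}/snorm/= sqr_sqrtr; last by rewrite addr_ge0 ?sqr_ge0.
by rewrite -inner_vec_grad_sqr.
Qed.

(** The zero field is a weak gradient of a null function, and uniqueness carries this to [grad]. It
    puts 0 in H^1, and it turns initial data that agree almost everywhere into a zero H^1
    distance. *)
Lemma zero_ae_grad g : Defs.locally_integrable Omega g ->
  {ae lebd, forall x, Omega x -> g x = 0} ->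
  weakly_differentiable Omega g /\
  forall i, {ae lebd, forall x, Omega x -> grad Omega g i x = 0}.
Proof.
move=> lg g0.
have l0 : Defs.locally_integrable Omega (0 : E -> R).
  split; first exact: measurable_cst.
  by move=> K _ _; exact: integrable0.
have inner0 phi : inner Omega (0 : E -> R) phi = 0.
  rewrite /inner (@eq_Rintegral _ _ _ _ _ (fun=> 0)) => [|x _].
    by rewrite Rintegral_cst ?mul0r.
  exact: mul0r.
have w0 : is_weak_gradient Omega g (fun=> 0).
  split => // i; split => // phi tphi; rewrite inner0 oppr0.
  rewrite /inner /Rintegral (ae_eq_integral (cst 0%E)) ?integral0//.
    have := partial_integrable Omega_open i lg tphi.
    exact: measurable_int.
  by apply: filterS g0 => x g0 xO /=; rewrite g0// mul0r.
have wg : weakly_differentiable Omega g by exists (fun=> 0).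
by split=> // i; exact: (weak_gradient_unique (gradP wg) w0 i).
Qed.

Lemma H1_ae0 g : H1 g -> {ae lebd, forall x, Omega x -> g x = 0} -> snorm H1 g = 0.
Proof.
move=> Hg g0; have [lg _] := gradP (H1_weak Hg).
have [w G0] := zero_ae_grad lg g0.
apply/eqP; rewrite -sqrf_eq0 H1_snorm_sqr//.
rewrite (L2_ae0 (L2_measurable (H1_L2 Hg)) g0).2 expr0n/= add0r.
rewrite /inner_vec big1// => i _.
rewrite -(semi_form_sqr sipL2); last exact: H1_grad.
by rewrite (L2_ae0 (L2_measurable (H1_grad i Hg)) (G0 i)).2 expr0n.
Qed.

Lemma H1_semi_inner : semi_inner H1 inner_H1.
Proof.
split.
- have l0 : Defs.locally_integrable Omega (0 : E -> R).
    split; first exact: measurable_cst.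
    by move=> K _ _; exact: integrable0.
  have [w G0] := zero_ae_grad l0 (nearW _ (fun x _ => erefl)).
  split => //; first exact: (semi_inner0 sipL2).
  by move=> i; exact: (L2_ae0 (grad_measurable i w) (G0 i)).1.
- exact: H1D.
- exact: H1Z.
- move=> u v w Hu Hv Hw; rewrite /inner_H1.
  rewrite (semi_formD sipL2); [|exact: H1_L2..].
  rewrite (inner_vec_ae_eq (G2 := fun i => grad Omega u i + grad Omega v i)).
  + rewrite inner_vecDl; [exact: addrACA| | |]; by move=> i; exact: H1_grad.
  + by move=> i; exact: (L2_measurable (H1_grad i (H1D Hu Hv))).
  + by move=> i; apply: (semi_innerD sipL2); exact: H1_grad.
  + by move=> i; exact: H1_grad.
  + by move=> i; apply: gradD; exact: H1_weak.
- move=> c u w Hu Hw; rewrite /inner_H1.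
  rewrite (semi_formZ sipL2); [|exact: H1_L2..].
  rewrite (inner_vec_ae_eq (G2 := fun i => c *: grad Omega u i)).
  + rewrite inner_vecZl; [by rewrite mulrDr| |]; by move=> i; exact: H1_grad.
  + by move=> i; exact: (L2_measurable (H1_grad i (H1Z c Hu))).
  + by move=> i; apply: (semi_innerZ sipL2); exact: H1_grad.
  + by move=> i; exact: H1_grad.
  + by move=> i; apply: gradZ; exact: H1_weak.
- move=> u v Hu Hv; rewrite /inner_H1 (semi_formC sipL2 (H1_L2 Hu) (H1_L2 Hv)).
  rewrite (inner_vecC (fun i => H1_grad i Hu) (fun i => H1_grad i Hv)).
  exact: erefl.
- move=> u Hu; rewrite H1_snorm_sqr// /inner_H1 (semi_form_sqr sipL2)//.
  exact: H1_L2.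
- by move=> u; exact: sqrtr_ge0.
Qed.

Lemma L2_le_H1 g : H1 g -> snorm L2 g <= snorm H1 g.
Proof.
move=> Hg; rewrite -(@ler_pXn2r _ 2)// ?nnegrE; last 2 first.
- exact: (snorm_ge0 sipL2).
- exact: (snorm_ge0 H1_semi_inner).
by rewrite H1_snorm_sqr// lerDl inner_vec_ge0// => i; exact: H1_grad.
Qed.

End weak_gradient.

(** * Bochner integrals *)

Section ae_monotone.
Context d (T : measurableType d) (R : realType) (mu : {measure set T -> \bar R}).
Implicit Types P Q S : T -> Prop.

Lemma aeS P Q : {ae mu, forall x, P x} -> (forall x, P x -> Q x) ->
  {ae mu, forall x, Q x}.
Proof. by move=> aP PQ; apply: filterS aP. Qed.

Lemma aeS2 P Q S : {ae mu, forall x, P x} -> {ae mu, forall x, Q x} ->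
  (forall x, P x -> Q x -> S x) -> {ae mu, forall x, S x}.
Proof. by move=> aP aQ PQS; apply: filterS2 aP aQ. Qed.

Lemma aeI P Q : {ae mu, forall x, P x} -> {ae mu, forall x, Q x} ->
  {ae mu, forall x, P x /\ Q x}.
Proof. by move=> aP aQ; apply: aeS2 aP aQ (fun _ => @conj _ _). Qed.

End ae_monotone.

Section ae_measurable_versions.
Local Open Scope ereal_scope.
Context d (T : measurableType d) (R : realType).
Variables (mu : {measure set T -> \bar R}) (D : set T).
Hypothesis mD : measurable D.

(** For a nonnegative [f] that is not assumed measurable the integral is a supremum over simple
    functions below it. Monotonicity survives if [q] is measurable, because removing a null set from
    the domain of [q] leaves its integral unchanged. *)
Lemma ae_le_lower_integral (q f : T -> \bar R) : measurable_fun D q ->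
  (forall x, D x -> 0 <= q x) -> (forall x, D x -> 0 <= f x) ->
  {ae mu, forall x, D x -> q x <= f x} ->
  \int[mu]_(x in D) q x <= \int[mu]_(x in D) f x.
Proof.
move=> mq q0 f0 [N [mN N0 HN]].
have mDN : measurable (D `\` N) by exact: measurableD.
rewrite (ge0_negligible_integral _ _ _ _ N0)//.
rewrite [leLHS]integral_mkcond [leRHS]integral_mkcond.
have le x : (q \_ (D `\` N)) x <= (f \_ D) x.
  rewrite !patchE; case: ifPn => [|_]; last first.
    by case: ifPn => //; rewrite inE => /f0.
  rewrite inE => -[Dx Nx]; rewrite mem_set//.
  by apply: contra_notP Nx => /= H; apply: HN => /= /(_ Dx).
rewrite !ge0_integralTE; last 2 first.
- by move=> x; rewrite patchE; case: ifPn => // /set_mem /f0.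
- by move=> x; rewrite patchE; case: ifPn => // /set_mem [/q0].
apply: le_ereal_sup => _ [h hq <-]; exists h => // x.
exact: le_trans (hq x) (le x).
Qed.

(** Setting everything to 0 on a measurable null set turns the convergence into one at every point,
    whose limit is measurable. *)
Lemma ae_cvg_measurable (f_ : nat -> T -> R) (f : T -> R) :
  (forall n, measurable_fun D (f_ n)) ->
  {ae mu, forall x, D x -> (f_ n x @[n --> \oo] --> f x)%R} ->
  exists2 g, measurable_fun D g & {ae mu, forall x, D x -> f x = g x}.
Proof.
move=> mf [N [mN N0 HN]].
exists (fun x => f x * \1_(~` N) x)%R; last first.
  exists N; split => // x /=; apply: contra_notP => Nx Dx.
  by rewrite indicE mem_set// mulr1.
apply: (@measurable_fun_cvg _ _ _ _ (fun n x => f_ n x * \1_(~` N) x)%R).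
  move=> n; apply: measurable_funM => //; apply: measurable_indic.
  exact: measurableC.
move=> x Dx; rewrite indicE; case: (boolP (x \in ~` N)) => [|_].
  rewrite inE => Nx; apply: cvgMl.
  by apply: contra_notP Nx => H; apply: HN => /= /(_ Dx).
by rewrite mulr0; under eq_fun do rewrite mulr0; exact: cvg_cst.
Qed.

End ae_measurable_versions.

(* An integral that only depends on the a.e. class of [f] on D: [f] itself    *)
(* need not be measurable.                                                    *)
Definition has_integral d (T : measurableType d) (R : realType)
    (mu : {measure set T -> \bar R}) (D : set T) (f : T -> R) (r : R) :=
  exists g, [/\ mu.-integrable D (EFin \o g),
    {ae mu, forall x, D x -> f x = g x} & \int[mu]_(x in D) g x = r].

Lemma integrable_bounded_finite d (T : measurableType d) (R : realType)
    (mu : {measure set T -> \bar R}) (D : set T) (f : T -> R) (M : R) :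
  measurable D -> (mu D < +oo)%E -> measurable_fun D f ->
  (forall x, D x -> `|f x| <= M) -> mu.-integrable D (EFin \o f).
Proof.
move=> mD Dfin mf fM; apply: measurable_bounded_integrable => //.
exists M; split; first exact: num_real.
by move=> N MN x Dx; apply: le_trans (fM _ Dx) (ltW MN).
Qed.

Lemma integrableB_EFin d (T : measurableType d) (R : realType)
    (mu : {measure set T -> \bar R}) (D : set T) (f g : T -> R) : measurable D ->
  mu.-integrable D (EFin \o f) -> mu.-integrable D (EFin \o g) ->
  mu.-integrable D (EFin \o (f \- g)).
Proof.
move=> mD i1 i2; rewrite (_ : EFin \o _ = ((EFin \o f) \- (EFin \o g))%E).
  exact: integrableB.
by apply/funext => x /=; rewrite EFinB.
Qed.

Section has_integral.
Context d (T : measurableType d) (R : realType).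
Variables (mu : {measure set T -> \bar R}) (D : set T).
Hypothesis mD : measurable D.
Implicit Types (f g : T -> R).

Lemma integrable_has_integral f : mu.-integrable D (EFin \o f) ->
  has_integral mu D f (\int[mu]_(x in D) f x).
Proof. by move=> intf; exists f; split => //; apply/nearW. Qed.

Lemma has_integralB f1 f2 r1 r2 : has_integral mu D f1 r1 ->
  has_integral mu D f2 r2 -> has_integral mu D (f1 \- f2) (r1 - r2).
Proof.
move=> [g1 [i1 e1 <-]] [g2 [i2 e2 <-]]; exists (g1 \- g2); split.
- exact: integrableB_EFin.
- by apply: filterS2 e1 e2 => x e1 e2 Dx /=; rewrite e1// e2.
- by rewrite RintegralB.
Qed.

Lemma has_integral_ae f g r : has_integral mu D f r ->
  {ae mu, forall x, D x -> g x = f x} -> has_integral mu D g r.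
Proof.
move=> [h [ih eh <-]] e; exists h; split => //.
by apply: filterS2 e eh => x e eh Dx; rewrite e// eh.
Qed.

Lemma has_integral_le f r (G : T -> \bar R) : has_integral mu D f r ->
  measurable_fun D G -> (forall x, D x -> 0 <= G x)%E ->
  {ae mu, forall x, D x -> (`|f x|%:E <= G x)%E} ->
  (`|r|%:E <= \int[mu]_(x in D) G x)%E.
Proof.
move=> [g [ig e <-]] mG G0 fG.
rewrite EFin_normr_Rintegral//; apply: le_trans (le_abse_integral _ _ _) _ => //.
  exact: measurable_int ig.
apply: ae_ge0_le_integral => //.
  by apply: measurableT_comp => //; exact: measurable_int ig.
by apply: filterS2 e fG => x e fG Dx; rewrite /= -e// fG.
Qed.

(** The difference has an integral and is dominated by 0. *)
Lemma has_integral_uniq f r1 r2 : has_integral mu D f r1 ->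
  has_integral mu D f r2 -> r1 = r2.
Proof.
move=> H1 H2; have := has_integral_le (has_integralB H1 H2) (measurable_cst 0%E).
move=> /(_ (fun _ _ => lexx _)); rewrite integral0 lee_fin normr_le0 subr_eq0.
move=> H; apply/eqP/H; apply/nearW => x _ /=.
by rewrite subrr normr0.
Qed.

(* The [N n] are not assumed measurable, so that the hypothesis on their      *)
(* integrals concerns lower integrals.                                        *)
Lemma has_integral_cvg (w : T -> R) (b' b N : nat -> T -> R) (c l : R) :
  (forall n, measurable_fun D (b' n)) ->
  {ae mu, forall x, D x -> b' n x @[n --> \oo] --> w x} ->
  (forall n, mu.-integrable D (EFin \o b n)) ->
  0 < c -> (forall n x, 0 <= N n x) ->
  (forall n, {ae mu, forall x, D x -> `|b n x - w x| <= c * N n x}) ->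
  (\int[mu]_(x in D) (N n x)%:E)%E @[n --> \oo] --> 0%E ->
  \int[mu]_(x in D) b n x @[n --> \oo] --> l ->
  has_integral mu D w l.
Proof.
move=> mb' b'w ib c0 N0 bN N_cvg b_cvg.
have [g mg eg] := ae_cvg_measurable mb' b'w.
pose e n x := b n x - g x.
have mbn n : measurable_fun D (b n).
  by apply/measurable_EFinP; exact: measurable_int (ib n).
have me n : measurable_fun D (e n) by exact: measurable_funB.
have mne n : measurable_fun D (fun x => `|e n x|).
  exact: (measurableT_comp (@normr_measurable R setT) (me n)).
have mqe n : measurable_fun D (fun x => (`|e n x| / c)%:E).
  by apply/measurable_EFinP; exact: (measurable_funM (mne n) (measurable_cst _)).
(* The error scaled by 1/c is a measurable minorant of [N n], so its integral is below the lower
   integral of [N n] and tends to 0 with it. *)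
pose q n := (\int[mu]_(x in D) (`|e n x| / c)%:E)%E.
have q_ge0 n x : D x -> (0 <= (`|e n x| / c)%:E)%E.
  by move=> _; rewrite lee_fin divr_ge0// ltW.
have q_le n : (q n <= \int[mu]_(x in D) (N n x)%:E)%E.
  apply: ae_le_lower_integral => //.
  - exact: q_ge0.
  - by move=> x _; rewrite lee_fin.
  - apply: filterS2 (bN n) eg => x H ex Dx.
    by rewrite lee_fin ler_pdivrMr// /e -ex// mulrC H.
have q0 : q n @[n --> \oo] --> 0%E.
  apply: (@squeeze_cvge _ _ _ _ (cst 0%E) _
    (fun n => \int[mu]_(x in D) (N n x)%:E)%E) => //.
    by apply: nearW => n; rewrite q_le andbT; apply: integral_ge0 => x; exact: q_ge0.
  exact: cvg_cst.
have /fine_cvgP[qfin qf0] := q0.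
have ie : \forall n \near \oo, mu.-integrable D (EFin \o e n).
  apply: filterS qfin => n qnfin; apply/integrableP; split; first exact/measurable_EFinP.
  have -> : (\int[mu]_(x in D) `|(EFin \o e n) x| = c%:E * q n)%E.
    rewrite /q -ge0_integralZl//.
    + by apply: eq_integral => t _ /=; rewrite -EFinM mulrC divfK// gt_eqF.
    + exact: q_ge0.
    + by rewrite lee_fin ltW.
  rewrite lte_mul_pinfty// ?lee_fin ?ltW//.
  by rewrite ltey_eq qnfin.
have ig : mu.-integrable D (EFin \o g).
  have [n0 _ /(_ n0 (leqnn _)) ien] := ie.
  rewrite (_ : EFin \o g = ((EFin \o b n0) \- (EFin \o e n0))%E); last first.
    by apply/funext => x /=; rewrite -EFinB /e opprB addrC subrK.
  exact: integrableB.
exists g; split => //.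
apply: (@cvg_unique _ (@Rhausdorff R) (\int[mu]_(x in D) b n x @[n --> \oo])).
2: exact: b_cvg.
apply/subr_cvg0; apply: norm_cvg0.
have q0' : c * fine (q n) @[n --> \oo] --> (0 : R).
  by rewrite -(mulr0 c); exact: cvgMr.
apply: (@squeeze_cvgr _ _ _ _ (cst 0) (fun n => c * fine (q n))) => //; last exact: cvg_cst.
apply: filterS ie => n ien; rewrite normr_ge0/= -RintegralB//.
apply: le_trans (le_normr_Rintegral _ _) _ => //.
rewrite -[fine (q n)]/(\int[mu]_(x in D) (`|e n x| / c)).
have ine : mu.-integrable D (EFin \o (fun t => `|e n t|)).
  exact: (integrable_norm ien).
rewrite RintegralZr// mulrCA mulfV ?mulr1//; last by rewrite gt_eqF.
Qed.

End has_integral.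

Section step_functions.
Context {R : realType} {V : lmodType R} {X : seminormed V} {B : V -> V -> R}.
Hypothesis XB : semi_inner X B.
Variable T : R.
Local Notation mu := (@lebesgue_measure R).
Local Notation D := (`]0, T[%classic : set R).
Implicit Types (s : step_function X) (u v w phi : V).

Lemma X_step_at s t : X (step_at s t).
Proof.
by apply: (semi_inner_sum XB) => i; apply: (semi_innerZ XB); exact: step_valP.
Qed.

Lemma X_step_integral s : X (step_integral T s).
Proof.
by apply: (semi_inner_sum XB) => i; apply: (semi_innerZ XB); exact: step_valP.
Qed.

Lemma step_at_form s t phi : X phi -> B (step_at s t) phi =
  \sum_i (\1_(step_set (s:=s) i) t : R) * B (step_val (s:=s) i) phi.
Proof.
move=> Xphi; rewrite (semi_form_sum XB)//; last first.
  by move=> i; apply: (semi_innerZ XB); exact: step_valP.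
by apply: eq_bigr => i _; rewrite (semi_formZ XB)//; exact: step_valP.
Qed.

Lemma measurable_step_form s phi : X phi ->
  measurable_fun setT (fun t => B (step_at s t) phi).
Proof.
move=> Xphi; under eq_fun do rewrite step_at_form//.
apply: measurable_sum => i; apply: measurable_funM => //.
by apply: measurable_indic; exact: measurable_step_set.
Qed.

Let muD : (mu D < +oo)%E.
Proof. by rewrite lebesgue_measure_itv/=; case: ifPn => // _; rewrite -EFinD ltry. Qed.

Lemma integral_step_form s phi : X phi ->
  mu.-integrable D (EFin \o (fun t => B (step_at s t) phi)) /\
  \int[mu]_(t in D) B (step_at s t) phi = B (step_integral T s) phi.
Proof.
move=> Xphi.
have int1 i : mu.-integrable D (EFin \o \1_(step_set (s:=s) i)).
  apply: (@integrable_bounded_finite _ _ _ _ _ _ 1) => //.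
    by apply: measurable_indic; exact: measurable_step_set.
  by move=> x _; rewrite indicE; case: (_ \in _); rewrite ?normr1 ?normr0.
have ind i : mu.-integrable D
    (EFin \o (fun t => (\1_(step_set (s:=s) i) t : R) * B (step_val (s:=s) i) phi)).
  rewrite (_ : EFin \o _ = ((EFin \o \1_(step_set (s:=s) i)) \*
      cst (B (step_val (s:=s) i) phi)%:E)%E); last first.
    by apply/funext => t /=; rewrite EFinM.
  exact: integrableZr.
split.
  rewrite (_ : EFin \o _ = fun t => (\sum_i
      ((\1_(step_set (s:=s) i) t : R) * B (step_val (s:=s) i) phi)%:E)%E); last first.
    by apply/funext => t /=; rewrite step_at_form// sumEFin.
  by apply: integrable_sum => // i _; exact: ind.
rewrite (@eq_Rintegral _ _ _ mu D (fun t => \sum_i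
    (\1_(step_set (s:=s) i) t : R) * B (step_val (s:=s) i) phi)); last first.
  by move=> t _; rewrite step_at_form.
rewrite /Rintegral; under eq_integral do rewrite -sumEFin.
rewrite integral_sum//= -sum_fine; last first.
  by move=> i _; apply: integrable_fin_num => //; exact: ind.
rewrite (semi_form_sum XB)//; last first.
  by move=> i; apply: (semi_innerZ XB); exact: step_valP.
apply: eq_bigr => i _; rewrite (semi_formZ XB)//; last exact: step_valP.
under eq_integral do rewrite EFinM muleC.
rewrite integralZl//; last exact: int1.
rewrite integral_indic//; last exact: measurable_step_set.
have mAD : measurable (step_set (s:=s) i `&` D : set (measurableTypeR R)).
  by apply: measurableI => //; exact: measurable_step_set.
have fin : mu (step_set (s:=s) i `&` D) \is a fin_num.
  rewrite ge0_fin_numE//; apply: le_lt_trans muD.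
  by apply: le_measure; rewrite ?inE//; exact: subIsetr.
by rewrite fineM// [LHS]mulrC setIC.
Qed.

Lemma form_cvg (x_ : nat -> V) x phi : (forall n, X (x_ n)) -> X x -> X phi ->
  snorm X (x_ n - x) @[n --> \oo] --> (0 : R) ->
  B (x_ n) phi @[n --> \oo] --> B x phi.
Proof.
move=> Xn Xx Xphi xnx; apply/subr_cvg0; apply: norm_cvg0.
apply: (@squeeze_cvgr _ _ _ _ (cst 0) (fun n => snorm X (x_ n - x) * snorm X phi)).
- apply: nearW => n /=; rewrite normr_ge0/= -(semi_formB XB)//.
  by apply: (cauchy_schwarz XB) => //; exact: (semi_innerB XB).
- exact: cvg_cst.
- by rewrite -(mul0r (snorm X phi)); exact: cvgMl.
Qed.

(** A continuous linear functional passes through the Bochner integral. The sequence [s'] gives a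
    measurable version of the scalar function, and [s] gives the value of its integral. *)
Lemma bochner_form (w : R -> V) I phi : is_bochner_integral T X w I -> X phi ->
  has_integral mu D (fun t => B (w t) phi) (B I phi).
Proof.
move=> [[s' Hs'] XI [s [Hs HI]]] Xphi.
(* The added 1 keeps the constant positive when [phi] has norm 0. *)
have c0 : 0 < snorm X phi + 1 by rewrite ltr_wpDl// (snorm_ge0 XB).
apply: (@has_integral_cvg _ (measurableTypeR R) R mu D (measurable_itv _) _
  (fun n t => B (step_at (s' n) t) phi) (fun n t => B (step_at (s n) t) phi)
  (fun n t => snorm X (step_at (s n) t - w t)) (snorm X phi + 1)) => //.
- by move=> n; apply: measurable_funTS; exact: measurable_step_form.
- apply: (aeS Hs') => t H tD; have [Xwt cvgt] := H tD.
  by apply: form_cvg => // n; exact: X_step_at.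
- by move=> n; exact: (integral_step_form (s n) Xphi).1.
- by move=> n t; exact: (snorm_ge0 XB).
- move=> n; apply: (aeS Hs') => t H tD; have [Xwt _] := H tD.
  have Xs := X_step_at (s n) t.
  rewrite -(semi_formB XB)// mulrC.
  apply: le_trans (cauchy_schwarz XB (semi_innerB XB Xs Xwt) Xphi) _.
  by rewrite ler_wpM2l ?(snorm_ge0 XB)// lerDl.
- under eq_fun do rewrite (integral_step_form (s _) Xphi).2.
  by apply: form_cvg => // n; exact: X_step_integral.
Qed.

End step_functions.

(** * Scalar weak derivatives in time *)

Section scalar_weak_derivative.
Context {R : realType} (T : R).
Hypothesis T0 : 0 < T.
Local Notation mu := (@lebesgue_measure R).
Local Notation D := (`]0, T[%classic : set R).
Implicit Types (a b psi f : R -> R) (c e delta : R).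

Lemma integrable_within_continuous f : {within `[0, T], continuous f} ->
  mu.-integrable D (EFin \o f).
Proof.
move=> cf; have : mu.-integrable `[0, T]%classic (EFin \o f).
  by apply: continuous_compact_integrable => //; exact: segment_compact.
by apply: integrableS => //; exact: subset_itv_oo_cc.
Qed.

Lemma Rintegral_derive psi : Csmooth psi ->
  \int[mu]_(t in D) derive1 psi t = psi T - psi 0.
Proof.
move=> spsi; have cpsi' := Csmooth_continuous _ (Csmooth_derive1 _ spsi).
have cw : {within `[0, T], continuous (derive1 psi)} by exact: continuous_subspaceT.
rewrite /Rintegral; transitivity
    (fine (\int[mu]_(t in `[0%R, T]) (derive1 psi t)%:E)%E).
  congr fine; symmetry; apply: integral_itv_bndoo.
  have /integrableP[] := integrable_within_continuous cw.
  by [].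
rewrite (@continuous_FTC2 _ (derive1 psi) psi)//.
split.
- by move=> x _; exact: Csmooth_derivable.
- by apply: cvg_at_right_filter; exact: Csmooth_continuous.
- by apply: cvg_at_left_filter; exact: Csmooth_continuous.
Qed.

(** Both sides are read through [has_integral], since a pairing B (du t) phi is only almost
    everywhere equal to a measurable function. *)
Definition scalar_weak a b := forall psi, time_test_function T psi ->
  exists r, has_integral mu D (fun t => derive1 psi t * a t) r /\
            has_integral mu D (fun t => - (psi t * b t)) r.

Lemma Csmooth_time_test psi c e : Csmooth psi -> 0 < c -> e < T ->
  (forall t, psi t != 0 -> c <= t <= e) -> time_test_function T psi.
Proof.
move=> spsi c0 eT supp; split; first by move=> n t; exact: Csmooth_derivable_iter.
exists `[c, e]%classic; first exact: segment_compact.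
split => t /=; first by move=> /supp; rewrite in_itv.
by rewrite !in_itv/= => /andP[ct te]; rewrite (lt_le_trans c0 ct) (le_lt_trans te eT).
Qed.

Lemma time_test_Csmooth psi : time_test_function T psi -> Csmooth psi.
Proof.
move=> [spsi _] n; elim: n psi spsi => [//|n IHn] psi spsi; split.
  by move=> t; exact: (spsi 0%N).
by apply: IHn => m t; rewrite -derive1Sn; exact: spsi.
Qed.

Lemma scalar_weakB a1 b1 a2 b2 : scalar_weak a1 b1 -> scalar_weak a2 b2 ->
  scalar_weak (a1 \- a2) (b1 \- b2).
Proof.
move=> w1 w2 psi tpsi; have [r1 [A1 B1]] := w1 _ tpsi.
have [r2 [A2 B2]] := w2 _ tpsi; exists (r1 - r2); split.
- apply: has_integral_ae (has_integralB _ A1 A2) _ => //.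
  by apply: nearW => t _ /=; rewrite mulrBr.
- apply: has_integral_ae (has_integralB _ B1 B2) _ => //.
  by apply: nearW => t _ /=; rewrite mulrBr opprB opprK addrC.
Qed.

(** Integration by parts: k t psi(t) vanishes at both end points. It serves to subtract a motion of
    constant velocity. *)
Lemma scalar_weak_linear k : scalar_weak (fun t => k * t) (fun=> k).
Proof.
move=> psi tpsi; have Spsi := time_test_Csmooth tpsi.
have [_ [K _ [suppK KD]]] := tpsi.
have psi_out t : ~ D t -> psi t = 0.
  by move=> nDt; apply/eqP; apply: contra_notT nDt => /suppK /KD.
pose F t := (k * t) * psi t.
have Sid : Csmooth (fun t : R => k * t).
  have lin (t : R) : is_derive t (1 : R) (fun t : R => k * t) k.
    have -> : (fun t : R => k * t) = k \*: id by apply/funext.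
    by apply: is_derive_eq; rewrite scaler1.
  case=> [//|n]; split; first by move=> t; case: (lin t).
  rewrite (_ : derive1 _ = fun=> k); first exact: Cn_cst.
  by apply/funext => t; rewrite derive1E; exact: derive_val.
have SF : Csmooth F by exact: CsmoothM.
have F'E t : derive1 F t = derive1 psi t * (k * t) + psi t * k.
  rewrite derive1E; have dl : is_derive t (1 : R) (fun t : R => k * t) k.
    have -> : (fun t : R => k * t) = k \*: id by apply/funext.
    by apply: is_derive_eq; rewrite scaler1.
  have dp : is_derive t (1 : R) psi (derive1 psi t).
    by rewrite derive1E; apply/derivableP; exact: Csmooth_derivable.
  have := is_deriveM dl dp => /(@derive_val _ _ _ _ _ _ _) ->.
  by rewrite /GRing.scale/=; ring.
have c1 : {within `[0, T], continuous (fun t => derive1 psi t * (k * t))}.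
  apply: continuous_subspaceT.
  exact: (Csmooth_continuous _ (CsmoothM _ _ (Csmooth_derive1 _ Spsi) Sid)).
have c2 : {within `[0, T], continuous (fun t => - (psi t * k))}.
  apply: continuous_subspaceT => t; apply: cvgN.
  by apply: cvgMl; exact: Csmooth_continuous.
have i1 := integrable_within_continuous c1.
have i2 := integrable_within_continuous c2.
exists (\int[mu]_(t in D) (derive1 psi t * (k * t))); split.
  exact: integrable_has_integral.
rewrite (_ : Rintegral _ _ _ = \int[mu]_(t in D) (- (psi t * k))).
  exact: integrable_has_integral.
apply/eqP; rewrite -subr_eq0 -RintegralB//.
rewrite (@eq_Rintegral _ _ _ mu D (derive1 F)); last first.
  by move=> t _; rewrite F'E opprK.
rewrite Rintegral_derive// /F mulr0 mul0r subr0 psi_out ?mulr0//.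
by rewrite /= in_itv/= ltxx andbF.
Qed.

(** A smooth step rescaled to [c, c + delta]. Its derivative acts as a one-sided mollifier at c. *)
Lemma cutoff c delta : 0 < delta -> exists s : R -> R, [/\ Csmooth s,
  forall t, t <= c -> s t = 0, forall t, c + delta <= t -> s t = 1,
  forall t, 0 <= s t <= 1 & (forall t, 0 <= derive1 s t) /\
  forall t, ~ (c <= t <= c + delta) -> derive1 s t = 0].
Proof.
move=> d0; have [S [sS S0 S1 S01 S'0]] := @smooth_step R.
pose s t := S (delta^-1 * t + - (delta^-1 * c)).
have s0 t : t <= c -> s t = 0.
  by move=> tc; rewrite /s S0// -mulrBr pmulr_rle0 ?invr_gt0// subr_le0.
have s1 t : c + delta <= t -> s t = 1.
  move=> tc; rewrite /s S1// -mulrBr mulrC ler_pdivlMr// mul1r.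
  by rewrite lerBrDl.
exists s; split => //.
- exact: Csmooth_affine.
- by move=> t; exact: S01.
split.
- move=> t; have lin : is_derive t (1 : R)
      (fun t : R => delta^-1 * t + - (delta^-1 * c)) delta^-1.
    exact: is_derive_affine.
  have dS : is_derive (delta^-1 * t + - (delta^-1 * c)) (1 : R) S
      (derive1 S (delta^-1 * t + - (delta^-1 * c))).
    by rewrite derive1E; apply/derivableP; exact: Csmooth_derivable.
  have ds : is_derive t (1 : R) s _ := @is_derive1_comp _ S
    (fun t => delta^-1 * t + - (delta^-1 * c)) t _ _ dS lin.
  by rewrite derive1E (@derive_val _ _ _ _ _ _ _ ds) mulr_ge0// invr_ge0 ltW.
- move=> t /negP; rewrite negb_and -!ltNge => /orP[tc|tc].
    rewrite derive1E (@near_eq_derive _ _ _ _ (cst 0)) ?derive_cst//.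
    near=> y; rewrite s0//; near: y; exact: lt_le_nbhsl.
  rewrite derive1E (@near_eq_derive _ _ _ _ (cst (1 : R))) ?derive_cst//.
  near=> y; rewrite s1//; apply/ltW; near: y; exact: lt_nbhsr.
Unshelve. all: by end_near. Qed.

(** The derivative of [s] is nonnegative with total mass s T - s 0 = 1, so the integral is an
    average of values of [a] on [c, c + delta]. *)
Lemma mollified_value a s c delta eps : {within `[0, T], continuous a} ->
  0 < c -> c + delta < T -> 0 <= delta -> Csmooth s ->
  (forall t, t <= c -> s t = 0) -> (forall t, c + delta <= t -> s t = 1) ->
  (forall t, 0 <= derive1 s t) ->
  (forall t, ~ (c <= t <= c + delta) -> derive1 s t = 0) ->
  (forall t, c <= t <= c + delta -> `|a t - a c| <= eps) ->
  mu.-integrable D (EFin \o (fun t => derive1 s t * a t)) /\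
  `|\int[mu]_(t in D) (derive1 s t * a t) - a c| <= eps.
Proof.
move=> ca c0 cT d0 ss s0 s1 s'0 s'out ac.
have cs' : {within `[0, T], continuous (derive1 s)}.
  exact/continuous_subspaceT/Csmooth_continuous/Csmooth_derive1.
have is'a : mu.-integrable D (EFin \o (fun t => derive1 s t * a t)).
  by apply: integrable_within_continuous => t; apply: cvgM; [exact: cs'|exact: ca].
split => //.
have is' := integrable_within_continuous cs'.
have is'c k : mu.-integrable D (EFin \o (fun t => derive1 s t * k)).
  apply: integrable_within_continuous => t.
  by apply: cvgMl; exact: cs'.
have I1 : \int[mu]_(t in D) derive1 s t = 1.
  rewrite Rintegral_derive// s1 ?s0 ?subr0//; exact: ltW.
have -> : a c = \int[mu]_(t in D) (derive1 s t * a c).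
  by rewrite RintegralZr// I1 mul1r.
rewrite -RintegralB//.
have ->: eps = \int[mu]_(t in D) (derive1 s t * eps).
  by rewrite RintegralZr// I1 mul1r.
have id : mu.-integrable D (EFin \o (fun t => derive1 s t * a t - derive1 s t * a c)).
  exact: (@integrableB_EFin _ (measurableTypeR R) R mu D (fun t => derive1 s t * a t)
    (fun t => derive1 s t * a c) (measurable_itv _) is'a (is'c _)).
apply: le_trans (le_normr_Rintegral _ _) _ => //.
apply: le_Rintegral => //; first exact: (integrable_norm id).
move=> t _; rewrite -mulrBr normrM (ger0_norm (s'0 t)).
have [tc|tc] := pselect (c <= t <= c + delta); first by rewrite ler_wpM2l// ac.
by rewrite s'out// !mul0r.
Qed.

(** A fundamental theorem of calculus in inequality form. The test function is a difference of
    cut-offs starting at c and at e, a smoothed indicator of [c, e] bounded by 1; integrating its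
    derivative against [a] approximates a c - a e. The overshoot [eps] leaves room for its descent
    after e. *)
Lemma scalar_weak_le a b (G : R -> \bar R) c e eps :
  {within `[0, T], continuous a} -> scalar_weak a b ->
  measurable_fun D G -> (forall t, D t -> 0 <= G t)%E ->
  {ae mu, forall t, c <= t <= e + eps -> (`|b t|%:E <= G t)%E} ->
  0 < c -> c <= e -> 0 < eps -> e + eps < T ->
  (`|a e - a c|%:E <= \int[mu]_(t in `[c, (e + eps)%R]) G t)%E.
Proof.
move=> ca wab mG G0 bG c0 ce eps0 eT.
have D_sub : `[c, e + eps]%classic `<=` D.
  move=> t /=; rewrite !in_itv/= => /andP[ct te].
  by rewrite (lt_le_trans c0 ct) (le_lt_trans te eT).
have split_diff (x y p q : R) : q - p = (x - p) - (y - q) - (x - y) by ring.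
suff H eta : 0 < eta -> (`|a e - a c|%:E <=
    \int[mu]_(t in `[c, (e + eps)%R]) G t + eta%:E)%E.
  by apply/lee_addgt0Pr.
move=> eta0; have eta20 : 0 < eta / 2 by rewrite divr_gt0.
have near_a x : 0 < x -> x < T ->
    exists2 r, 0 < r & forall t, `|t - x| < r -> `|a t - a x| <= eta / 2.
  move=> x0 xT; have /continuous_within_itvP[//|ca' _ _] := ca.
  have /ca' : x \in `]0, T[ by rewrite in_itv/= x0.
  move=> /cvgrPdist_le /(_ _ eta20) /nbhs_ballP[r /= r0 H]; exists r => // t tx.
  by rewrite distrC; apply: H; rewrite /ball/= distrC.
have [|r1 r10 H1] := near_a c c0; first lra.
have [||r2 r20 H2] := near_a e; [lra|lra|].
(* Below both radii of continuity, so that the averages at c and at e are accurate, and at most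
   [eps], so that the test function vanishes after e + eps. *)
pose delta := Num.min (Num.min (r1 / 2) (r2 / 2)) eps.
have d0 : 0 < delta by rewrite !lt_min eps0 !divr_gt0.
have dr1 : delta < r1.
  by apply: (@le_lt_trans _ _ (r1 / 2)); [rewrite !ge_min lexx|lra].
have dr2 : delta < r2.
  by apply: (@le_lt_trans _ _ (r2 / 2)); [rewrite !ge_min lexx orbT|lra].
have deps : delta <= eps by rewrite ge_min lexx orbT.
have [s1 [ss1 s10 s11 s101 [s1'0 s1'out]]] := cutoff c d0.
have [s2 [ss2 s20 s21 s201 [s2'0 s2'out]]] := cutoff e d0.
have [||t tc|i1 M1] := @mollified_value a s1 c delta (eta / 2) ca c0 _ _ ss1 s10 s11 s1'0 s1'out.
- lra.
- lra.
- by move: tc => /andP[tc1 tc2]; apply: H1; rewrite ger0_norm; lra.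
have [|||t tc|i2 M2] := @mollified_value a s2 e delta (eta / 2) ca _ _ _ ss2 s20 s21 s2'0 s2'out.
- lra.
- lra.
- lra.
- by move: tc => /andP[tc1 tc2]; apply: H2; rewrite ger0_norm; lra.
pose psi := s1 \- s2.
have spsi : Csmooth psi.
  rewrite (_ : psi = s1 \+ (fun t => (-1) * s2 t)).
    apply: CsmoothD => //; apply: (@CsmoothM _ (fun=> -1)) => //.
    exact: Csmooth_cst.
  by apply/funext => t; rewrite /psi/= mulN1r.
have psi'E t : derive1 psi t = derive1 s1 t - derive1 s2 t.
  rewrite !derive1E.
  by rewrite -(@deriveB _ _ _ s1 s2)//; exact: Csmooth_derivable.
have psi_out t : ~ (c <= t <= e + eps) -> psi t = 0.
  move=> /negP; rewrite negb_and -!ltNge /psi/= => /orP[tc|te].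
    by rewrite s10 ?s20 ?subrr// ltW// (lt_le_trans tc).
  rewrite s11; last by rewrite ltW// (le_lt_trans _ te)// lerD.
  by rewrite s21 ?subrr// ltW// (le_lt_trans _ te)// lerD2l.
have psi1 t : `|psi t| <= 1.
  by have := s101 t; have := s201 t; rewrite /psi/= ler_norml; lra.
have tpsi : time_test_function T psi.
  apply: (Csmooth_time_test spsi c0 eT) => t.
  by move=> psit; apply: contraT => /negP/psi_out psit0; rewrite psit0 eqxx in psit.
have [r [A1 A2]] := wab psi tpsi.
have rE : r = \int[mu]_(t in D) (derive1 s1 t * a t) -
    \int[mu]_(t in D) (derive1 s2 t * a t).
  apply: (has_integral_uniq _ A1) => //.
  apply: has_integral_ae (has_integralB _ (integrable_has_integral i1)
    (integrable_has_integral i2)) _ => //.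
  by apply: nearW => t _; rewrite psi'E /= mulrBl.
have rG : (`|r|%:E <= \int[mu]_(t in `[c, (e + eps)%R]) G t)%E.
  have -> : (\int[mu]_(t in `[c, (e + eps)%R]) G t =
      \int[mu]_(t in D) (G \_ `[c, (e + eps)%R]) t)%E.
    by rewrite -integral_mkcondr setIidr.
  apply: (has_integral_le _ A2) => //.
  - have mce : measurable (`[c, e + eps]%classic : set (measurableTypeR R)) by [].
    apply/(measurable_restrict G mce) => //.
    by apply: (measurable_funS _ _ mG) => //; exact: subIsetl.
  - by move=> t Dt; rewrite patchE; case: ifPn => // _; exact: G0.
  - apply: (aeS bG) => t bt Dt; rewrite normrN normrM patchE; case: ifPn => tce.
      have /bt : c <= t <= e + eps by move: tce; rewrite inE/= in_itv.
      apply: le_trans; rewrite lee_fin -[leRHS]mul1r.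
      by rewrite ler_wpM2r.
    rewrite psi_out ?normr0 ?mul0r//; apply/negP.
    by move: tce; rewrite notin_setE /= in_itv/= => /negP.
apply: (@le_trans _ _ (`|r|%:E + eta%:E)%E); last exact: leeD2r.
rewrite -EFinD lee_fin.
have -> : a e - a c = (\int[mu]_(t in D) (derive1 s1 t * a t) - a c) -
    (\int[mu]_(t in D) (derive1 s2 t * a t) - a e) - r.
  by rewrite rE; exact: split_diff.
apply: le_trans (ler_normB _ _) _; rewrite addrC lerD2l.
by apply: le_trans (ler_normB _ _) _; rewrite [leRHS]splitr; exact: lerD.
Qed.

End scalar_weak_derivative.

(** * Weak derivatives in time *)

Section weak_derivative.
Context {R : realType} {V : lmodType R} {X : seminormed V} {B : V -> V -> R}.
Hypothesis XB : semi_inner X B.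
Variable T : R.
Hypothesis T0 : 0 < T.
Local Notation mu := (@lebesgue_measure R).
Local Notation D := (`]0, T[%classic : set R).
Implicit Types (u du w : R -> V) (v phi : V).

Lemma bochner_mem w I : is_bochner_integral T X w I ->
  {ae mu, forall t, D t -> X (w t)}.
Proof. by move=> [[s Hs] _ _]; apply: (aeS Hs) => t H /H[]. Qed.

Lemma form_weak u du phi : is_weak_derivative T X u du ->
  (forall t, t \in `[0, T] -> X (u t)) -> X phi ->
  scalar_weak T (fun t => B (u t) phi) (fun t => B (du t) phi).
Proof.
move=> wu Xu Xphi psi tpsi; have [I [I1 I2]] := wu psi tpsi.
exists (B I phi); split.
- apply: has_integral_ae (bochner_form XB I1 Xphi) _ => //.
  apply: nearW => t Dt; rewrite (semi_formZ XB)//; apply: Xu.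
  by apply: subset_itv_oo_cc; exact: Dt.
- apply: has_integral_ae (bochner_form XB I2 Xphi) _ => //.
  apply: (aeS (bochner_mem I2)) => t Xt Dt.
  (* Only [psi t *: du t] is known to lie in [X]: where psi t is nonzero it can be divided out, and
     elsewhere both sides are 0. *)
  have [psi0|psi0] := eqVneq (psi t) 0.
    by rewrite psi0 scale0r oppr0 mul0r oppr0 (semi_form0 XB).
  have Xdu : X (du t).
    have := semi_innerZ XB (- (psi t)^-1) (Xt Dt).
    by rewrite scalerN scaleNr opprK scalerA mulVf// scale1r.
  rewrite (semi_formN XB) ?(semi_formZ XB)//; exact: (semi_innerZ XB).
Qed.

Lemma form_continuous u phi : continuous_in T X u -> X phi ->
  {within `[0, T], continuous (fun t => B (u t) phi)}.
Proof.
move=> cu Xphi; apply/subspace_continuousP => t tT; have [Xut cut] := cu t tT.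
apply/subr_cvg0; apply: norm_cvg0.
apply: (@squeeze_cvgr _ _ _ _ (cst 0) (fun s => snorm X (u s - u t) * snorm X phi)).
- near=> s; rewrite normr_ge0/=.
  have sT : s \in `[0, T] by near: s; exact: withinT.
  have [Xus _] := cu s sT.
  rewrite -(semi_formB XB)//.
  by apply: (cauchy_schwarz XB) => //; exact: (semi_innerB XB).
- exact: cvg_cst.
- have := cvgMl cut (b := snorm X phi); rewrite mul0r; exact.
Unshelve. all: by end_near. Qed.

(** A mean value inequality relative to the constant velocity [v]. Let w be the vector being
    estimated; the squared norm of w is the increment over [c, e] of t |-> B (u t) w - t B v w, to
    which [scalar_weak_le] applies, and one factor |w| is divided out. *)
Lemma snorm_increment_le u du v (G : R -> \bar R) c e eps :
  is_weak_derivative T X u du -> continuous_in T X u -> X v ->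
  measurable_fun D G -> (forall t, D t -> 0 <= G t)%E ->
  {ae mu, forall t, c <= t <= e + eps ->
     X (du t) /\ ((snorm X (du t - v))%:E <= G t)%E} ->
  0 < c -> c <= e -> 0 < eps -> e + eps < T ->
  ((snorm X (u e - u c - (e - c) *: v))%:E <=
    \int[mu]_(t in `[c, (e + eps)%R]) G t)%E.
Proof.
move=> wu cu Xv mG G0 duG c0 ce eps0 eT.
have Xu t : t \in `[0, T] -> X (u t) by move=> /cu[].
have Xue : X (u e) by apply: Xu; rewrite in_itv/=; apply/andP; split; lra.
have Xuc : X (u c) by apply: Xu; rewrite in_itv/=; apply/andP; split; lra.
set w := u e - u c - (e - c) *: v.
have Xdv := semi_innerZ XB (e - c) Xv.
have Xuec := semi_innerB XB Xue Xuc.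
have Xw : X w by exact: (semi_innerB XB).
have D_sub : `[c, e + eps]%classic `<=` D.
  move=> t /=; rewrite !in_itv/= => /andP[ct te].
  by rewrite (lt_le_trans c0 ct) (le_lt_trans te eT).
have mce : measurable (`[c, e + eps]%classic : set (measurableTypeR R)) by [].
have [w0|w0] := eqVneq (snorm X w) 0.
  by rewrite w0; apply: integral_ge0 => t /D_sub; exact: G0.
have w_gt0 : 0 < snorm X w by rewrite lt_neqAle eq_sym w0 (snorm_ge0 XB).
have wa := scalar_weakB (form_weak wu Xu Xw) (scalar_weak_linear T0 (B v w)).
have ca : {within `[0, T], continuous ((fun t => B (u t) w) \- (fun t => B v w * t))}.
  have c1 := form_continuous cu Xw.
  have c2 : {within `[0, T], continuous (fun t => B v w * t)}.
    by apply: continuous_subspaceT => t; apply: cvgMr; exact: cvg_id.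
  by move=> t; exact: cvgB (c1 t) (c2 t).
have mwG : measurable_fun D (fun t => (snorm X w)%:E * G t)%E.
  exact: measurable_funeM.
have wG0 t : D t -> (0 <= (snorm X w)%:E * G t)%E.
  by move=> Dt; rewrite mule_ge0 ?lee_fin ?(ltW w_gt0) ?G0.
have := @scalar_weak_le _ T T0 _ _ _ c e eps ca wa mwG wG0 _ c0 ce eps0 eT.
have -> : B (u e) w - B v w * e - (B (u c) w - B v w * c) = snorm X w ^+ 2.
  rewrite (semi_form_sqr XB)// {3}/w (semi_formB XB)// (semi_formB XB)//.
  by rewrite (semi_formZ XB)//; move: (B _ _) (B _ _) (B _ _) => x y z; ring.
rewrite ge0_integralZl//; last 3 first.
- exact: (measurable_funS _ D_sub mG).
- by move=> t /D_sub; exact: G0.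
- by rewrite lee_fin ltW.
rewrite ger0_norm ?sqr_ge0// expr2 EFinM lee_pmul2l ?lte_fin//; apply.
apply: (aeS duG) => t Ht tce; have [Xdu duv] := Ht tce.
rewrite /= -(semi_formB XB)//.
apply: (@le_trans _ _ ((snorm X w)%:E * (snorm X (du t - v))%:E)%E).
  rewrite -EFinM lee_fin mulrC; apply: (cauchy_schwarz XB) => //.
  exact: (semi_innerB XB).
by rewrite lee_wpmul2l// lee_fin ltW.
Qed.

End weak_derivative.

(** [N] is not assumed measurable, but the positive part of f - h is, and it lies below [N]; its
    integral is therefore finite, and f is at most this part plus |h|. *)
Lemma integrable_le_lower_integral d (S : measurableType d) (R : realType)
    (mu : {measure set S -> \bar R}) (D : set S) (f h : S -> R) (N : S -> R) :
  measurable D -> measurable_fun D f -> (forall x, D x -> 0 <= f x) ->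
  mu.-integrable D (EFin \o h) -> (forall x, 0 <= N x) ->
  {ae mu, forall x, D x -> f x <= N x + h x} ->
  (\int[mu]_(x in D) (N x)%:E < +oo)%E -> mu.-integrable D (EFin \o f).
Proof.
move=> mD mf f0 ih N0 fNh Nfin.
pose q x := Num.max (f x - h x) 0.
have mh : measurable_fun D h by apply/measurable_EFinP; exact: measurable_int ih.
have mq : measurable_fun D q.
  by apply: measurable_maxr => //; exact: measurable_funB.
have q0 x : 0 <= q x by rewrite le_max lexx orbT.
have iq : mu.-integrable D (EFin \o q).
  apply/integrableP; split; first exact/measurable_EFinP.
  apply: le_lt_trans Nfin.
  rewrite (eq_integral (fun x => (q x)%:E)); last first.
    by move=> x _ /=; rewrite ger0_norm.
  apply: ae_le_lower_integral => //.
  - exact/measurable_EFinP.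
  - by move=> x _; rewrite lee_fin.
  - by move=> x _; rewrite lee_fin.
  - apply: (aeS fNh) => x H Dx; rewrite lee_fin ge_max N0 andbT.
    by rewrite lerBlDr H.
have iqh : mu.-integrable D (EFin \o (fun x => q x + `|h x|)).
  rewrite (_ : EFin \o _ = ((EFin \o q) \+ (EFin \o (fun x => `|h x|%R)))%E); last first.
    by apply/funext => x /=; rewrite EFinD.
  by apply: integrableD => //; exact: integrable_norm ih.
apply: le_integrable iqh => //; first exact/measurable_EFinP.
move=> x Dx /=; rewrite lee_fin (ger0_norm (f0 _ Dx)) ger0_norm ?addr_ge0//.
apply: (@le_trans _ _ (q x + h x)); last by rewrite lerD2l ler_norm.
by rewrite -lerBlDr le_max lexx.
Qed.

(** * Lebesgue points of Bochner integrable functions *)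

Section lebesgue_pt.
Local Open Scope ereal_scope.

(** Near a Lebesgue point the average of |f - f t| is at most e, and f t < e; on a ball of length 2h
    each contributes at most 2 h e. *)
Lemma lebesgue_pt_ball (R : realType) (f : R -> R) (t e : R) :
  measurable_fun setT f -> (forall r, 0 <= f r)%R -> (f t < e)%R ->
  lebesgue_pt f t -> \forall h \near (0 : R)%R^'+,
    \int[lebesgue_measure]_(r in ball t h) (f r)%:E <= (4 * h * e)%:E.
Proof.
move=> mf f0 fte lpt.
have e0 : (0 < e)%R by exact: le_lt_trans (f0 t) fte.
have /fine_cvgP[fin] := lpt.
move=> /cvgrPdist_le /(_ e e0) cvg0.
near=> h.
have h0 : (0 < h)%R by near: h; exact: nbhs_right_gt.
have finh : davg f t h \is a fin_num by near: h.
have leh : davg f t h <= e%:E.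
  rewrite -(fineK finh) lee_fin; apply: le_trans (ler_norm _) _.
  rewrite -normrN -sub0r.
  by near: h.
have mub : lebesgue_measure (ball t h) = (h *+ 2)%:E.
  by apply: lebesgue_measure_ball; exact: ltW.
have mb : measurable (ball t h : set (measurableTypeR R)) by exact: measurable_ball.
have mft : measurable_fun (ball t h) (fun r => `|f r - f t|%R).
  apply: (measurableT_comp (@normr_measurable R setT)).
  by apply: measurable_funTS; exact: measurable_funB.
pose I := (\int[lebesgue_measure]_(r in ball t h) (`|f r - f t|%R)%:E).
have IE : I = (2 * h)%:E * davg f t h.
  rewrite /davg /iavg mub /I muleA inver.
  rewrite gt_eqF ?pmulrn_lgt0// -EFinM mulr_natl.
  by rewrite mulfV ?mul1e// gt_eqF// pmulrn_lgt0.
apply: (@le_trans _ _ (\int[lebesgue_measure]_(r in ball t h)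
    ((`|f r - f t|%R)%:E + e%:E))).
  apply: ge0_le_integral => //.
  - by move=> r _; rewrite lee_fin.
  - by apply/measurable_EFinP; exact: measurable_funTS.
  - apply: emeasurable_funD => //; exact/measurable_EFinP.
  - move=> r _; rewrite -EFinD lee_fin; apply: (@le_trans _ _ (`|f r - f t| + f t)%R).
      by rewrite -lerBlDr ler_norm.
    by rewrite lerD2l ltW.
rewrite ge0_integralD//; last 2 first.
- exact/measurable_EFinP.
- by move=> r _; rewrite lee_fin ltW.
rewrite [X in X + _](_ : _ = I)// IE integral_cst//.
rewrite [X in e%:E * X](_ : _ = (h *+ 2)%:E)// -EFinM.
apply: (@le_trans _ _ ((2 * h)%:E * e%:E + (e * (h *+ 2))%:E)).
  by rewrite leeD2r// lee_pmul2l// lte_fin mulr_gt0.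
rewrite -EFinM -EFinD lee_fin -mulr_natl.
rewrite mulr2n; lra.
Unshelve. all: by end_near. Qed.

End lebesgue_pt.

Section lebesgue_points.
Context {R : realType} {V : lmodType R} {X : seminormed V} {B : V -> V -> R}.
Hypothesis XB : semi_inner X B.
Variable T : R.
Local Notation mu := (@lebesgue_measure R).
Local Notation D := (`]0, T[%classic : set R).
Implicit Types (w : R -> V) (v : V) (s : step_function X).

Lemma snorm_sum I (r : seq I) (F : I -> V) : (forall i, X (F i)) ->
  snorm X (\sum_(i <- r) F i) <= \sum_(i <- r) snorm X (F i).
Proof.
move=> XF; elim: r => [|i r IHr]; first by rewrite !big_nil (snorm0 XB).
rewrite !big_cons; apply: le_trans (snormD XB _ _) _ => //.
  exact: (semi_inner_sum XB).
by rewrite lerD2l.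
Qed.

(** Expanding the squared norm expresses it by pairings of the step function with fixed vectors,
    which are measurable. *)
Lemma measurable_step_snorm s v : X v ->
  measurable_fun setT (fun t => snorm X (step_at s t - v)).
Proof.
move=> Xv; have Xs t := X_step_at XB s t.
rewrite (_ : (fun _ => _) = (@Num.sqrt R) \o (fun t =>
    (\sum_i (\1_(step_set (s:=s) i) t : R) * B (step_at s t) (step_val (s:=s) i))
    - 2 * B (step_at s t) v + B v v)); last first.
  apply/funext => t /=.
  rewrite -[LHS]ger0_norm ?(snorm_ge0 XB)// -sqrtr_sqr; congr Num.sqrt.
  have Xsv := semi_innerB XB (Xs t) Xv.
  rewrite (semi_form_sqr XB)// (semi_formB XB)// !(semi_formC XB _ Xsv)//.
  rewrite !(semi_formB XB)// (semi_formC XB Xv (Xs t)).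
  rewrite (@step_at_form _ _ _ _ XB s t (step_at s t))//.
  under [in RHS]eq_bigr do rewrite (semi_formC XB (Xs t) (step_valP _)).
  by move: (\sum_i _) (B (step_at s t) v) (B v v) => x y z; ring.
apply: measurableT_comp.
  by apply: continuous_measurable_fun; exact: sqrt_continuous.
have mB phi : X phi -> measurable_fun setT (fun t => B (step_at s t) phi).
  by move=> Xphi; exact: (measurable_step_form XB).
apply: measurable_funD => //; apply: measurable_funB.
  apply: measurable_sum => i; apply: measurable_funM.
    by apply: measurable_indic; exact: measurable_step_set.
  by apply: mB; exact: step_valP.
by apply: measurable_funM => //; exact: mB.
Qed.

Let muD : (mu D < +oo)%E.
Proof. by rewrite lebesgue_measure_itv/=; case: ifPn => // _; rewrite -EFinD ltry. Qed.

Lemma integrable_step_snorm s v : X v ->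
  mu.-integrable D (EFin \o (fun t => snorm X (step_at s t - v))).
Proof.
move=> Xv; apply: (@integrable_bounded_finite _ _ _ _ _ _
    (\sum_i snorm X (step_val (s:=s) i) + snorm X v)) => //.
- by apply: measurable_funTS; exact: measurable_step_snorm.
- move=> t _; rewrite ger0_norm ?(snorm_ge0 XB)//.
  apply: le_trans (snormD XB (X_step_at XB s t) (semi_innerN XB Xv)) _.
  rewrite (snormN XB)// lerD2r; apply: le_trans (snorm_sum _ _) _.
    by move=> i; apply: (semi_innerZ XB); exact: step_valP.
  apply: ler_sum => i _; rewrite (snormZ XB); last exact: step_valP.
  rewrite ler_piMl ?(snorm_ge0 XB)// indicE.
  by case: (_ \in _); rewrite ?normr1 ?normr0.
Qed.

Lemma snorm_cvg (x_ : nat -> V) x v : (forall n, X (x_ n)) -> X x -> X v ->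
  snorm X (x_ n - x) @[n --> \oo] --> (0 : R) ->
  snorm X (x_ n - v) @[n --> \oo] --> snorm X (x - v).
Proof.
move=> Xn Xx Xv xnx; apply/subr_cvg0; apply: norm_cvg0.
apply: (@squeeze_cvgr _ _ _ _ (cst 0) (fun n => snorm X (x_ n - x))) => //.
- apply: nearW => n /=; rewrite normr_ge0/=.
  have -> : x_ n - x = (x_ n - v) - (x - v) by rewrite opprB addrA subrK.
  by apply: (ler_snormB XB); exact: (semi_innerB XB).
- exact: cvg_cst.
Qed.

(** The distance to [v] is an almost everywhere limit of measurable functions, hence has a
    measurable version. Its integrability follows from the triangle inequality through one
    approximating step function, after which scalar Lebesgue differentiation applies. *)
Lemma snorm_version w I v : is_bochner_integral T X w I -> X v ->
  exists f : R -> R, [/\ measurable_fun setT f, forall r, 0 <= f r,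
    {ae mu, forall r, D r -> snorm X (w r - v) = f r} &
    {ae mu, forall r, lebesgue_pt f r}].
Proof.
move=> [[s' Hs'] XI [s [Hs _]]] Xv.
have [||g mg eg] := @ae_cvg_measurable _ (measurableTypeR R) R mu D
  (fun n t => snorm X (step_at (s' n) t - v))
  (fun t => snorm X (w t - v)).
- by move=> n; apply: measurable_funTS; exact: measurable_step_snorm.
- apply: (aeS Hs') => t H Dt; have [Xwt cvgt] := H Dt.
  by apply: snorm_cvg => // n; exact: (X_step_at XB).
have mng : measurable_fun D (fun t => `|g t|).
  exact: (measurableT_comp (@normr_measurable R setT) mg).
(* Integrals converging to 0 are eventually finite; one finite index [n0] suffices. *)
have /fine_cvgP[[n0 _ /(_ n0 (leqnn _)) fin0] _] := Hs.
have ig : mu.-integrable D (EFin \o (fun t => `|g t|)).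
  apply: (@integrable_le_lower_integral _ (measurableTypeR R) R mu D
    (fun t => `|g t|) (fun t => snorm X (step_at (s n0) t - v))
    (fun t => snorm X (step_at (s n0) t - w t))) => //.
  - exact: integrable_step_snorm.
  - by move=> t; exact: (snorm_ge0 XB).
  - apply: (aeS2 Hs' eg) => t H1 H2 Dt; have [Xwt _] := H1 Dt.
    rewrite -H2// ger0_norm ?(snorm_ge0 XB)//.
    have Xs := X_step_at XB (s n0) t.
    by rewrite (snormBC XB Xs Xwt); exact: (snormB XB).
  - by rewrite ltey_eq fin0.
exists ((fun t => `|g t|) \_ D); split.
- by apply/(measurable_restrictT _ (measurable_itv _)).
- by move=> r; rewrite patchE; case: ifPn.
- apply: (aeS eg) => t H Dt; rewrite patchE mem_set// -H// ger0_norm//.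
  exact: (snorm_ge0 XB).
- apply: lebesgue_differentiation; exact: integrable_locally_restrict.
Qed.

(** The approximating step functions take countably many values v. Almost every t is a Lebesgue
    point of all the scalar functions |w - v| at once, and at such a t some value v is within e of w
    t. *)
Lemma bochner_lebesgue w I : is_bochner_integral T X w I ->
  {ae mu, forall t, D t -> X (w t) /\ forall e, 0 < e ->
    exists v (f : R -> R), [/\ X v, snorm X (w t - v) < e,
      measurable_fun setT f /\ (forall r, 0 <= f r),
      {ae mu, forall r, D r -> X (w r) /\ snorm X (w r - v) <= f r} &
      \forall h \near (0 : R)^'+,
        (\int[mu]_(r in ball t h) (f r)%:E <= (4 * h * e)%:E)%E]}.
Proof.
move=> bw; have [[s Hs] XI _] := bw.
(* The sets of a step function may overlap, so its values are sums over subsets [S] of indices; the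
   pairs (n, S) are countably many. *)
pose v n (S : {set 'I_(step_size (s n))}) := \sum_(i in S) step_val (s:=s n) i.
have Xv n S : X (v n S).
  rewrite /v big_mkcond; apply: (semi_inner_sum XB) => i.
  by case: ifPn => _; [exact: step_valP|exact: (semi_inner0 XB)].
have /choice[f Hf] : forall nS : {n & {set 'I_(step_size (s n))}}, exists f : R -> R,
    [/\ measurable_fun setT f, forall r, 0 <= f r,
    {ae mu, forall r, D r -> snorm X (w r - v _ (tagged nS)) = f r} &
    {ae mu, forall r, lebesgue_pt f r}].
  by move=> [n S]; apply: snorm_version bw _.
pose nS n S : {n & {set 'I_(step_size (s n))}} := existT _ n S.
have aef : {ae mu, forall t, forall n S,
    (D t -> snorm X (w t - v n S) = f (nS n S) t) /\ lebesgue_pt (f (nS n S)) t}.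
  apply: ae_foralln => n; apply: filter_forall => S.
  by have [_ _ H1 H2] := Hf (nS n S); exact: (aeS2 H1 H2).
apply: (aeS2 Hs aef) => t H1 H2 Dt; have [Xwt cvgt] := H1 Dt.
split => // e e0.
have /cvgrPdist_lt /(_ e e0) [n _ /(_ n (leqnn _))] := cvgt.
rewrite /= sub0r normrN ger0_norm ?(snorm_ge0 XB)//.
pose S : {set 'I_(step_size (s n))} := [set i | t \in step_set (s:=s n) i]%SET.
have -> : step_at (s n) t = v n S.
  rewrite /step_at /v [RHS]big_mkcond; apply: eq_bigr => i _.
  rewrite inE indicE.
  by case: (t \in _); rewrite ?scale1r ?scale0r.
rewrite (snormBC XB)// => lte.
have [mf f0 ae1 _] := Hf (nS n S); have [/(_ Dt) E lpt] := H2 n S.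
exists (v n S), (f (nS n S)); split => //.
- by apply: (aeS2 Hs ae1) => r /= K1 K2 Dr; have [Xwr _] := K1 Dr; rewrite K2.
- by apply: lebesgue_pt_ball => //; rewrite -E.
Qed.

End lebesgue_points.

(** The weak derivative is known only through test functions; one that is 1 on [alpha, beta] exposes
    [du] itself there. *)
Lemma plateau (R : realType) (T alpha beta : R) : 0 < alpha -> beta < T ->
  exists2 psi, time_test_function T psi &
    forall t, alpha <= t <= beta -> psi t = 1.
Proof.
move=> alpha0 betaT.
have alpha20 : 0 < alpha / 2 by rewrite divr_gt0.
have betaT2 : 0 < (T - beta) / 2 by rewrite divr_gt0// subr_gt0.
have [s1 [ss1 s10 s11 _ _]] := cutoff (alpha / 2) alpha20.
have [s2 [ss2 s20 s21 _ _]] := cutoff beta betaT2.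
pose s3 t := 1 + (-1) * s2 t.
have ss3 : Csmooth s3.
  apply: (CsmoothD (fun=> 1) (fun t => -1 * s2 t)); first exact: Csmooth_cst.
  by apply: (@CsmoothM _ (fun=> -1)) => //; exact: Csmooth_cst.
exists (fun t => s1 t * s3 t).
  apply: (@Csmooth_time_test _ T _ (alpha / 2) (beta + (T - beta) / 2)) => //.
  - exact: CsmoothM.
  - lra.
  - move=> t; apply: contraNT; rewrite negb_and -!ltNge => /orP[ta|tb].
      by rewrite s10 ?mul0r// ltW.
    by rewrite /s3 s21 ?mulN1r ?subrr ?mulr0// ltW.
move=> t /andP[ta tb]; rewrite s11 -?splitr// /s3 s20// mulr0 addr0 mulr1//.
Qed.

(** * Strong differentiability at almost every time *)

Section strong_derivative.
Context {R : realType} {V : lmodType R} {X : seminormed V} {B : V -> V -> R}.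
Hypothesis XB : semi_inner X B.
Variable T : R.
Hypothesis T0 : 0 < T.
Local Notation mu := (@lebesgue_measure R).
Local Notation D := (`]0, T[%classic : set R).
Implicit Types (u du : R -> V) (v : V).

(** The interval between s and t, prolonged to the right by the overshoot |s - t|, lies within 2 |s
    - t| of t on either side; the radius 3 |s - t| places it inside the open ball. *)
Lemma snorm_increment_sym u du v (f : R -> R) alpha beta (t s : R) :
  is_weak_derivative T X u du -> continuous_in T X u -> X v ->
  measurable_fun setT f -> (forall r, 0 <= f r) ->
  {ae mu, forall r, alpha <= r <= beta -> X (du r) /\ snorm X (du r - v) <= f r} ->
  0 < alpha -> beta < T -> s != t ->
  alpha <= t - 3 * `|s - t| -> t + 3 * `|s - t| <= beta ->
  ((snorm X (u s - u t - (s - t) *: v))%:E <=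
    \int[mu]_(r in ball t (3 * `|s - t|)%R) (f r)%:E)%E.
Proof.
move=> wu cu Xv mf f0 duf a0 bT st at' tb.
have st0 : 0 < `|s - t| by rewrite normr_gt0 subr_eq0.
have Xu r : alpha <= r <= beta -> X (u r).
  move=> /andP[ar rb]; have [|//] := cu r.
  by rewrite in_itv/= (le_trans (ltW a0) ar) (le_trans rb (ltW bT)).
have H c e : c < e -> alpha <= c -> e + `|s - t| <= beta ->
    t - 3 * `|s - t| < c -> e + `|s - t| < t + 3 * `|s - t| ->
    ((snorm X (u e - u c - (e - c) *: v))%:E <=
      \int[mu]_(r in ball t (3 * `|s - t|)%R) (f r)%:E)%E.
  move=> ce ac eb tc et.
  apply: (@le_trans _ _ (\int[mu]_(r in `[c, (e + `|s - t|)%R]) (f r)%:E)%E).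
    apply: (snorm_increment_le XB T0 wu cu Xv) => //.
    - by apply/measurable_EFinP; exact: measurable_funTS.
    - by move=> r _; rewrite lee_fin.
    - apply: (aeS duf) => r Hr /andP[cr re]; rewrite lee_fin; apply: Hr.
      by rewrite (le_trans ac cr) (le_trans re eb).
    - exact: lt_le_trans a0 ac.
    - exact: ltW.
    - exact: le_lt_trans eb bT.
  apply: ge0_subset_integral => //.
  - exact: (measurable_ball t).
  - by apply/measurable_EFinP; exact: measurable_funTS.
  - by move=> r _; rewrite lee_fin.
  - move=> r /=; rewrite in_itv/= /ball/= => /andP[cr re].
    by rewrite ltr_norml; lra.
have [lst|lst|/eqP] := ltgtP s t; last by rewrite (negbTE st).
- have E : `|s - t| = t - s by rewrite ltr0_norm ?opprB// subr_lt0.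
  rewrite (_ : u s - u t - _ = - (u t - u s - (t - s) *: v)); last first.
    by rewrite -(opprB t s) scaleNr opprK !opprB addrC.
  have Xus : X (u s) by apply: Xu; rewrite E in at' tb; lra.
  have Xut : X (u t) by apply: Xu; rewrite E in at' tb; lra.
  rewrite (snormN XB); last first.
    by apply: (semi_innerB XB); [exact: (semi_innerB XB)|exact: (semi_innerZ XB)].
  by apply: H; rewrite ?E; rewrite E in at' tb; lra.
- have E : `|s - t| = s - t by rewrite gtr0_norm ?subr_gt0.
  by apply: H; rewrite ?E; rewrite E in at' tb; lra.
Qed.

(** At a Lebesgue point t, [du t] is compared with a nearby constant velocity; the increment of u
    differs from this velocity times s - t by the integral of the deviation near t, which is a small
    multiple of |s - t|. *)
Lemma strong_derivative_within u du alpha beta : is_weak_derivative T X u du ->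
  continuous_in T X u -> 0 < alpha -> beta < T ->
  {ae mu, forall t, alpha < t < beta -> X (du t) /\
    snorm X ((s - t)^-1 *: (u s - u t) - du t) @[s --> t^'] --> (0 : R)}.
Proof.
move=> wu cu a0 bT; have [psi tpsi psi1] := plateau a0 bT.
(* What is Bochner integrable is [- (psi t *: du t)], equal to [- du t] on [alpha, beta]; hence the
   approximating velocity is [- v]. *)
have [I [_ bI]] := wu psi tpsi.
have inD r : alpha <= r <= beta -> D r.
  by move=> /andP[ar rb]; rewrite /= in_itv/= (lt_le_trans a0 ar) (le_lt_trans rb bT).
apply: (aeS (bochner_lebesgue XB bI)) => t Ht /andP[at' tb].
have tab : alpha <= t <= beta by rewrite !ltW.
have [Xwt H] := Ht (inD _ tab); rewrite psi1// scale1r in Xwt H.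
have Xdut : X (du t) by rewrite -[du t]opprK; exact: (semi_innerN XB).
split => //; apply/cvgrPdist_le => e e0.
(* The ball of radius 3 |s - t| costs 4 * 3 |s - t| times the tolerance, that is 12 units after
   division by |s - t|; replacing the velocity by [du t] costs the thirteenth. *)
have e13 : 0 < e / 13 by rewrite divr_gt0.
have [v [f [Xv vt [mf f0] aef nearf]]] := H _ e13.
have [r /= r0 Hr] := nearf.
have XNv := semi_innerN XB Xv.
have duf : {ae mu, forall r, alpha <= r <= beta ->
    X (du r) /\ snorm X (du r - (- v)) <= f r}.
  apply: (aeS aef) => x Hx xab; have := Hx (inD _ xab).
  rewrite psi1// scale1r => -[Xdu dufx].
  have Xdux : X (du x) by rewrite -[du x]opprK; exact: (semi_innerN XB).
  split => //; rewrite (_ : du x - - v = - (- du x - v)).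
    by rewrite (snormN XB)//; exact: (semi_innerB XB).
  by rewrite opprB !opprK addrC.
(* Each bound is divided by 3 because the ball around t has radius 3 |s - t|: it must be small
   enough for the Lebesgue estimate and stay inside [alpha, beta]. *)
pose del := Num.min (r / 3) (Num.min ((t - alpha) / 3) ((beta - t) / 3)).
have del0 : 0 < del by rewrite !lt_min !divr_gt0// subr_gt0.
near=> s.
have st : s != t by near: s; exact: nbhs_dnbhs_neq.
have sdel : `|s - t| < del.
  near: s; apply: nbhs_dnbhs; apply/nbhs_ballP; exists del => //= y.
  by rewrite /ball/= distrC.
move: sdel; rewrite !lt_min => /and3P[sr sa sb].
have st0 : 0 < `|s - t| by rewrite normr_gt0 subr_eq0.
have := @snorm_increment_sym u du (- v) f alpha beta t s wu cu XNv mf f0 duf a0 bT st.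
move=> /(_ _ _) => K.
have {K} : ((snorm X (u s - u t - (s - t) *: - v))%:E <=
    (4 * (3 * `|s - t|) * (e / 13))%:E)%E.
  apply: le_trans (K _ _) _; [lra|lra|].
  apply: Hr; last by rewrite mulr_gt0.
  by rewrite /= sub0r normrN gtr0_norm ?mulr_gt0//; lra.
rewrite lee_fin => K.
have [|Xus _] := cu s.
  rewrite in_itv/=; have := ler_norm (s - t); have := ler_norm (t - s).
  by rewrite distrC; lra.
have [|Xut _] := cu t; first by rewrite in_itv/=; lra.
have Xq := semi_innerZ XB (s - t)^-1 (semi_innerB XB Xus Xut).
rewrite sub0r normrN ger0_norm ?(snorm_ge0 XB)//.
apply: le_trans (snormB XB Xq XNv Xdut) _.
have -> : e = 12 * (e / 13) + e / 13 by field.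
apply: lerD; last by rewrite addrC ltW.
rewrite (_ : _ - - v = (s - t)^-1 *: (u s - u t - (s - t) *: - v)); last first.
  by rewrite [RHS]scalerBr scalerA mulVf ?scale1r// subr_eq0.
rewrite (snormZ XB); last first.
  by apply: (semi_innerB XB); [exact: (semi_innerB XB)|exact: (semi_innerZ XB)].
rewrite normfV ler_pdivrMl//; apply: le_trans K _.
by rewrite le_eqVlt; apply/orP; left; apply/eqP; ring.
Unshelve. all: by end_near. Qed.

(** The intervals from T/(n+1) to T - T/(n+1) exhaust (0, T), and their exceptional null sets are
    countably many. *)
Lemma strong_derivative u du : is_weak_derivative T X u du ->
  continuous_in T X u ->
  {ae mu, forall t, D t -> X (du t) /\
    snorm X ((s - t)^-1 *: (u s - u t) - du t) @[s --> t^'] --> (0 : R)}.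
Proof.
move=> wu cu; have Tn0 n : 0 < T / n.+1%:R by rewrite divr_gt0.
have := @ae_foralln _ _ _ mu _ (fun n => @strong_derivative_within u du
  (T / n.+1%:R) (T - T / n.+1%:R) wu cu (Tn0 n) _).
move=> H; apply: (aeS (H _)) => [n|t Ht]; first by rewrite gtrBl.
rewrite /= in_itv/= => /andP[t0 tT].
have m0 : 0 < Num.min t (T - t) by rewrite lt_min t0 subr_gt0.
have [n] : exists n, T / n.+1%:R < Num.min t (T - t).
  exists (Num.truncn (T / Num.min t (T - t))).
  by rewrite ltr_pdivrMr// -ltr_pdivrMl// mulrC truncnS_gt.
rewrite lt_min => /andP[n1 n2]; apply: (Ht n).
by rewrite n1/= ltrBrDl -ltrBrDr.
Qed.

End strong_derivative.

(** * Gronwall estimate *)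

Lemma integral_expR_le (R : realType) (k l c b : R) : 0 <= k -> 0 < l -> c <= b ->
  (\int[lebesgue_measure]_(t in `[c, b]) (k * expR (l * t))%:E <=
    (k * expR (l * b) / l)%:E)%E.
Proof.
move=> k0 l0; rewrite le_eqVlt => /predU1P[->|cb].
  rewrite set_itv1 integral_set1 lee_fin.
  by rewrite divr_ge0 ?mulr_ge0 ?expR_ge0// ltW.
pose F t := k / l * expR (l * t).
have dF t : is_derive t (1 : R) F (k * expR (l * t)).
  have dl : is_derive t (1 : R) (fun t : R => l * t) l.
    have -> : (fun t : R => l * t) = l \*: id by apply/funext.
    by apply: is_derive_eq; rewrite scaler1.
  have de : is_derive t (1 : R) (fun t : R => expR (l * t)) (l * expR (l * t)).
    have := @is_derive1_comp _ expR (fun t : R => l * t) t _ _ (is_derive_expR _) dl.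
    by rewrite mulrC.
  have -> : F = (k / l) \*: (fun t : R => expR (l * t)) by apply/funext.
  apply: is_derive_eq; rewrite /GRing.scale/= mulrA divfK// gt_eqF//.
have cF : continuous F.
  by move=> t; apply/differentiable_continuous/derivable1_diffP; case: (dF t).
have cf : continuous (fun t : R => k * expR (l * t)).
  move=> t; apply: cvgMr.
  apply: (continuous_comp (f := fun t : R => l * t) (g := expR)).
    by apply: cvgMr; exact: cvg_id.
  exact: continuous_expR.
rewrite (@continuous_FTC2 _ _ F)//.
- rewrite lee_fin /F lerBlDr -[leLHS]mulrAC lerDl.
  by rewrite mulr_ge0 ?expR_ge0// divr_ge0// ltW.
- exact: continuous_subspaceT.
- split.
  + by move=> x _; case: (dF x).
  + by apply: cvg_at_right_filter; exact: cF.
  + by apply: cvg_at_left_filter; exact: cF.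
- by move=> x _; rewrite derive1E; exact: derive_val.
Qed.

Section gronwall.
Context {R : realType} {V : lmodType R} {X : seminormed V} {B : V -> V -> R}.
Hypothesis XB : semi_inner X B.
Variable T : R.
Hypothesis T0 : 0 < T.
Local Notation mu := (@lebesgue_measure R).
Local Notation D := (`]0, T[%classic : set R).
Implicit Types (u du : R -> V) (v : V).

Lemma snorm_diff_continuous u1 u2 : continuous_in T X u1 -> continuous_in T X u2 ->
  {within `[0, T], continuous (fun t => snorm X (u1 t - u2 t))}.
Proof.
move=> c1 c2; apply/subspace_continuousP => t tT.
have [X1t c1t] := c1 t tT; have [X2t c2t] := c2 t tT.
apply/subr_cvg0; apply: norm_cvg0.
apply: (@squeeze_cvgr _ _ _ _ (cst 0) (fun s => snorm X (u1 s - u1 t) + snorm X (u2 s - u2 t))).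
- near=> s; rewrite normr_ge0/=.
  have sT : s \in `[0, T] by near: s; exact: withinT.
  have [X1s _] := c1 s sT; have [X2s _] := c2 s sT.
  have Xs := semi_innerB XB X1s X2s; have Xt := semi_innerB XB X1t X2t.
  apply: le_trans (ler_snormB XB Xs Xt) _.
  have -> : u1 s - u2 s - (u1 t - u2 t) = (u1 s - u1 t) - (u2 s - u2 t).
    by rewrite !opprB [u2 t - u1 t]addrC addrACA [- u2 s + _]addrC.
  have X1 := semi_innerB XB X1s X1t; have X2 := semi_innerB XB X2s X2t.
  by apply: le_trans (snormD XB X1 (semi_innerN XB X2)) _; rewrite (snormN XB).
- exact: cvg_cst.
- by have := cvgD c1t c2t; rewrite addr0; exact.
Unshelve. all: by end_near. Qed.

Section bound.
Variables (u1 du1 u2 du2 : R -> V) (C : R).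
Hypothesis w1 : is_weak_derivative T X u1 du1.
Hypothesis c1 : continuous_in T X u1.
Hypothesis w2 : is_weak_derivative T X u2 du2.
Hypothesis c2 : continuous_in T X u2.
Hypothesis C0 : 0 < C.
Hypothesis duC : {ae mu, forall t, D t -> [/\ X (du1 t), X (du2 t) &
  snorm X (du1 t - du2 t) <= C * snorm X (u1 t - u2 t)]}.

Let N t := snorm X (u1 t - u2 t).

(* The weight [expR (- (4 * C * t))] makes the integral bound a contraction by  *)
(* 1/4, and the overshoot [eps] in [scalar_weak_le] costs at most a factor 2.   *)
Let gronwall_step K c e : 0 <= K ->
  (forall t, t \in `[0, T] -> N t <= K * expR (4 * C * t)) ->
  0 < c -> c <= e -> e < T -> N e <= N c + K * expR (4 * C * e) / 2.
Proof.
move=> K0 NK c0 ce eT.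
have l0 : 0 < 4 * C by rewrite mulr_gt0.
pose eps := Num.min (ln 2 / (4 * C)) ((T - e) / 2).
have eps0 : 0 < eps.
  by rewrite lt_min !divr_gt0 ?subr_gt0// ln_gt0// ltr1n.
have epsT : e + eps < T.
  have : eps <= (T - e) / 2 by rewrite ge_min lexx orbT.
  by move: (eps) => x; lra.
have exp2 : expR (4 * C * eps) <= 2.
  rewrite -[leRHS](@lnK R 2) ?posrE// ler_expR -ler_pdivlMl// mulrC.
  by rewrite ge_min lexx.
have eI : e \in `[0, T] by rewrite in_itv/=; lra.
have cI : c \in `[0, T] by rewrite in_itv/=; lra.
have [X1e _] := c1 eI; have [X2e _] := c2 eI.
have [X1c _] := c1 cI; have [X2c _] := c2 cI.
have Xe := semi_innerB XB X1e X2e; have Xc := semi_innerB XB X1c X2c.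
have Ne0 : 0 <= N e by exact: (snorm_ge0 XB).
have Nc0 : 0 <= N c by exact: (snorm_ge0 XB).
have [Nez|Nez] := eqVneq (N e) 0.
  by rewrite Nez addr_ge0// divr_ge0// mulr_ge0// expR_ge0.
have Negt : 0 < N e by rewrite lt_neqAle eq_sym Nez.
(* Testing with this fixed vector gives N e squared at time e and at most N c * N e at time c, so
   the estimate becomes one for N e after division by N e. *)
set phi := u1 e - u2 e in Xe.
have X1 t : t \in `[0, T] -> X (u1 t) by move=> /c1[].
have X2 t : t \in `[0, T] -> X (u2 t) by move=> /c2[].
have wa := scalar_weakB (form_weak XB w1 X1 Xe) (form_weak XB w2 X2 Xe).
have ca : {within `[0, T], continuous
    ((fun t => B (u1 t) phi) \- (fun t => B (u2 t) phi))}.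
  have cB1 := form_continuous XB c1 Xe; have cB2 := form_continuous XB c2 Xe.
  by move=> t; exact: cvgB (cB1 t) (cB2 t).
have k0 : 0 <= C * N e * K by rewrite !mulr_ge0// ltW.
have cG : continuous (fun t : R => (C * N e * K) * expR (4 * C * t)).
  move=> t; apply: cvgMr.
  apply: (continuous_comp (f := fun t : R => 4 * C * t) (g := expR)).
    by apply: cvgMr; exact: cvg_id.
  exact: continuous_expR.
have := @scalar_weak_le _ T T0 _ _
  (fun t => ((C * N e * K) * expR (4 * C * t))%:E) c e eps ca wa _ _ _ c0 ce eps0 epsT.
move=> H.
have {}H : (`|B phi phi - B (u1 c - u2 c) phi|%:E <=
    (C * N e * K * expR (4 * C * (e + eps)) / (4 * C))%:E)%E.
  have := integral_expR_le k0 l0 (_ : c <= e + eps).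
  move=> /(_ _) L; apply: le_trans (L _); last by rewrite (le_trans ce)// lerDl ltW.
  rewrite (semi_formB XB X1e X2e Xe) (semi_formB XB X1c X2c Xe).
  apply: H.
  - apply/measurable_EFinP; apply: measurable_funTS.
    exact: continuous_measurable_fun.
  - by move=> t _; rewrite lee_fin mulr_ge0// expR_ge0.
  - apply: (aeS duC) => t Ht /andP[ct te].
    have t0 : 0 < t by exact: lt_le_trans c0 ct.
    have tT : t < T by exact: le_lt_trans te epsT.
    have [|Xd1 Xd2 dC] := Ht; first by rewrite /= in_itv/= t0.
    rewrite lee_fin/= -(semi_formB XB Xd1 Xd2 Xe).
    apply: le_trans (cauchy_schwarz XB (semi_innerB XB Xd1 Xd2) Xe) _.
    have -> : C * N e * K * expR (4 * C * t) = C * (K * expR (4 * C * t)) * N e.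
      by move: (expR _) (N e) => x y; ring.
    rewrite [snorm X phi](_ : _ = N e)// ler_wpM2r//.
    apply: le_trans dC _; rewrite ler_wpM2l ?(ltW C0)//; apply: NK.
    by rewrite in_itv/= !ltW.
move: H; rewrite lee_fin -(semi_form_sqr XB Xe) -/(N e) => H.
have cs := cauchy_schwarz XB Xc Xe; rewrite -/(N c) -/(N e) in cs.
have expe : expR (4 * C * (e + eps)) <= 2 * expR (4 * C * e).
  by rewrite mulrDr expRD mulrC ler_wpM2r// expR_ge0.
have E : C * N e * K * expR (4 * C * (e + eps)) / (4 * C) =
    N e * (K * expR (4 * C * (e + eps)) / 4).
  move: (expR _) (N e) => x y; field; exact: lt0r_neq0.
rewrite E in H.
have K2 : K * expR (4 * C * (e + eps)) / 4 <= K * expR (4 * C * e) / 2.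
  have := ler_wpM2l K0 expe.
  by move: (expR _) (expR _) => x y; lra.
have : N e ^+ 2 <= N e * (N c + K * expR (4 * C * e) / 2).
  apply: (@le_trans _ _ (N c * N e + N e * (K * expR (4 * C * (e + eps)) / 4))).
    rewrite -[leLHS](subrK (B (u1 c - u2 c) phi)) addrC.
    by apply: lerD; [exact: le_trans (ler_norm _) cs|exact: le_trans (ler_norm _) H].
  by rewrite [leRHS]mulrDr [N c * _]mulrC lerD2l ler_wpM2l.
by rewrite expr2 ler_pM2l.
Qed.

(** Let K be the maximum over [0, T] of the norm weighted by exp(-4 C t). [gronwall_step] bounds the
    weighted norm by K / 2 inside the interval and continuity extends this to T, so K <= K / 2. *)
Lemma gronwall : N 0 = 0 -> forall t, t \in `[0, T] -> N t = 0.
Proof.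
move=> N00.
have N0 t : 0 <= N t by exact: (snorm_ge0 XB).
have cN := snorm_diff_continuous c1 c2.
pose g t := expR (- (4 * C * t)) * N t.
have cexp : continuous (fun t : R => expR (- (4 * C * t))).
  move=> t.
  apply: (continuous_comp (f := fun t : R => - (4 * C * t)) (g := expR)).
    by apply: cvgN; apply: cvgMr; exact: cvg_id.
  exact: continuous_expR.
have cg : {within `[0, T], continuous g}.
  move=> t; apply: cvgM; last exact: cN.
  by have := continuous_subspaceT cexp; exact.
have [t0 t0I maxg] := EVT_max (ltW T0) cg.
set K := g t0 in maxg.
have g0 t : 0 <= g t by rewrite mulr_ge0// expR_ge0.
have NE t : N t = g t * expR (4 * C * t).
  by rewrite /g mulrAC -expRD addNr expR0 mul1r.
have NK t : t \in `[0, T] -> N t <= K * expR (4 * C * t).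
  by move=> /maxg; rewrite NE => H; rewrite ler_wpM2r// expR_ge0.
have /continuous_within_itvP[//|_ cN0 _] := cN.
have /continuous_within_itvP[//|_ _ cgT] := cg.
have inner_bound e : 0 < e < T -> g e <= K / 2.
  move=> /andP[e0 eT].
  rewrite -(@ler_pM2r _ (expR (4 * C * e))) ?expR_gt0// -NE.
  rewrite [leRHS]mulrAC.
  (* [gronwall_step] bounds this quantity by N c for every small c > 0; letting c tend to 0 brings
     in N 0 = 0. *)
  suff : N e - K * expR (4 * C * e) / 2 <= N 0 by rewrite N00 subr_le0.
  apply: (cvgr_to_ge cN0); near=> c.
  rewrite lerBlDr; apply: gronwall_step => //; first exact: g0.
  by apply/ltW; near: c; exact: nbhs_right_lt.
have K2 t : t \in `[0, T] -> g t <= K / 2.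
  rewrite in_itv/= => /andP[]; rewrite le_eqVlt => /predU1P[<-|tgt0].
    by rewrite {1}/g N00 mulr0 divr_ge0// g0.
  rewrite le_eqVlt => /predU1P[->|tT]; last by rewrite inner_bound// tgt0.
  apply: (cvgr_to_le cgT); near=> e; apply: inner_bound.
  by apply/andP; split=> //; near: e; exact: nbhs_left_gt.
have K0 : K <= 0 by have := K2 _ t0I; rewrite -/K; lra.
move=> t tI; rewrite NE; have -> : g t = 0; last by rewrite mul0r.
by apply/eqP; rewrite eq_le g0 andbT (le_trans (maxg t tI) K0).
Unshelve. all: by end_near. Qed.

End bound.
End gronwall.

(** * Bounded coefficients *)

Lemma semi_formBr (R : realType) (V : lmodType R) (X : seminormed V)
    (B : V -> V -> R) (XB : semi_inner X B) u v w : X u -> X v -> X w ->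
  B w (u - v) = B w u - B w v.
Proof.
move=> Xu Xv Xw; have Xuv := semi_innerB XB Xu Xv.
by rewrite !(semi_formC XB Xw)// (semi_formB XB).
Qed.

Lemma semi_form_congr (R : realType) (V : lmodType R) (X : seminormed V)
    (B : V -> V -> R) (XB : semi_inner X B) u v w : X u -> X v -> X w ->
  snorm X (u - v) = 0 -> B u w = B v w.
Proof.
move=> Xu Xv Xw uv0; apply/eqP; rewrite -subr_eq0 -normr_le0 -(semi_formB XB)//.
by apply: le_trans (cauchy_schwarz XB (semi_innerB XB Xu Xv) Xw) _; rewrite uv0 mul0r.
Qed.

Section coefficients.
Context {R : realType} {d : nat} (Omega : set 'rV[R]_d).
Hypothesis Omega_open : open Omega.
Local Notation E := 'rV[R]_d.
Local Notation L2 := (L2_space Omega).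
Local Notation H1 := (H1_space Omega).
Local Notation sipL2 := (L2_semi_inner Omega).
Implicit Types (a g u v : E -> R) (G : 'I_d -> E -> R).

Let mOmega : measurable Omega := open_measurable_rV Omega_open.

Definition coefficient a C := [/\ measurable_fun setT (a \_ Omega), 0 <= C &
  {ae lebd, forall x, Omega x -> `|a x| <= C}].

Lemma coefficient_L2 a C g : coefficient a C -> L2 g ->
  L2 (a \* g) /\ snorm L2 (a \* g) <= C * snorm L2 g.
Proof. by move=> [ma C0 aC] Lg; exact: L2_mul_dominated. Qed.

Lemma inner_coercive a (C a0 : R) g : coefficient a C ->
  {ae lebd, forall x, Omega x -> a0 <= a x} -> L2 g ->
  a0 * snorm L2 g ^+ 2 <= inner Omega (a \* g) g.
Proof.
move=> aC a0a Lg; have [Lag _] := coefficient_L2 aC Lg; have [ma _ _] := aC.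
have La0g := semi_innerZ sipL2 a0 Lg.
(* The lower bound on [a] holds only almost everywhere; |a - a0| in place of a - a0 makes the
   integrand nonnegative everywhere without changing the integral. *)
have mb : measurable_fun setT ((fun x => `|a x - a0|) \_ Omega).
  apply/(measurable_restrictT _ mOmega).
  apply: (measurableT_comp (@normr_measurable R setT)).
  apply: measurable_funB => //; exact/(measurable_restrictT _ mOmega).
rewrite -subr_ge0 (semi_form_sqr sipL2)// -(semi_formZ sipL2)// -(semi_formB sipL2)//.
rewrite -(@inner_ae_eq _ _ _ (fun x => `|a x - a0| * g x))//.
- rewrite /inner; apply: Rintegral_ge0 => x _.
  by rewrite -mulrA -expr2 mulr_ge0 ?sqr_ge0.
- rewrite (patch_mul Omega (fun x => `|a x - a0|) g).
  by apply: measurable_funM => //; exact: L2_measurable.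
- exact: (semi_innerB sipL2).
- apply: (aeS a0a) => x a0x /a0x le; rewrite ger0_norm ?subr_ge0//.
  by rewrite mulrBl.
Qed.

Definition L2_vec_space : seminormed ('I_d -> E -> R) :=
  Seminormed [set G | forall i, L2 (G i)] (fun G => Num.sqrt (inner_vec Omega G G)).

Lemma L2_vec_semi_inner : semi_inner L2_vec_space (inner_vec Omega).
Proof.
split => //.
- by move=> i; exact: (semi_inner0 sipL2).
- by move=> G1 G2 L1 L2' i; exact: (semi_innerD sipL2).
- by move=> c G LG i; exact: (semi_innerZ sipL2).
- by move=> G1 G2 G L1 L2' LG; exact: inner_vecDl.
- by move=> c G1 G L1 LG; exact: inner_vecZl.
- by move=> G1 G2 L1 L2'; exact: inner_vecC.
- by move=> G LG; rewrite sqr_sqrtr// inner_vec_ge0.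
- by move=> G; exact: sqrtr_ge0.
Qed.

Local Notation L2v := L2_vec_space.
Local Notation sipL2v := L2_vec_semi_inner.

Lemma H1_grad_vec u : H1 u -> L2v (grad Omega u).
Proof. by move=> Hu i; exact: H1_grad. Qed.

Lemma H1_snorm_sqr_vec u : H1 u ->
  snorm H1 u ^+ 2 = snorm L2 u ^+ 2 + snorm L2v (grad Omega u) ^+ 2.
Proof.
by move=> Hu; rewrite H1_snorm_sqr// (semi_form_sqr sipL2v)//; exact: H1_grad_vec.
Qed.

Lemma grad_le_H1 u : H1 u -> snorm L2v (grad Omega u) <= snorm H1 u.
Proof.
move=> Hu; rewrite -(@ler_pXn2r _ 2)// ?nnegrE ?(snorm_ge0 sipL2v)//.
  by rewrite (H1_snorm_sqr_vec Hu) lerDr sqr_ge0.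
exact: (snorm_ge0 (H1_semi_inner Omega_open)).
Qed.

Lemma grad_norm_vec u : H1 u -> fine (grad_norm Omega u) = snorm L2v (grad Omega u).
Proof.
move=> Hu; apply/eqP; rewrite -(@eqrXn2 _ 2)// ?(snorm_ge0 sipL2v)//.
  rewrite inner_vec_grad_sqr// -(semi_form_sqr sipL2v)//; exact: H1_grad_vec.
by rewrite fine_ge0// /grad_norm; case: asboolP => // _; exact: Lnorm_ge0.
Qed.

Lemma coefficient_vec a C G : coefficient a C -> L2v G ->
  L2v (scale_vec a G) /\ snorm L2v (scale_vec a G) <= C * snorm L2v G.
Proof.
move=> aC LG; have [_ C0 _] := aC.
have LaG : L2v (scale_vec a G) by move=> i; exact: (coefficient_L2 aC (LG i)).1.
split=> //; rewrite -(@ler_pXn2r _ 2)// ?nnegrE ?mulr_ge0 ?(snorm_ge0 sipL2v)//.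
rewrite exprMn !(semi_form_sqr sipL2v)// /inner_vec mulr_sumr.
apply: ler_sum => i _; rewrite -(semi_form_sqr sipL2 (LG i)) -(semi_form_sqr sipL2 (LaG i)).
rewrite -exprMn lerXn2r ?nnegrE ?mulr_ge0 ?(snorm_ge0 sipL2)//.
exact: (coefficient_L2 aC (LG i)).2.
Qed.

Lemma inner_vec_coercive a (C a0 : R) G : coefficient a C ->
  {ae lebd, forall x, Omega x -> a0 <= a x} -> L2v G ->
  a0 * snorm L2v G ^+ 2 <= inner_vec Omega (scale_vec a G) G.
Proof.
move=> aC a0a LG; rewrite (semi_form_sqr sipL2v)// /inner_vec mulr_sumr.
apply: ler_sum => i _; rewrite -(semi_form_sqr sipL2); last exact: LG.
exact: inner_coercive aC a0a (LG i).
Qed.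

Lemma inner_vec_gradB u v G : H1 u -> H1 v -> L2v G ->
  inner_vec Omega (grad Omega (u - v)) G =
  inner_vec Omega (grad Omega u) G - inner_vec Omega (grad Omega v) G.
Proof.
move=> Hu Hv LG; have Huv := semi_innerB (H1_semi_inner Omega_open) Hu Hv.
have LGu := H1_grad_vec Hu; have LGv := H1_grad_vec Hv.
rewrite -(semi_formB sipL2v)//; apply: inner_vec_ae_eq => //.
- by move=> i; apply: grad_measurable => //; exact: H1_weak.
- exact: (semi_innerB sipL2v).
- move=> i; have HNv := semi_innerN (H1_semi_inner Omega_open) Hv.
  apply: (aeS2 (gradD Omega_open i (H1_weak Hu) (H1_weak HNv))
    (gradZ Omega_open (-1) i (H1_weak Hv))) => x; rewrite scaleN1r => e1 e2 Ox.
  by rewrite e1// !fctE e2// !fctE scaleN1r.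
Qed.

Lemma scale_vec_sym a G1 G2 :
  inner_vec Omega (scale_vec a G1) G2 = inner_vec Omega (scale_vec a G2) G1.
Proof.
apply: eq_bigr => i _; apply: eq_Rintegral => x _.
by rewrite /scale_vec /= mulrAC.
Qed.

(** Moving the coefficient onto the other factor leaves a bare gradient, whose almost everywhere
    linearity finishes. *)
Lemma elliptic_gradBl a C u v G : coefficient a C -> H1 u -> H1 v -> L2v G ->
  inner_vec Omega (scale_vec a (grad Omega (u - v))) G =
  inner_vec Omega (scale_vec a (grad Omega u)) G -
  inner_vec Omega (scale_vec a (grad Omega v)) G.
Proof.
move=> aC Hu Hv LG; have [LaG _] := coefficient_vec aC LG.
have Huv := semi_innerB (H1_semi_inner Omega_open) Hu Hv.
rewrite !(scale_vec_sym a _ G).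
rewrite !(semi_formC sipL2v LaG) ?inner_vec_gradB//; exact: H1_grad_vec.
Qed.

Lemma elliptic_gradBr a C u v G : coefficient a C -> H1 u -> H1 v -> L2v G ->
  inner_vec Omega (scale_vec a G) (grad Omega (u - v)) =
  inner_vec Omega (scale_vec a G) (grad Omega u) -
  inner_vec Omega (scale_vec a G) (grad Omega v).
Proof. by move=> aC Hu Hv LG; rewrite !(scale_vec_sym a G) (elliptic_gradBl aC). Qed.

Lemma elliptic_bound a C G1 G2 : coefficient a C -> L2v G1 -> L2v G2 ->
  `|inner_vec Omega (scale_vec a G1) G2| <= C * snorm L2v G1 * snorm L2v G2.
Proof.
move=> aC L1 L2'; have [LaG le] := coefficient_vec aC L1.
apply: le_trans (cauchy_schwarz sipL2v LaG L2') _.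
by rewrite ler_wpM2r// (snorm_ge0 sipL2v).
Qed.

End coefficients.

(** * Energy estimate *)

(** The constant is determinant over trace of the matrix of the form, which is at most its smallest
    eigenvalue since the trace exceeds the largest one. *)
Lemma quadratic_gap (R : realType) (r e c a b : R) : 0 < r -> 0 < e ->
  c ^+ 2 < 4 * r * e ->
  (4 * r * e - c ^+ 2) / (4 * (r + e)) * (a ^+ 2 + b ^+ 2) <=
    r * a ^+ 2 + e * b ^+ 2 - c * a * b.
Proof.
move=> r0 e0 ce; set g := _ / _.
have re0 : 0 < 4 * (r + e) by rewrite mulr_gt0// addr_gt0.
have gE : g * (4 * (r + e)) = 4 * r * e - c ^+ 2 by rewrite /g divfK// gt_eqF.
have g_lt : g < r.
  rewrite /g ltr_pdivrMr//; apply: (@le_lt_trans _ _ (4 * r * e)).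
    by rewrite lerBlDr lerDl sqr_ge0.
  have := mulr_gt0 r0 r0; lra.
have g0 : 0 < g by rewrite divr_gt0// subr_gt0.
have rg0 : 0 < r - g by rewrite subr_gt0.
rewrite -subr_ge0 -(@pmulr_rge0 _ (4 * (r - g))); last by rewrite mulr_gt0.
(* Completing the square in a leaves the coefficient 4 (r - g)(e - g) - c^2 in front of b^2, which
   is (2g)^2 by the choice of [g]. *)
have -> : 4 * (r - g) * (r * a ^+ 2 + e * b ^+ 2 - c * a * b - g * (a ^+ 2 + b ^+ 2)) =
    (2 * (r - g) * a - c * b) ^+ 2 +
    (4 * r * e - c ^+ 2 - g * (4 * (r + e)) + (2 * g) ^+ 2) * b ^+ 2 by ring.
rewrite gE subrr add0r -exprMn.
by rewrite addr_ge0 ?sqr_ge0.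
Qed.

(** By [quadratic_gap], g S^2 is at most K N (a + b) <= 2 K N S; dividing by g S gives the bound. *)
Lemma energy_arith (R : realType) (r e c K a b S N : R) : 0 < r -> 0 < e ->
  c ^+ 2 < 4 * r * e -> 0 <= K -> 0 <= N -> 0 <= a -> 0 <= b -> 0 <= S ->
  S ^+ 2 = a ^+ 2 + b ^+ 2 ->
  r * a ^+ 2 + e * b ^+ 2 <= c * a * b + K * N * (a + b) ->
  S <= 2 * K / ((4 * r * e - c ^+ 2) / (4 * (r + e))) * N.
Proof.
move=> r0 e0 ce K0 N0 a0 b0 S0 SE H.
have := quadratic_gap a b r0 e0 ce; set g := _ / (4 * _) => gap.
have re0 : 0 < 4 * (r + e) by rewrite mulr_gt0// addr_gt0.
have g0 : 0 < g by rewrite divr_gt0// subr_gt0.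
have aS : a <= S by rewrite -(@ler_pXn2r _ 2)// SE lerDl sqr_ge0.
have bS : b <= S by rewrite -(@ler_pXn2r _ 2)// SE lerDr sqr_ge0.
have [->|Sn0] := eqVneq S 0.
  apply: mulr_ge0 => //; apply: divr_ge0; last exact: ltW.
  exact: mulr_ge0.
have S_gt0 : 0 < S by rewrite lt_neqAle eq_sym Sn0.
rewrite [leRHS]mulrAC ler_pdivlMr// -(ler_pM2r S_gt0).
have KN : K * N * (a + b) <= K * N * (S + S).
  by rewrite ler_wpM2l ?mulr_ge0// lerD.
have -> : S * g * S = g * S ^+ 2 by ring.
rewrite SE; apply: le_trans gap _; rewrite lerBlDl; apply: le_trans H _.
by rewrite lerD2l; apply: le_trans KN _; rewrite le_eqVlt; apply/orP; left; apply/eqP; ring.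
Qed.

Lemma energy_balance (R : realDomainType) (A1 A2 A3 A4 A5 A6 s1 s2 t3 t4 t5 t6 : R) :
  s1 <= A1 -> s2 <= A2 -> `|A3| <= t3 -> `|A4| <= t4 -> `|A5| <= t5 -> `|A6| <= t6 ->
  A3 + A1 + A2 + A4 - A6 - A5 = 0 -> s1 + s2 <= t3 + t4 + t5 + t6.
Proof. by rewrite !ler_norml; lra. Qed.

Lemma ler_mul3 (R : realDomainType) (k x y m n : R) : 0 <= k -> 0 <= x ->
  0 <= y -> x <= n -> y <= m -> k * x * y <= k * m * n.
Proof.
move=> k0 x0 y0 xn ym; rewrite mulrAC; apply: ler_pM => //; first exact: mulr_ge0.
exact: ler_wpM2l.
Qed.

Section energy.
Context {R : realType} {d : nat} (Omega : set 'rV[R]_d).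
Hypothesis Omega_open : open Omega.
Local Notation E := 'rV[R]_d.
Local Notation L2 := (L2_space Omega).
Local Notation H1 := (H1_space Omega).
Local Notation L2v := (L2_vec_space Omega).
Local Notation sipL2 := (L2_semi_inner Omega).
Local Notation sipH1 := (H1_semi_inner Omega_open).
Local Notation sipL2v := (L2_vec_semi_inner Omega).
Local Notation ip := (inner Omega).
Local Notation iv := (inner_vec Omega).
Local Notation D := (grad Omega).

Variables (rho drho eta kappa p wr wd : E -> R).
Variables (r0 r1 r' e0 e1 k1 P M Q Q' L om W dm : R).
Hypotheses (rho_coef : coefficient Omega rho r1)
  (drho_coef : coefficient Omega drho r')
  (eta_coef : coefficient Omega eta e1) (kappa_coef : coefficient Omega kappa k1)
  (rho_ge : {ae lebd, forall x, Omega x -> r0 <= rho x})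
  (eta_ge : {ae lebd, forall x, Omega x -> e0 <= eta x})
  (r0_gt0 : 0 < r0) (e0_gt0 : 0 < e0)
  (L2p : L2 p) (pP : snorm L2 p <= P)
  (H1wr : H1 wr) (wrM : snorm L2v (D wr) <= M) (wrQ : snorm L2 wr <= Q)
  (L2wd : L2 wd) (wdQ : snorm L2 wd <= Q')
  (L_ge0 : 0 <= L) (om_gt0 : 0 < om) (Wom : om <= `|W|).
Hypothesis small : (P * M * e1 / om) ^+ 2 < 4 * r0 * e0.

(** The constant delivered by [energy_arith]: the numerator gathers the coefficients of the norm of
    [u1 - u2], those behind [P / om] coming from the formula for the source, and the denominator is
    the gap of the quadratic form. *)
Definition energy_const :=
  2 * (r' + k1 + L + P / om * (Q' + k1 * M + L * Q)) /
  ((4 * r0 * e0 - (P * M * e1 / om) ^+ 2) / (4 * (r0 + e0))).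

Section two_solutions.
Variables (u1 u2 du1 du2 dru1 dru2 F1 F2 : E -> R) (h1 h2 : R).
Hypotheses (Hu1 : H1 u1) (Hu2 : H1 u2) (Hdu1 : H1 du1) (Hdu2 : H1 du2)
  (L2dru1 : L2 dru1) (L2dru2 : L2 dru2)
  (dru1E : snorm L2 (dru1 - (drho \* u1 + rho \* du1)) = 0)
  (dru2E : snorm L2 (dru2 - (drho \* u2 + rho \* du2)) = 0)
  (L2F1 : L2 F1) (L2F2 : L2 F2)
  (F12 : snorm L2 (F1 - F2) <= L * snorm L2 (u1 - u2)).

Let eqn dru du u h F phi :=
  ip dru phi + iv (scale_vec eta (D du)) (D phi) +
  iv (scale_vec kappa (D u)) (D phi) = h * ip p phi + ip F phi.

Hypotheses (eq11 : eqn dru1 du1 u1 h1 F1 du1) (eq12 : eqn dru1 du1 u1 h1 F1 du2)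
  (eq21 : eqn dru2 du2 u2 h2 F2 du1) (eq22 : eqn dru2 du2 u2 h2 F2 du2).

Let source du u F := W^-1 * (dm + ip u wd +
  iv (scale_vec eta (D du)) (D wr) +
  iv (scale_vec kappa (D u)) (D wr) - ip F wr).

Hypotheses (h1E : h1 = source du1 u1 F1) (h2E : h2 = source du2 u2 F2).

Let U : E -> R := u1 - u2.
Let V : E -> R := du1 - du2.
Let HU : H1 U := semi_innerB sipH1 Hu1 Hu2.
Let HV : H1 V := semi_innerB sipH1 Hdu1 Hdu2.

(* The equations are tested with [du1] and [du2] separately, so that V need not *)
(* be a test function itself: H^1_0 is never shown to be a vector space.        *)
Let residual phi := ip (drho \* U) phi + ip (rho \* V) phi +
  iv (scale_vec eta (D V)) (D phi) +
  iv (scale_vec kappa (D U)) (D phi) -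
  (h1 - h2) * ip p phi - ip (F1 - F2) phi.

Let mul_subr (a u v : E -> R) : a \* (u - v) = a \* u - a \* v.
Proof. by apply/funext => x; rewrite !fctE /= mulrBr. Qed.

Let residual0 phi : H1 phi -> eqn dru1 du1 u1 h1 F1 phi ->
  eqn dru2 du2 u2 h2 F2 phi -> residual phi = 0.
Proof.
move=> Hphi; rewrite /eqn /residual.
have L2phi := H1_L2 Hphi; have Gphi := H1_grad_vec Hphi.
have LA u : H1 u -> L2 (drho \* u).
  by move=> Hu; exact: (coefficient_L2 drho_coef (H1_L2 Hu)).1.
have LR u : H1 u -> L2 (rho \* u).
  by move=> Hu; exact: (coefficient_L2 rho_coef (H1_L2 Hu)).1.
have LA1 := LA _ Hu1; have LA2 := LA _ Hu2.
have LR1 := LR _ Hdu1; have LR2 := LR _ Hdu2.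
rewrite (semi_form_congr sipL2 L2dru1 (semi_innerD sipL2 LA1 LR1) L2phi dru1E).
rewrite (semi_form_congr sipL2 L2dru2 (semi_innerD sipL2 LA2 LR2) L2phi dru2E).
have EU : ip (drho \* U) phi = ip (drho \* u1) phi - ip (drho \* u2) phi.
  by rewrite -(semi_formB sipL2)//; congr (inner Omega _ _); exact: mul_subr.
have EV : ip (rho \* V) phi = ip (rho \* du1) phi - ip (rho \* du2) phi.
  by rewrite -(semi_formB sipL2)//; congr (inner Omega _ _); exact: mul_subr.
have EF : ip (F1 - F2) phi = ip F1 phi - ip F2 phi by exact: (semi_formB sipL2).
rewrite EU EV EF !(semi_formD sipL2)//.
rewrite (elliptic_gradBl Omega_open eta_coef)// (elliptic_gradBl Omega_open kappa_coef)//.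
move: (inner _ _ _) (inner _ _ _) (inner _ _ _) (inner _ _ _) (inner _ _ _)
  (inner _ _ _) (inner _ _ _) (inner_vec _ _ _) (inner_vec _ _ _)
  (inner_vec _ _ _) (inner_vec _ _ _).
by move=> x1 x2 x3 x4 x5 x6 x7 x8 x9 x10 x11 A1 A2; lra.
Qed.

Let residualV : residual V = 0.
Proof.
have R1 := residual0 Hdu1 eq11 eq21; have R2 := residual0 Hdu2 eq12 eq22.
have LA : L2 (drho \* U) := (coefficient_L2 drho_coef (H1_L2 HU)).1.
have LR : L2 (rho \* V) := (coefficient_L2 rho_coef (H1_L2 HV)).1.
have LF := semi_innerB sipL2 L2F1 L2F2.
have L1 := H1_L2 Hdu1; have L2' := H1_L2 Hdu2.
have GU := H1_grad_vec HU; have GV := H1_grad_vec HV.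
have : residual V = residual du1 - residual du2; last by rewrite R1 R2 subrr.
rewrite /residual [in X in X = _]/V !(semi_formBr sipL2)//.
rewrite (elliptic_gradBr Omega_open eta_coef)// (elliptic_gradBr Omega_open kappa_coef)//.
move: (inner _ _ _) (inner _ _ _) (inner _ _ _) (inner _ _ _) (inner _ _ _)
  (inner _ _ _) (inner _ _ _) (inner _ _ _) (inner_vec _ _ _) (inner_vec _ _ _)
  (inner_vec _ _ _) (inner_vec _ _ _).
by move=> x1 x2 x3 x4 x5 x6 x7 x8 x9 x10 x11 x12; ring.
Qed.

Let a := snorm L2 V.
Let b := snorm L2v (D V).
Let N := snorm H1 U.
Let a_ge0 : 0 <= a := snorm_ge0 sipL2 V.
Let b_ge0 : 0 <= b := snorm_ge0 sipL2v (D V).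
Let N_ge0 : 0 <= N := snorm_ge0 sipH1 U.

(** The term [dm] is common to both sources and cancels. Among the others only the one with [eta]
    contains the difference of time derivatives; it keeps [b], while the rest is bounded by
    multiples of [N]. *)
Lemma source_diff : `|h1 - h2| <=
  om^-1 * (Q' * N + e1 * M * b + k1 * M * N + L * Q * N).
Proof.
have LU := H1_L2 HU; have GU := H1_grad_vec HU; have GV := H1_grad_vec HV.
have LU1 := H1_L2 Hu1; have LU2 := H1_L2 Hu2.
have LW := H1_L2 H1wr; have GW := H1_grad_vec H1wr.
have UN := L2_le_H1 Omega_open HU; have gUN := grad_le_H1 Omega_open HU.
have LF := semi_innerB sipL2 L2F1 L2F2.
have [_ e1_ge0 _] := eta_coef; have [_ k1_ge0 _] := kappa_coef.
have -> : h1 - h2 = W^-1 * (ip U wd + iv (scale_vec eta (D V)) (D wr) +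
    iv (scale_vec kappa (D U)) (D wr) - ip (F1 - F2) wr).
  rewrite h1E h2E /source !(semi_formB sipL2)//.
  rewrite (elliptic_gradBl Omega_open eta_coef)// (elliptic_gradBl Omega_open kappa_coef)//.
  move: (inner _ _ _) (inner _ _ _) (inner _ _ _) (inner _ _ _)
    (inner_vec _ _ _) (inner_vec _ _ _) (inner_vec _ _ _) (inner_vec _ _ _).
  by move=> x1 x2 x3 x4 x5 x6 x7 x8; ring.
rewrite normrM; apply: ler_pM => //.
  rewrite normfV lef_pV2 ?posrE//; exact: lt_le_trans om_gt0 Wom.
have gwr0 := snorm_ge0 sipL2v (D wr); have gU0 := snorm_ge0 sipL2v (D U).
have wr0 := snorm_ge0 sipL2 wr; have U0 := snorm_ge0 sipL2 U.
have wd0 := snorm_ge0 sipL2 wd; have F0 := snorm_ge0 sipL2 (F1 - F2).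
have B1 : `|ip U wd| <= Q' * N.
  apply: le_trans (cauchy_schwarz sipL2 LU L2wd) _.
  by rewrite mulrC; exact: (ler_pM wd0 U0 wdQ UN).
have B2 : `|iv (scale_vec eta (D V)) (D wr)| <= e1 * M * b.
  exact: le_trans (elliptic_bound eta_coef GV GW)
    (ler_mul3 e1_ge0 b_ge0 gwr0 (lexx b) wrM).
have B3 : `|iv (scale_vec kappa (D U)) (D wr)| <= k1 * M * N.
  exact: le_trans (elliptic_bound kappa_coef GU GW)
    (ler_mul3 k1_ge0 gU0 gwr0 gUN wrM).
have B4 : `|ip (F1 - F2) wr| <= L * Q * N.
  apply: le_trans (cauchy_schwarz sipL2 LF LW) _.
  have F12N : snorm L2 (F1 - F2) <= L * N.
    exact: le_trans F12 (ler_wpM2l L_ge0 UN).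
  by rewrite mulrAC; exact: (ler_pM F0 wr0 F12N wrQ).
apply: le_trans (ler_normB _ _) (lerD _ B4).
apply: le_trans (ler_normD _ _) (lerD _ B3).
exact: le_trans (ler_normD _ _) (lerD B1 B2).
Qed.

(** The product of the [b] term of [source_diff] with |(p, V)| <= P a is the mixed term c a b with c
    = P M e1 / om; everything else fits into K N (a + b). *)
Lemma energy_estimate : snorm H1 V <= energy_const * N.
Proof.
have LU := H1_L2 HU; have GU := H1_grad_vec HU; have GV := H1_grad_vec HV.
have LV := H1_L2 HV; have UN := L2_le_H1 Omega_open HU.
have gUN := grad_le_H1 Omega_open HU.
have LF := semi_innerB sipL2 L2F1 L2F2.
have [_ e1_ge0 _] := eta_coef; have [_ k1_ge0 _] := kappa_coef.
have [_ r'_ge0 _] := drho_coef.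
have P_ge0 : 0 <= P by apply: le_trans pP; exact: (snorm_ge0 sipL2).
have M_ge0 : 0 <= M by apply: le_trans wrM; exact: (snorm_ge0 sipL2v).
have Q_ge0 : 0 <= Q by apply: le_trans wrQ; exact: (snorm_ge0 sipL2).
have Q'_ge0 : 0 <= Q' by apply: le_trans wdQ; exact: (snorm_ge0 sipL2).
have om_ge0 : 0 <= om^-1 by rewrite invr_ge0 ltW.
set K := r' + k1 + L + P / om * (Q' + k1 * M + L * Q).
have K0 : 0 <= K.
  apply: addr_ge0; first by rewrite !addr_ge0.
  by rewrite mulr_ge0 ?addr_ge0 ?mulr_ge0.
have HS := H1_snorm_sqr_vec Omega_open HV.
apply: (@energy_arith _ r0 e0 (P * M * e1 / om) K a b (snorm H1 V) N r0_gt0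
  e0_gt0 small K0 N_ge0 a_ge0 b_ge0 (snorm_ge0 sipH1 V) HS).
have c1 := inner_coercive Omega_open rho_coef rho_ge LV.
have c2 := inner_vec_coercive Omega_open eta_coef eta_ge GV.
have gU0 := snorm_ge0 sipL2v (D U).
have U0 := snorm_ge0 sipL2 U.
have c3 : `|ip (drho \* U) V| <= r' * N * a.
  have [LA nA] := coefficient_L2 drho_coef LU.
  apply: le_trans (cauchy_schwarz sipL2 LA LV) (ler_wpM2r a_ge0 _).
  exact: le_trans nA (ler_wpM2l r'_ge0 UN).
have c4 : `|iv (scale_vec kappa (D U)) (D V)| <= k1 * N * b.
  apply: le_trans (elliptic_bound kappa_coef GU GV) (ler_wpM2r b_ge0 _).
  exact: ler_wpM2l k1_ge0 _ _ gUN.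
have c5 : `|ip (F1 - F2) V| <= L * N * a.
  apply: le_trans (cauchy_schwarz sipL2 LF LV) (ler_wpM2r a_ge0 _).
  exact: le_trans F12 (ler_wpM2l L_ge0 UN).
have c6 : `|ip p V| <= P * a.
  exact: le_trans (cauchy_schwarz sipL2 L2p LV) (ler_wpM2r a_ge0 pP).
have c7 : `|(h1 - h2) * ip p V| <=
    om^-1 * (Q' * N + e1 * M * b + k1 * M * N + L * Q * N) * (P * a).
  by rewrite normrM; exact: (ler_pM (normr_ge0 _) (normr_ge0 _) source_diff c6).
apply: le_trans (energy_balance c1 c2 c3 c4 c5 c7 residualV) _.
rewrite -subr_ge0.
set G := P / om * (Q' + k1 * M + L * Q).
have G0 : 0 <= G by rewrite mulr_ge0 ?addr_ge0 ?mulr_ge0.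
(* [K] multiplies both a and b although each lower-order term carries only one of them; what remains
   is this nonnegative surplus. *)
rewrite (_ : _ - _ = k1 * N * a + (r' + L + G) * N * b); last first.
  by rewrite /K /G; move: (a) (b) (N) => x y z; ring.
have T1 := mulr_ge0 (mulr_ge0 k1_ge0 N_ge0) a_ge0.
have T2 := mulr_ge0 (mulr_ge0 (addr_ge0 (addr_ge0 r'_ge0 L_ge0) G0) N_ge0) b_ge0.
exact: addr_ge0 T1 T2.
Qed.

End two_solutions.
End energy.

(** * Product rule in time *)

Section inclusion.
Context {R : realType} {V : lmodType R} (X Y : seminormed V) (T : R).
Hypothesis XY : forall v, X v -> Y v.
Hypothesis snormE : snorm X = snorm Y.
Implicit Types (u du : R -> V).

(** H^1_0 carries the norm of H^1, so a solution can be read in H^1, where the semi-inner product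
    structure is available. *)
Lemma continuous_in_sub u : continuous_in T X u -> continuous_in T Y u.
Proof.
by move=> cu t tT; have [Xut cvgt] := cu t tT; rewrite -snormE; split=> //; exact: XY.
Qed.

Let step_sub (s : step_function X) : step_function Y :=
  StepFunction (@measurable_step_set _ _ _ s) (fun i => XY (@step_valP _ _ _ s i)).

Lemma strongly_measurable_sub u : strongly_measurable T X u -> strongly_measurable T Y u.
Proof.
move=> [s Hs]; exists (step_sub \o s); apply: (aeS Hs) => t H tT.
by have [Xut cvgt] := H tT; rewrite -snormE; split=> //; exact: XY.
Qed.

Lemma bochner_sub u I : is_bochner_integral T X u I -> is_bochner_integral T Y u I.
Proof.
move=> [su XI [s [s1 s2]]]; split.
- exact: strongly_measurable_sub.
- exact: XY.
- by exists (step_sub \o s); rewrite -snormE.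
Qed.

Lemma weak_derivative_sub u du : is_weak_derivative T X u du ->
  is_weak_derivative T Y u du.
Proof.
move=> wu psi tpsi; have [I [I1 I2]] := wu psi tpsi.
by exists I; split; exact: bochner_sub.
Qed.

End inclusion.

Lemma cvg_within_near (T : Type) (U : topologicalType) (F : set_system T)
    {FF : Filter F} (D : set T) (f : T -> U) (l : U) : F D ->
  f x @[x --> within D F] --> l -> f x @[x --> F] --> l.
Proof. by move=> FD H A /H; apply: filterS2 FD => x Dx; exact. Qed.

Section Linfty.
Context {R : realType} {d : nat} (Omega : set 'rV[R]_d).
Hypothesis Omega_open : open Omega.
Local Notation E := 'rV[R]_d.
Local Notation L2 := (L2_space Omega).
Local Notation Linfty := (Linfty_space Omega).
Local Notation sipL2 := (L2_semi_inner Omega).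
Implicit Types (a b g : E -> R).

Lemma Linfty_add a b : Linfty a -> Linfty b -> Linfty (a + b).
Proof. rewrite /= patch_add; exact: (Lfun_addr_closed _ (leey _)).2. Qed.

Lemma Linfty_scale c a : Linfty a -> Linfty (c *: a).
Proof.
move=> La; rewrite /= patch_scale.
have [_ H] := Lfun_submod_closed (lebd : {measure set E -> \bar R}) (leey 1%E).
have [L0 _] := Lfun_addr_closed (lebd : {measure set E -> \bar R}) (leey 1%E).
by rewrite -[_ *: _]addr0; exact: H.
Qed.

Lemma Linfty_sub a b : Linfty a -> Linfty b -> Linfty (a - b).
Proof.
by move=> La Lb; apply: Linfty_add => //; rewrite -scaleN1r; exact: Linfty_scale.
Qed.

Lemma Linfty_coefficient a : Linfty a -> coefficient Omega a (snorm Linfty a).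
Proof.
move=> La; split; first exact: Linfty_measurable.
- by rewrite fine_ge0// Lnorm_ge0.
- exact: Linfty_bound.
Qed.

Lemma Linfty_mul_L2 a g : Linfty a -> L2 g ->
  L2 (a \* g) /\ snorm L2 (a \* g) <= snorm Linfty a * snorm L2 g.
Proof. by move=> La; exact: (coefficient_L2 (Linfty_coefficient La)). Qed.

Section product.
Variables (T : R) (rho u : R -> E -> R) (C : R).
Hypothesis rho_C : continuous_in T Linfty rho.
Hypothesis rho_coef : forall t, t \in `[0, T] -> coefficient Omega (rho t) C.
Hypothesis u_C : continuous_in T L2 u.

Lemma product_continuous_in : continuous_in T L2 (fun t => rho t \* u t).
Proof.
move=> t tT; have [Lrt crt] := rho_C tT; have [Lut cut] := u_C tT.
split; first exact: (Linfty_mul_L2 Lrt Lut).1.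
pose b s := snorm Linfty (rho s - rho t) * (snorm L2 (u s - u t) + snorm L2 (u t)) +
  C * snorm L2 (u s - u t).
have b0 : b s @[s --> within `[0, T] (nbhs t)] --> (0 : R).
  have := cvgD (cvgM crt (cvgD cut (cvg_cst (snorm L2 (u t))))) (cvgMr cut (a := C)).
  by rewrite mul0r mulr0 addr0; exact.
apply: (@squeeze_cvgr _ _ _ _ (cst 0) b) => //; last exact: cvg_cst.
near=> s; rewrite (snorm_ge0 sipL2)/=.
have sT : s \in `[0, T] by near: s; exact: withinT.
have [Lrs _] := rho_C sT; have [Lus _] := u_C sT.
have Ldr := Linfty_sub Lrs Lrt; have Ldu := semi_innerB sipL2 Lus Lut.
have [L1 n1] := Linfty_mul_L2 Ldr Lus.
have [L2' n2] := coefficient_L2 (rho_coef tT) Ldu.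
have -> : rho s \* u s - rho t \* u t =
    (rho s - rho t) \* u s + rho t \* (u s - u t).
  by apply/funext => x; rewrite !fctE /=; ring.
apply: le_trans (snormD sipL2 L1 L2') (lerD _ n2).
apply: le_trans n1 _; apply: ler_wpM2l; first by rewrite fine_ge0// Lnorm_ge0.
by have := snormD sipL2 Ldu Lut; rewrite subrK.
Unshelve. all: by end_near. Qed.

Variables (drho : R -> E -> R) (C' : R) (du dru : E -> R) (t : R).
Hypothesis rho_C1 : C1_in T Linfty rho drho.
Hypothesis drho_coef : forall t, t \in `[0, T] -> coefficient Omega (drho t) C'.
Hypothesis t_in : t \in `]0, T[.
Hypotheses (Ldu : L2 du) (Ldru : L2 dru).
Hypothesis u_deriv :
  snorm L2 ((s - t)^-1 *: (u s - u t) - du) @[s --> t^'] --> (0 : R).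
Hypothesis ru_deriv :
  snorm L2 ((s - t)^-1 *: (rho s \* u s - rho t \* u t) - dru) @[s --> t^'] --> (0 : R).

(** The difference quotient of rho u tends both to [dru] and to the expression of the product rule.
    The distance of these two limits does not depend on s and is bounded by [b s], which tends to
    0. *)
Lemma product_derivative :
  snorm L2 (dru - (drho t \* u t + rho t \* du)) = 0.
Proof.
have tT : t \in `[0, T] by apply: subset_itv_oo_cc; exact: t_in.
have near_t : nbhs t `[0, T]%classic.
  apply: filterS (near_in_itvoo t_in) => x; exact: subset_itv_oo_cc.
have near_t' : t^' `[0, T]%classic by exact: nbhs_dnbhs.
have [_ _ /(_ t tT) /(cvg_within_near near_t') crho] := rho_C1.
have [Lrt _] := rho_C tT; have [Lut cut] := u_C tT.
have Ldrt : Linfty (drho t) by have [_ /(_ t tT)[]] := rho_C1.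
have {}cut : snorm L2 (u s - u t) @[s --> t^'] --> (0 : R).
  apply: cvg_trans (cvg_within_near near_t cut).
  by move=> A /nbhs_dnbhs; exact.
pose w := drho t \* u t + rho t \* du.
have Lw : L2 w.
  apply: (semi_innerD sipL2); first exact: (Linfty_mul_L2 Ldrt Lut).1.
  exact: (Linfty_mul_L2 Lrt Ldu).1.
pose b s := snorm L2 ((s - t)^-1 *: (rho s \* u s - rho t \* u t) - dru) +
  (snorm Linfty ((s - t)^-1 *: (rho s - rho t) - drho t) *
    (snorm L2 (u s - u t) + snorm L2 (u t)) + C' * snorm L2 (u s - u t) +
  C * snorm L2 ((s - t)^-1 *: (u s - u t) - du)).
have b0 : b s @[s --> t^'] --> (0 : R).
  have := cvgD ru_deriv (cvgD (cvgD (cvgM crho (cvgD cut (cvg_cst (snorm L2 (u t)))))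
    (cvgMr cut (a := C'))) (cvgMr u_deriv (a := C))).
  by rewrite mul0r !mulr0 !addr0; exact.
apply/eqP; rewrite eq_le (snorm_ge0 sipL2) andbT.
apply: (cvgr_to_ge b0); near=> s.
have sT : s \in `[0, T] by near: s.
have [Lrs _] := rho_C sT; have [Lus _] := u_C sT.
set k := (s - t)^-1.
have Lru s' : s' \in `[0, T] -> L2 (rho s' \* u s').
  by move=> s'T; have [] := product_continuous_in s'T.
have Lq := semi_innerZ sipL2 k (semi_innerB sipL2 (Lru s sT) (Lru t tT)).
have Lqr := Linfty_sub (Linfty_scale k (Linfty_sub Lrs Lrt)) Ldrt.
have Lsu := semi_innerB sipL2 Lus Lut.
have Lqu := semi_innerB sipL2 (semi_innerZ sipL2 k Lsu) Ldu.
have [L1 n1] := Linfty_mul_L2 Lqr Lus.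
have [L2' n2] := coefficient_L2 (drho_coef tT) Lsu.
have [L3 n3] := coefficient_L2 (rho_coef tT) Lqu.
apply: le_trans (snormB sipL2 Ldru Lq Lw) _.
rewrite (snormBC sipL2 Ldru Lq); apply: lerD => //.
rewrite (_ : _ - w = (k *: (rho s - rho t) - drho t) \* u s +
    drho t \* (u s - u t) + rho t \* (k *: (u s - u t) - du)); last first.
  apply/funext => x; rewrite /w !fctE /=.
  move: (rho s x) (rho t x) (u s x) (u t x) (du x) (drho t x) => x1 x2 x3 x4 x5 x6.
  by rewrite /GRing.scale/=; ring.
have L12 := semi_innerD sipL2 L1 L2'.
apply: le_trans (snormD sipL2 L12 L3) (lerD _ n3).
apply: le_trans (snormD sipL2 L1 L2') (lerD _ n2).
apply: le_trans n1 _; apply: ler_wpM2l; first by rewrite fine_ge0// Lnorm_ge0.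
by have := snormD sipL2 Lsu Lut; rewrite subrK.
Unshelve. all: by end_near. Qed.

End product.
End Linfty.

(** * Uniqueness *)

Section data.
Context {R : realType} {d : nat} (Omega : set 'rV[R]_d).
Hypothesis Omega_open : open Omega.
Local Notation E := 'rV[R]_d.
Local Notation L2 := (L2_space Omega).
Local Notation sipL2 := (L2_semi_inner Omega).
Local Notation H1 := (H1_space Omega).
Implicit Types (a g u : E -> R) (f : R -> R).

Let mOmega : measurable Omega := open_measurable_rV Omega_open.

(** Continuity on a compact interval bounds the set of norms, without which [sup] would carry no
    information. *)
Lemma snorm_le_sup (T : R) (p : R -> E -> R) : 0 < T -> continuous_in T L2 p ->
  forall t, t \in `[0, T] ->
    snorm L2 (p t) <= sup [set snorm L2 (p t) | t in `[0, T]].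
Proof.
move=> T0 cp t tT.
have c0 : continuous_in T L2 (fun=> 0).
  move=> s _; split; first exact: (semi_inner0 sipL2).
  by rewrite subrr (snorm0 sipL2); exact: cvg_cst.
have [c _ maxp] := EVT_max (ltW T0) (snorm_diff_continuous sipL2 cp c0).
apply: ub_le_sup; last by exists t.
exists (snorm L2 (p c)) => _ [s sT <-].
by have := maxp s sT; rewrite !subr0.
Qed.

Lemma lipschitzP f k : k.-lipschitz f -> forall x y, `|f x - f y| <= `|k| * `|x - y|.
Proof.
move=> lf x y; have /= := lf (x, y) (conj I I) => /le_trans; apply.
by rewrite ler_wpM2r// ler_norm.
Qed.

Lemma lipschitz_measurable f k : k.-lipschitz f -> measurable_fun setT f.
Proof.
move=> /lipschitzP lf; apply: continuous_measurable_fun => x.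
apply/subr_cvg0; apply: norm_cvg0.
apply: (@squeeze_cvgr _ _ _ _ (cst 0) (fun y => `|k| * `|y - x|)).
- by apply: nearW => y /=; rewrite normr_ge0/=.
- exact: cvg_cst.
- have id_x : y @[y --> x] --> x by exact: cvg_id.
  have := cvgMr (cvg_norm (cvgB id_x (cvg_cst x))) (a := `|k|).
  by rewrite subrr normr0 mulr0; exact.
Qed.

Hypothesis Omega_bounded : bounded_set Omega.

(** The finite measure of [Omega] enters here; it is needed for the constant part f 0 of f(u). *)
Lemma L2_cst k : L2 (fun=> k).
Proof.
have mk : measurable_fun setT ((fun=> k) \_ Omega : E -> R).
  exact/(measurable_restrictT _ mOmega).
apply: L2P => //.
have -> : (\int[lebd]_x (((fun=> k) \_ Omega : E -> R) x ^+ 2)%:E =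
    \int[lebd]_(x in Omega) (k ^+ 2)%:E)%E.
  rewrite [RHS]integral_mkcond; apply: eq_integral => x _; rewrite !patchE.
  by case: ifP => // _; rewrite expr0n.
rewrite integral_cst//; apply: lte_mul_pinfty => //.
  by rewrite lee_fin sqr_ge0.
exact: bounded_lebesgue_rV_lty.
Qed.

Lemma lipschitz_L2 f k u : k.-lipschitz f -> L2 u -> L2 (f \o u).
Proof.
move=> lf Lu; have Lf0 := L2_cst (f 0).
have mu : measurable_fun Omega u.
  by apply/(measurable_restrictT _ mOmega); exact: L2_measurable.
rewrite (_ : f \o u = (fun x => f (u x) - f 0) + (fun=> f 0)); last first.
  by apply/funext => x; rewrite !fctE /= subrK.
apply: (semi_innerD sipL2) => //.
have [] // := @L2_dominated _ _ Omega `|k| u (fun x => f (u x) - f 0).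
- apply/(measurable_restrictT _ mOmega); apply: measurable_funB => //.
  exact: (measurableT_comp (lipschitz_measurable lf) mu).
- by apply: nearW => x _; have := lipschitzP lf (u x) 0; rewrite subr0.
Qed.

Lemma lipschitz_snorm f k u1 u2 : k.-lipschitz f -> L2 u1 -> L2 u2 ->
  snorm L2 ((f \o u1) - (f \o u2)) <= `|k| * snorm L2 (u1 - u2).
Proof.
move=> lf L1 L2'; have LB := semi_innerB sipL2 L1 L2'.
have Lf := semi_innerB sipL2 (lipschitz_L2 lf L1) (lipschitz_L2 lf L2').
have [] // := @L2_dominated _ _ Omega `|k| (u1 - u2) ((f \o u1) - (f \o u2)).
- exact: L2_measurable.
- by apply: nearW => x _; rewrite !fctE /=; exact: lipschitzP.
Qed.

(** A finite [grad_norm] already contains the weak differentiability of the quotient, hence its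
    measurability, and a square-integrable gradient; the lower bound on rho adds the L^2 bound. *)
Lemma quotient_H1 g (rho : E -> R) (r0 : R) : L2 g -> 0 < r0 ->
  {ae lebd, forall x, Omega x -> r0 <= rho x} ->
  (grad_norm Omega (fun x => g x / rho x)%R < +oo)%E ->
  H1 (fun x => g x / rho x) /\
  snorm L2 (fun x => g x / rho x) <= r0^-1 * snorm L2 g.
Proof.
move=> Lg r0_gt0 rho_ge /(grad_norm_fin Omega_open)[wd Lgrad].
have [[mq _] _] := gradP wd.
have [] // := @L2_dominated _ _ Omega r0^-1 g (fun x => g x / rho x).
- exact/(measurable_restrictT _ mOmega).
- by rewrite invr_ge0 ltW.
- apply: (aeS rho_ge) => x rhox /rhox r0x.
  have rx : 0 < rho x by exact: lt_le_trans r0_gt0 r0x.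
  by rewrite normrM mulrC ler_wpM2r// normfV gtr0_norm// lef_pV2.
Qed.

(** Almost every t is a point of strong differentiability both of u in H^1 and of rho u in L^2. At
    such a t the product rule identifies [dru t], which is introduced independently of [du t]. *)
Lemma solution_product (T : R) (rho drho u du dru : R -> E -> R) (C C' : R) :
  0 < T -> C1_in T (Linfty_space Omega) rho drho ->
  (forall t, t \in `[0, T] -> coefficient Omega (rho t) C) ->
  (forall t, t \in `[0, T] -> coefficient Omega (drho t) C') ->
  continuous_in T H1 u -> is_weak_derivative T H1 u du ->
  is_weak_derivative T L2 (fun t => rho t \* u t) dru ->
  {ae leb1, forall t, t \in `]0, T[ -> [/\ H1 (du t), L2 (dru t) &
    snorm L2 (dru t - (drho t \* u t + rho t \* du t)) = 0]}.
Proof.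
move=> T0 rhoC1 rhoC drhoC' cu wu wru; have [crho _ _] := rhoC1.
have sipH1 := H1_semi_inner Omega_open.
have cuL2 : continuous_in T L2 u.
  move=> t tT; have [Hut cut] := cu t tT; split; first exact: H1_L2.
  apply: (@squeeze_cvgr _ _ _ _ (cst 0) (fun s => snorm H1 (u s - u t))) => //.
    near=> s; rewrite (snorm_ge0 sipL2)/=; apply: L2_le_H1 => //.
    apply: (semi_innerB sipH1) => //.
    have sT : s \in `[0, T] by near: s; exact: withinT.
    by have [] := cu s sT.
  exact: cvg_cst.
have cru := product_continuous_in crho rhoC cuL2.
apply: (aeS2 (strong_derivative sipH1 T0 wu cu) (strong_derivative sipL2 T0 wru cru)).
move=> t Hu Hru tD; have [Hdu du_cvg] := Hu tD; have [Ldru dru_cvg] := Hru tD.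
split => //; have tT : t \in `[0, T] by apply: subset_itv_oo_cc; exact: tD.
apply: (product_derivative crho rhoC cuL2 rhoC1 drhoC' tD (H1_L2 Hdu) Ldru _ dru_cvg).
apply: (@squeeze_cvgr _ _ _ _ (cst 0)
    (fun s => snorm H1 ((s - t)^-1 *: (u s - u t) - du t))) => //.
  near=> s; rewrite (snorm_ge0 sipL2)/=; apply: L2_le_H1 => //.
  apply: (semi_innerB sipH1) => //; apply: (semi_innerZ sipH1).
  have sT : s \in `[0, T].
    apply: subset_itv_oo_cc; near: s; apply: nbhs_dnbhs; exact: near_in_itvoo.
  have [Hus _] := cu s sT; have [Hut _] := cu t tT.
  exact: (semi_innerB sipH1).
exact: cvg_cst.
Unshelve. all: by end_near. Qed.

End data.

(** The smallness condition multiplied by 4 r0 e0 becomes the negative discriminant required by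
    [quadratic_gap]. *)
Lemma smallness_sqr (R : realType) (p M e om e0 r0 z : R) : 0 < om -> 0 < e0 ->
  0 < r0 -> z < 1 -> p ^+ 2 * (M ^+ 2 * e ^+ 2 / (4 * om ^+ 2 * e0 * r0)) < z ->
  (p * M * `|e| / om) ^+ 2 < 4 * r0 * e0.
Proof.
move=> om0 e00 r00 z1 /lt_trans /(_ z1) H.
have -> : (p * M * `|e| / om) ^+ 2 =
    4 * r0 * e0 * (p ^+ 2 * (M ^+ 2 * e ^+ 2 / (4 * om ^+ 2 * e0 * r0))).
  rewrite !exprMn real_normK ?num_real//; field.
  by rewrite !gt_eqF.
by rewrite gtr_pMr// !mulr_gt0.
Qed.

Theorem theorem3p4 (R : realType) (d : nat) (d_gt0 : (0 < d)%N)
    (Omega : set 'rV[R]_d) (T : R)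
    (rho drho eta kappa dkappa p : R -> 'rV[R]_d -> R)
    (rho0 rho1 rho1' eta0 eta1 kappa0 kappa1 kappa1' : R)
    (f : R -> R) (Lf : R) (u0 omega : 'rV[R]_d -> R) (m dm : R -> R)
    (omega_m zeta : R)
    (Omega_domain : lipschitz_domain Omega) (T_gt0 : 0 < T)
    (rho_C1 : C1_in T (Linfty_space Omega) rho drho)
    (rho_H1 : continuous_in T (H1_space Omega) rho)
    (rho0_gt0 : 0 < rho0)
    (rho_bounds : forall t, t \in `[0, T] ->
       {ae lebd, forall x, Omega x -> rho0 <= rho t x <= rho1})
    (drho_bound : forall t, t \in `[0, T] ->
       {ae lebd, forall x, Omega x -> `|drho t x| <= rho1'})
    (eta_C : continuous_in T (Linfty_space Omega) eta)
    (eta0_gt0 : 0 < eta0)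
    (eta_bounds : forall t, t \in `[0, T] ->
       {ae lebd, forall x, Omega x -> eta0 <= eta t x <= eta1})
    (kappa_C1 : C1_in T (Linfty_space Omega) kappa dkappa)
    (kappa0_gt0 : 0 < kappa0)
    (kappa_bounds : forall t, t \in `[0, T] ->
       {ae lebd, forall x, Omega x -> kappa0 <= kappa t x <= kappa1})
    (dkappa_bound : forall t, t \in `[0, T] ->
       {ae lebd, forall x, Omega x -> `|dkappa t x| <= kappa1'})
    (f_lipschitz : Lf.-lipschitz f)
    (u0_H10 : H10_space Omega u0)
    (omega_H10 : H10_space Omega omega)
    (p_C : continuous_in T (L2_space Omega) p) :
  let omega_rho t := fun x => omega x / rho t x in
  let omega_bar t := inner Omega (p t) (omega_rho t) in
  forall
    (omega_bar_C : {within `[0, T], continuous omega_bar})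
    (omega_bar_neq0 : forall t, t \in `[0, T] -> omega_bar t != 0)
    (omega_m_min : [set `|omega_bar t| | t in `[0, T]] omega_m /\
       forall t, t \in `[0, T] -> omega_m <= `|omega_bar t|)
    (m_H1 : H1_time T m dm),
  let M := ereal_sup [set grad_norm Omega (omega_rho t) | t in `[0, T]] in
  let p_norm := sup [set snorm (L2_space Omega) (p t) | t in `[0, T]] in
  forall
    (M_fin : (M < +oo)%E)
    (zeta_gt0 : 0 < zeta) (zeta_lt1 : zeta < 1)
    (smallness : p_norm ^+ 2 * ((fine M) ^+ 2 * eta1 ^+ 2 /
       (4 * omega_m ^+ 2 * eta0 * rho0)) < zeta),
  forall (u1 u2 : R -> 'rV[R]_d -> R) (h1 h2 : R -> R),
    is_solution Omega T rho drho eta kappa p f u0 omega dm u1 h1 ->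
    is_solution Omega T rho drho eta kappa p f u0 omega dm u2 h2 ->
    (forall t, t \in `[0, T] ->
       {ae lebd, forall x, Omega x -> u1 t x = u2 t x}) /\
    {ae leb1, forall t, t \in `]0, T[ -> h1 t = h2 t}.
Proof.
move=> wr W cW W_neq0 [om_ex om_le] mH1 M P M_fin zeta_pos zeta_lt1 small u1 u2 h1 h2 S1 S2.
have [_ Omega_open _ Omega_bounded _] := Omega_domain.
have sipH1 := H1_semi_inner Omega_open; have sipL2 := L2_semi_inner Omega.
have H10_H1 v : H10_space Omega v -> H1_space Omega v by case.
have [rhoC drhoC _] := rho_C1; have [kappaC _ _] := kappa_C1.
(* The absolute value supplies the nonnegative constant that [coefficient] asks for. *)
have bounded_coef (a : 'rV[R]_d -> R) (a0 a1 : R) : Linfty_space Omega a -> 0 < a0 ->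
    {ae lebd, forall x, Omega x -> a0 <= a x <= a1} -> coefficient Omega a `|a1|.
  move=> La a0_gt0 Ha; split => //; first exact: Linfty_measurable.
  apply: (aeS Ha) => x Hx /Hx /andP[ax xa].
  by rewrite !ger0_norm ?(le_trans _ xa)// (le_trans (ltW a0_gt0)).
have rho_coef t (tT : t \in `[0, T]) : coefficient Omega (rho t) `|rho1|.
  exact: (bounded_coef _ _ _ (rhoC t tT).1 rho0_gt0 (rho_bounds t tT)).
have eta_coef t (tT : t \in `[0, T]) : coefficient Omega (eta t) `|eta1|.
  exact: (bounded_coef _ _ _ (eta_C t tT).1 eta0_gt0 (eta_bounds t tT)).
have kappa_coef t (tT : t \in `[0, T]) : coefficient Omega (kappa t) `|kappa1|.
  exact: (bounded_coef _ _ _ (kappaC t tT).1 kappa0_gt0 (kappa_bounds t tT)).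
have drho_coef t (tT : t \in `[0, T]) : coefficient Omega (drho t) `|rho1'|.
  split => //; first exact: Linfty_measurable (drhoC t tT).1.
  apply: (aeS (drho_bound t tT)) => x Hx /Hx H; exact: le_trans H (ler_norm _).
have om_gt0 : 0 < omega_m.
  by have [t tT <-] := om_ex; rewrite normr_gt0; exact: W_neq0.
have Lomega : L2_space Omega omega by exact/H1_L2/H10_H1.
have wr_H1 t (tT : t \in `[0, T]) : [/\ H1_space Omega (wr t),
    snorm (L2_space Omega) (wr t) <= rho0^-1 * snorm (L2_space Omega) omega &
    snorm (L2_vec_space Omega) (grad Omega (wr t)) <= fine M].
  have leM : (grad_norm Omega (wr t) <= M)%E by apply: ereal_sup_ubound; exists t.
  have fin := le_lt_trans leM M_fin.
  have rho_ge : {ae lebd, forall x, Omega x -> rho0 <= rho t x}.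
    by apply: (aeS (rho_bounds t tT)) => x Hx /Hx /andP[].
  have [Hwr nwr] := quotient_H1 Omega_open Lomega rho0_gt0 rho_ge fin.
  have g0 : (0 <= grad_norm Omega (wr t))%E.
    by rewrite /grad_norm; case: asboolP => // _; exact: Lnorm_ge0.
  split => //; rewrite -(grad_norm_vec Omega_open Hwr); apply: fine_le => //.
    by rewrite ge0_fin_numE.
  by rewrite ge0_fin_numE// (le_trans g0).
pose Q := rho0^-1 * snorm (L2_space Omega) omega.
pose Q' := `|rho1'| * Q.
have wd_L2 t (tT : t \in `[0, T]) :
    L2_space Omega (fun x => omega x * drho t x / rho t x) /\
    snorm (L2_space Omega) (fun x => omega x * drho t x / rho t x) <= Q'.
  have [Hwr nwr _] := wr_H1 t tT.
  have [Lwd nwd] := coefficient_L2 (drho_coef t tT) (H1_L2 Hwr).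
  have -> : (fun x => omega x * drho t x / rho t x) = drho t \* wr t.
    by apply/funext => x; rewrite /wr /= mulrAC mulrC.
  by split => //; apply: le_trans nwd _; rewrite ler_wpM2l.
have P_le := snorm_le_sup T_gt0 p_C.
have small' := smallness_sqr om_gt0 eta0_gt0 rho0_gt0 zeta_lt1 small.
pose C := energy_const rho0 `|rho1'| eta0 `|eta1| `|kappa1| P (fine M) Q Q' `|Lf| omega_m.
have [h1_L2 cu1 u10 [du1 [dru1 [wu1 du1_L2 wru1 eq1]]]] := S1.
have [h2_L2 cu2 u20 [du2 [dru2 [wu2 du2_L2 wru2 eq2]]]] := S2.
have {}cu1 := continuous_in_sub H10_H1 erefl cu1.
have {}cu2 := continuous_in_sub H10_H1 erefl cu2.
have {}wu1 := weak_derivative_sub H10_H1 erefl wu1.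
have {}wu2 := weak_derivative_sub H10_H1 erefl wu2.
(* The values of [du1] and [du2] are the test functions of the energy estimate, so their membership
   in H^1_0, and not only in H^1, has to be recorded. *)
have [[s1 Hs1] _] := du1_L2; have [[s2 Hs2] _] := du2_L2.
have du1_H10 : {ae leb1, forall t, t \in `]0, T[ -> H10_space Omega (du1 t)}.
  by apply: (aeS Hs1) => t H /H[].
have du2_H10 : {ae leb1, forall t, t \in `]0, T[ -> H10_space Omega (du2 t)}.
  by apply: (aeS Hs2) => t H /H[].
have prod1 := solution_product Omega_open T_gt0 rho_C1 rho_coef drho_coef cu1 wu1 wru1.
have prod2 := solution_product Omega_open T_gt0 rho_C1 rho_coef drho_coef cu2 wu2 wru2.
have estimates : {ae leb1, forall t, t \in `]0, T[ ->
    [/\ H1_space Omega (du1 t), H1_space Omega (du2 t),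
    snorm (H1_space Omega) (du1 t - du2 t) <=
      C * snorm (H1_space Omega) (u1 t - u2 t) &
    `|h1 t - h2 t| <= omega_m^-1 * (Q' * snorm (H1_space Omega) (u1 t - u2 t) +
      `|eta1| * fine M * snorm (L2_vec_space Omega) (grad Omega (du1 t - du2 t)) +
      `|kappa1| * fine M * snorm (H1_space Omega) (u1 t - u2 t) +
      `|Lf| * Q * snorm (H1_space Omega) (u1 t - u2 t))]}.
  apply: (aeS2 (aeI du1_H10 du2_H10) (aeI (aeI prod1 prod2) (aeI eq1 eq2))).
  move=> t [H101 H102] [[p1 p2] [e1 e2]] tD.
  have tT : t \in `[0, T] by apply: subset_itv_oo_cc; exact: tD.
  have {}H101 := H101 tD; have {}H102 := H102 tD.
  have [Hd1 Ld1 prd1] := p1 tD; have [Hd2 Ld2 prd2] := p2 tD.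
  have [eqn1 src1] := e1 tD; have [eqn2 src2] := e2 tD.
  have [Hu1 _] := cu1 t tT; have [Hu2 _] := cu2 t tT.
  have Lu1 := H1_L2 Hu1; have Lu2 := H1_L2 Hu2.
  have LF1 := lipschitz_L2 Omega_open Omega_bounded f_lipschitz Lu1.
  have LF2 := lipschitz_L2 Omega_open Omega_bounded f_lipschitz Lu2.
  have LF12 := lipschitz_snorm Omega_open Omega_bounded f_lipschitz Lu1 Lu2.
  have [Hwr nwr gwr] := wr_H1 t tT; have [Lwd nwd] := wd_L2 t tT.
  have [Lp _] := p_C t tT.
  have rho_ge : {ae lebd, forall x, Omega x -> rho0 <= rho t x}.
    by apply: (aeS (rho_bounds t tT)) => x Hx /Hx /andP[].
  have eta_ge : {ae lebd, forall x, Omega x -> eta0 <= eta t x}.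
    by apply: (aeS (eta_bounds t tT)) => x Hx /Hx /andP[].
  split => //.
  - exact: (energy_estimate Omega_open (rho_coef t tT) (drho_coef t tT) (eta_coef t tT)
      (kappa_coef t tT) rho_ge eta_ge rho0_gt0 eta0_gt0 Lp (P_le t tT) Hwr gwr nwr
      Lwd nwd (normr_ge0 Lf) om_gt0 (om_le t tT) small' Hu1 Hu2 Hd1 Hd2 Ld1 Ld2
      prd1 prd2 LF1 LF2 LF12 (eqn1 _ H101) (eqn1 _ H102) (eqn2 _ H101) (eqn2 _ H102)
      src1 src2).
  - exact: (source_diff Omega_open (eta_coef t tT) (kappa_coef t tT) Hwr gwr nwr
      Lwd nwd (normr_ge0 Lf) om_gt0 (om_le t tT) Hu1 Hu2 Hd1 Hd2 LF1 LF2 LF12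
      src1 src2).
(* [gronwall] asks for a positive constant; |C| + 1 is one whatever the sign of [C]. *)
have U0 t (tT : t \in `[0, T]) : snorm (H1_space Omega) (u1 t - u2 t) = 0.
  apply: (gronwall sipH1 T_gt0 (C := `|C| + 1) wu1 cu1 wu2 cu2) => //.
  - apply: (aeS estimates) => s Hs sD; have [Hd1 Hd2 le _] := Hs sD; split => //.
    apply: le_trans le _; rewrite ler_wpM2r ?(snorm_ge0 sipH1)//.
    by apply: le_trans (ler_norm _) _; rewrite lerDl.
  - have T0I : 0 \in `[0, T] by rewrite in_itv/= lexx ltW.
    have [Hu1 _] := cu1 0 T0I; have [Hu2 _] := cu2 0 T0I.
    apply: (H1_ae0 Omega_open); first exact: (semi_innerB sipH1).
    apply: (aeS2 u10 u20) => x e1 e2 Ox.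
    by rewrite !fctE e1// e2// subrr.
split => [t tT|].
  have [Hu1 _] := cu1 t tT; have [Hu2 _] := cu2 t tT.
  have HU := semi_innerB sipH1 Hu1 Hu2.
  have LU0 : snorm (L2_space Omega) (u1 t - u2 t) = 0.
    apply/eqP; rewrite eq_le (snorm_ge0 sipL2) andbT -(U0 t tT).
    exact: L2_le_H1.
  apply: (aeS (L2_snorm_eq0 (H1_L2 HU) LU0)) => x H Ox.
  by apply/eqP; rewrite -subr_eq0; apply/eqP; exact: (H Ox).
apply: (aeS estimates) => t Ht tD; have [Hd1 Hd2 le hle] := Ht tD.
have tT : t \in `[0, T] by apply: subset_itv_oo_cc; exact: tD.
have HV := semi_innerB sipH1 Hd1 Hd2.
(* With the two functions u equal, the energy estimate annihilates the difference of their time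
   derivatives, and with it the last term in the bound on |h1 - h2|. *)
have gV0 : snorm (L2_vec_space Omega) (grad Omega (du1 t - du2 t)) = 0.
  apply/eqP; rewrite eq_le (snorm_ge0 (L2_vec_semi_inner Omega)) andbT.
  apply: le_trans (grad_le_H1 Omega_open HV) _; apply: le_trans le _.
  by rewrite U0// mulr0.
apply/eqP; rewrite -subr_eq0 -normr_le0; apply: le_trans hle _.
by rewrite U0// gV0 !mulr0 !addr0 mulr0.
Qed.
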